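(* Let $d\ge 3$, $0\le\eta<\frac12$, $\epsilon\in(0,1)$, $\delta\in(0,1)$. Suppose the labeling oracle $\mathcal{O}$ satisfies the $\eta$-bounded noise condition with respect to a unit vector $u$, and the initial unit vector $v_0$ satisfies $\theta(v_0,u)\in[0,\frac\pi2]$. Run ACTIVE-PERCEPTRON with inputs $\mathcal{O}$, $v_0$, $\epsilon$, $\delta$, sample schedule $m_k=\Theta\!\left(\frac{d}{(1-2\eta)^2}\left(\ln\frac{d}{(1-2\eta)^2}+\ln\frac k\delta\right)\right)$ and band widths $b_k=\Theta\!\left(\frac{2^{-k}(1-2\eta)}{\sqrt d\,\ln(k m_k/\delta)}\right)$ (with appropriate absolute constants in the $\Theta$'s). Then with probability at least $1-\delta$: (1) the output $v$ satisfies $\mathbb{P}[\operatorname{sign}(v\cdot X)\neq\operatorname{sign}(u\cdot X)]\le\epsilon$; (2) the number of label queries is $O\!\left(\frac{d}{(1-2\eta)^2}\ln\frac1\epsilon\left(\ln\frac{d}{(1-2\eta)^2}+\ln\frac1\delta+\ln\ln\frac1\epsilon\right)\right)$; (3) the number of unlabeled examples drawn is $O\!\left(\frac{d}{(1-2\eta)^3}\left(\ln\frac{d}{(1-2\eta)^2}+\ln\frac1\delta+\ln\ln\frac1\epsilon\right)^2\frac1\epsilon\ln\frac1\epsilon\right)$; (4) the running time is $O\!\left(\frac{d^2}{(1-2\eta)^3}\left(\ln\frac{d}{(1-2\eta)^2}+\ln\frac1\delta+\ln\ln\frac1\epsilon\right)^2\frac1\epsilon\ln\frac1\epsilon\ri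ght)$.
   Context: $\mathbb{S}^{d-1}$ is the unit sphere in $\mathbb{R}^d$; $X$ is uniform on $\mathbb{S}^{d-1}$. Data $(X,Y)\in\mathbb{S}^{d-1}\times\{-1,+1\}$ are drawn from a distribution $D$ whose marginal on $X$ is uniform on $\mathbb{S}^{d-1}$; the oracle $\mathcal{O}$ queried at $x$ returns an independent draw from the conditional law of $Y$ given $X=x$. For unit vectors, $\theta(v_1,v_2)=\arccos(v_1\cdot v_2)$. $\eta$-bounded noise w.r.t. $u$: for all $x$, $\mathbb{P}[Y\neq\operatorname{sign}(u\cdot x)\mid X=x]\le\eta$. Procedure MODIFIED-PERCEPTRON$(\mathcal{O},w_0,\theta,\delta,m,b)$: for $t=0,\dots,m-1$: let $R_t=\{x\in\mathbb{S}^{d-1}: \frac b2\le w_t\cdot x\le b\}$; draw unlabeled points uniformly from $\mathbb{S}^{d-1}$ until one lies in $R_t$, call it $x_t$, query $\mathcal{O}$ for its label $y_t$; set $w_{t+1}=w_t-2\,\mathbb{1}\{y_t\,w_t\cdot x_t<0\}(w_t\cdot x_t)\,x_t$. Return $w_m$. Algorithm ACTIVE-PERCEPTRON$(\mathcal{O},v_0,\epsilon,\delta,\{m_k\},\{b_k\})$: let $k_0=\lceil\log_2\frac1\epsilon\rceil$; for $k=1,\dots,k_0$ set $v_k=$ MODIFIED-PERCEPTRON$(\mathcal{O},v_{k-1},\frac{\pi}{2^k},\frac{\delta}{k(k+1)},m_k,b_k)$; return $v_{k_0}$. Running time counts arithmetic operations on $d$-dimensional vectors (processing one example costs $O(d)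$).
   Formalization: The O-bounds (2)–(4) are stated for ε at most some absolute constant ε₀ in (0,1): for ε near 1 the displayed bounds tend to 0 or turn negative although at least one label is queried. Claim (1) is stated for all ε in (0,1). *)

(* Defs.v *)
From mathcomp Require Import all_boot all_order all_algebra.
From mathcomp Require Import all_classical all_reals all_analysis.
Set Implicit Arguments. Unset Strict Implicit. Unset Printing Implicit Defensive.
Import Order.TTheory GRing.Theory Num.Theory.
Local Open Scope classical_set_scope.
Local Open Scope ring_scope.

Section Geometry.
Variables (R : realType) (d : nat).

Definition dotv (x y : 'rV[R]_d) : R := \sum_(i < d) x ord0 i * y ord0 i.

Definition sphere : set 'rV[R]_d := [set x | dotv x x = 1].
Definition unit_ball : set 'rV[R]_d := [set x | dotv x x <= 1].

Definition sgnp (a : R) : R := if 0 <= a then 1 else -1.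

Definition borel_d : set (set 'rV[R]_d) :=
  <<s [set B | exists (j : 'I_d) (a : R), B = [set x : 'rV[R]_d | x ord0 j <= a]] >>.

(* d-dimensional Lebesgue measure, as an iterated Lebesgue integral
   of the indicator (Tonelli), coordinates d-1, ..., 0. *)
Definition upd (g : nat -> R) (n : nat) (x : R) : nat -> R :=
  fun k => if k == n then x else g k.

Fixpoint iint (n : nat) (f : (nat -> R) -> \bar R) : \bar R :=
  match n with
  | 0 => f (fun _ => 0)
  | n'.+1 => (\int[@lebesgue_measure R]_(x in setT)
                 iint n' (fun g => f (upd g n' x)))%E
  end.

Definition lebesgue_d (A : set 'rV[R]_d) : \bar R :=
  iint d (fun g => (\1_A (\row_(i < d) g (nat_of_ord i)))%:E).

Definition cone (A : set 'rV[R]_d) : set 'rV[R]_d :=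
  [set y | exists r x, 0 < r <= 1 /\ A x /\ y = r *: x].

(* normalized surface (uniform) measure on the sphere:
   sigma(B) = vol(cone(B /\ S)) / vol(unit ball). *)
Definition sphere_unif (B : set 'rV[R]_d) : R :=
  fine (lebesgue_d (cone (B `&` sphere))) / fine (lebesgue_d unit_ball).

Definition disagreement (v u : 'rV[R]_d) : R :=
  sphere_unif [set x | sgnp (dotv v x) <> sgnp (dotv u x)].

(* q x = P[Y = +1 | X = x]; eta-bounded noise w.r.t. u *)
Definition cond_law (q : 'rV[R]_d -> R) : Prop :=
  (forall B : set R, measurable B -> borel_d (q @^-1` B)) /\
  (forall x, sphere x -> 0 <= q x <= 1).

Definition bounded_noise (eta : R) (u : 'rV[R]_d) (q : 'rV[R]_d -> R) : Prop :=
  forall x, sphere x ->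
    (if sgnp (dotv u x) == 1 then 1 - q x else q x) <= eta.

(* ---- the algorithm, driven by a stream Zs of uniform unlabeled points
   and a stream Us of uniform [0,1] variables used by the oracle ---- *)

Definition band (w : 'rV[R]_d) (b : R) : set 'rV[R]_d :=
  [set x | b / 2 <= dotv w x <= b].

Definition first_in (Zs : nat -> 'rV[R]_d) (S : set 'rV[R]_d) (j : nat)
  : option nat :=
  if `[< exists i, (j <= i)%N /\ S (Zs i) >] then
    Some (get [set i | (j <= i)%N /\ S (Zs i) /\
                       forall i', (j <= i' < i)%N -> ~ S (Zs i')])
  else None.

(* oracle answer at x using the uniform variable uu : +1 w.p. q x *)
Definition oracle_label (q : 'rV[R]_d -> R) (uu : R) (x : 'rV[R]_d) : R :=
  if uu < q x then 1 else -1.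

Definition perceptron_update (w x : 'rV[R]_d) (y : R) : 'rV[R]_d :=
  w - (2 * (if y * dotv w x < 0 then 1 else 0) * dotv w x) *: x.

(* state : (current vector, #unlabeled points drawn, #labels queried) *)
Definition state := ('rV[R]_d * nat * nat)%type.

Definition mp_step (q : 'rV[R]_d -> R) (Zs : nat -> 'rV[R]_d) (Us : nat -> R)
  (b : R) (st : state) : option state :=
  let: (w, j, l) := st in
  match first_in Zs (band w b) j with
  | Some i => let x := Zs i in
              Some (perceptron_update w x (oracle_label q (Us l) x), i.+1, l.+1)
  | None => None
  end.

Fixpoint modified_perceptron q Zs Us (b : R) (m : nat) (st : state)
  : option state :=
  match m with
  | 0 => Some st
  | m'.+1 => obind (modified_perceptron q Zs Us b m') (mp_step q Zs Us b st)
  end.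

Fixpoint ap_rounds q Zs Us (ms : nat -> nat) (bs : nat -> R) (v0 : 'rV[R]_d)
  (n : nat) : option state :=
  match n with
  | 0 => Some (v0, 0%N, 0%N)
  | n'.+1 => obind (modified_perceptron q Zs Us (bs n) (ms n))
                   (ap_rounds q Zs Us ms bs v0 n')
  end.

End Geometry.

Section Schedules.
Variable R : realType.

Definition ceil_nat (x : R) : nat := absz (Num.ceil x).

Definition k0 (eps : R) : nat := ceil_nat (ln (1 / eps) / ln 2).

Definition m_sched (c1 : R) (d : nat) (eta delta : R) (k : nat) : nat :=
  ceil_nat (c1 * (d%:R / (1 - 2 * eta) ^+ 2) *
            (ln (d%:R / (1 - 2 * eta) ^+ 2) + ln (k%:R / delta))).

Definition b_sched (c1 c2 : R) (d : nat) (eta delta : R) (k : nat) : R :=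
  c2 * (2 ^- k) * (1 - 2 * eta) /
  (Num.sqrt d%:R * ln (k%:R * (m_sched c1 d eta delta k)%:R / delta)).

Definition LL (d : nat) (eta eps delta : R) : R :=
  ln (d%:R / (1 - 2 * eta) ^+ 2) + ln (1 / delta) + ln (ln (1 / eps)).

Definition query_bound (d : nat) (eta eps delta : R) : R :=
  d%:R / (1 - 2 * eta) ^+ 2 * ln (1 / eps) * LL d eta eps delta.

Definition unlabeled_bound (d : nat) (eta eps delta : R) : R :=
  d%:R / (1 - 2 * eta) ^+ 3 * (LL d eta eps delta) ^+ 2 * (1 / eps) * ln (1 / eps).

Definition time_bound (d : nat) (eta eps delta : R) : R :=
  (d%:R) ^+ 2 / (1 - 2 * eta) ^+ 3 * (LL d eta eps delta) ^+ 2 * (1 / eps) * ln (1 / eps).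

(* running time: O(d) arithmetic per unlabeled example examined and per
   label query / update *)
Definition run_time (d j l : nat) : R := (d * (j + l))%:R.

End Schedules.

Section Probability.
Variables (R : realType) (dT : measure_display) (T : measurableType dT).

Definition mutually_independent {I : eqType} (P : probability T R)
  (F : I -> set (set T)) : Prop :=
  forall (s : seq I) (A : I -> set T), uniq s ->
    (forall i, i \in s -> F i (A i)) ->
    fine (P (\big[setI/setT]_(i <- s) A i)) = \prod_(i <- s) fine (P (A i)).

Definition stream_sigma (d : nat) (Z : nat -> T -> 'rV[R]_d) (U : nat -> T -> R)
  (i : nat + nat) : set (set T) :=
  match i with
  | inl n => (fun B => Z n @^-1` B) @` @borel_d R d
  | inr n => (fun B => U n @^-1` B) @` (@measurable _ R)
  end.

Definition uniform_sphere_rv (P : probability T R) (d : nat)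
  (X : T -> 'rV[R]_d) : Prop :=
  forall B, @borel_d R d B ->
    measurable (X @^-1` B) /\ P (X @^-1` B) = (sphere_unif B)%:E.

Definition uniform01_rv (P : probability T R) (X : T -> R) : Prop :=
  forall B : set R, measurable B ->
    measurable (X @^-1` B) /\
    P (X @^-1` B) = @lebesgue_measure R (B `&` `[0%R, 1%R]).

End Probability.

(* Main.v *)
Require Import Defs.
From HB Require Import structures.
From mathcomp Require Import all_boot all_order all_algebra.
From mathcomp Require Import all_classical all_reals all_analysis.
From mathcomp Require Import measurable_realfun.
From mathcomp Require Import ring lra zify.
Set Implicit Arguments. Unset Strict Implicit. Unset Printing Implicit Defensive.
Import Order.TTheory GRing.Theory Num.Theory.
Local Open Scope classical_set_scope.
Local Open Scope ring_scope.
Import numFieldNormedType.Exports.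

(* Reflections preserve the uniform law of the sphere, which gives every moment of the pair (w.x, e.x)
   of orthogonal coordinates that is needed: bands of width b have probability of order b sqrt d, and the
   disagreement of two directions is at most a constant times their distance. An update is the
   reflection of w in the hyperplane orthogonal to x, so w stays on the sphere; conditionally on the band,
   exp(lambda |w - u|) contracts in mean by 1 - c (1 - 2 eta)^2 up to an additive term, if lambda is
   proportional to (1 - 2 eta) sqrt d / b. Truncating this exponential at |w - u| = sqrt 3 and adding the
   failure budget of the later rounds gives one supermartingale for the whole run, so with probability
   at least 1 - delta/2 the last round K ends within distance 2^-K / 12 of u. The number of draws is
   controlled by the supermartingale 2^(M - labels) decaying by 1 - p/2 per draw, p being the least
   band probability. *)

(** The drift of r = |w - u| comes from the part of u orthogonal to w, of length s with s^2 = r^2 (1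
    - r^2/4). It is at least r/2 exactly when r <= sqrt 3, whence the truncation there; the initial
    angle gives r <= sqrt 2, which leaves a margin. Two demands on lambda compete: lambda b_k must
    be a small multiple of (1 - 2 eta) sqrt d, for the second-order term of the exponential to stay
    below the first-order gain, and lambda 2^-k must be several times the logarithm of k m_k /
    delta, for round k to fail with probability at most delta / (2 k (k + 1)). The logarithm
    dividing b_k reconciles them; as it contains m_k, the schedule must beat its own logarithm,
    which fixes the order in which the constants are chosen. The uniform measure is only given as
    the volume of a cone, integrated one coordinate at a time, so a reflection is split into maps
    that each move a single coordinate. The label count decides which uniform variable is read next;
    conditioning is replaced by resampling one coordinate of the streams. *)

(** * Function spaces with the product sigma-algebra *)

Section FunctionSpace.
Context {I : eqType} {dE : measure_display} {E : measurableType dE}.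

Definition coordinate_sets : set (set (I -> E)) :=
  [set A | exists i (B : set E), measurable B /\ A = [set g | B (g i)]].

(** Serves twice: over [nat] for the coordinates of an iterated Lebesgue integral, over [nat + nat]
    for the streams of draws and of uniform variables. *)
Definition fspace := g_sigma_algebraType coordinate_sets.
HB.instance Definition _ := Measurable.on fspace.

Definition updf (g : I -> E) (i : I) (x : E) : I -> E :=
  fun k => if k == i then x else g k.

Lemma updfC (g : I -> E) i j x y : i != j ->
  updf (updf g i x) j y = updf (updf g j y) i x.
Proof.
move=> ij; apply/funext => k; rewrite /updf; case: (eqVneq k j) => [->|//].
by rewrite eq_sym (negbTE ij).
Qed.

Lemma updf_updf (g : I -> E) i x y : updf (updf g i x) i y = updf g i y.
Proof. by apply/funext => k; rewrite /updf; case: (k == i). Qed.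

Lemma updf_id (g : I -> E) i : updf g i (g i) = g.
Proof. by apply/funext => k; rewrite /updf; case: eqVneq => [->|//]. Qed.

Lemma updf_same (g : I -> E) i x : updf g i x i = x.
Proof. by rewrite /updf eqxx. Qed.

Lemma updf_other (g : I -> E) i x k : k != i -> updf g i x k = g k.
Proof. by rewrite /updf => /negbTE->. Qed.

Lemma measurable_coord (i : I) : measurable_fun setT (fun g : fspace => g i).
Proof.
move=> _ B mB; rewrite setTI; apply: sub_sigma_algebra; by exists i, B.
Qed.

Lemma measurable_fspace d (T : measurableType d) (F : T -> fspace) :
  (forall i, measurable_fun setT (fun t => F t i)) -> measurable_fun setT F.
Proof.
move=> mF; refine (@measurability d _ T fspace setT F coordinate_sets _ _) => //.
move=> _ [_ [i [B [mB ->]]] <-]; exact: mF.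
Qed.

Lemma measurable_updf (i : I) :
  measurable_fun setT (fun p : fspace * E => updf p.1 i p.2 : fspace).
Proof.
apply: measurable_fspace => k; rewrite /updf; case: eqVneq => _.
  exact: measurable_snd.
exact: (measurableT_comp (measurable_coord k) (@measurable_fst _ _ fspace E)).
Qed.

End FunctionSpace.
Arguments fspace : clear implicits.
Arguments fspace I {dE} E.

(** * Affine substitution on the line *)

Section AffineLine.
Variable R : realType.
Local Notation mu := (@lebesgue_measure R).
Let aff (a h : R) : measurableTypeR R -> measurableTypeR R := fun x => a * x + h.

Let measurable_aff (a h : R) : measurable_fun setT (aff a h).
Proof. by apply: measurable_funD => //; apply: measurable_funM. Qed.

Let pushaff a h : {measure set (measurableTypeR R) -> \bar R} :=
  measure_function_pushforward__canonical__measure_function_Measure mu (measurable_aff a h).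

(** Both sides are measures in [A], and Lebesgue measure is determined by half-open intervals; the
    sign of [a] decides which end of the preimage is open. *)
Lemma lebesgue_measure_affine (a h : R) (A : set (measurableTypeR R)) :
  a != 0 -> measurable A ->
  mu A = (`|a|%:E * pushforward mu (aff a h) A)%E.
Proof.
move=> a0 mA.
have a_gt0 : 0 <= `|a| by [].
pose m := mscale (NngNum a_gt0) (pushaff a h).
apply: (@lebesgue_measure_unique R m) => // _ [[x y]] _ <-.
rewrite lebesgue_measure_itv/= -[RHS]/(`|a|%:E * mu (aff a h @^-1` `]x, y]))%E.
have [agt|alt] := ltP 0 a.
  have -> : aff a h @^-1` `]x, y] = `](x - h) / a, (y - h) / a]%classic.
    apply/seteqP; split => t; rewrite /aff /= !in_itv/= ltr_pdivrMr// ler_pdivlMr//; lra.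
  rewrite lebesgue_measure_itv/= !lte_fin ltr_pM2r ?invr_gt0// ltrD2r.
  case: ifP => _; last by rewrite mule0.
  rewrite -!EFinD -EFinM gtr0_norm//; congr EFin; field; exact: a0.
have alt' : a < 0 by rewrite lt_neqAle a0.
have -> : aff a h @^-1` `]x, y] = `[(y - h) / a, (x - h) / a[%classic.
  apply/seteqP; split => t; rewrite /aff /= !in_itv/= ltr_ndivlMr// ler_ndivrMr//; lra.
rewrite lebesgue_measure_itv/= !lte_fin ltr_nM2r ?invr_lt0// ltrD2r.
case: ifP => _; last by rewrite mule0.
rewrite -!EFinD -EFinM ltr0_norm//; congr EFin; field; exact: a0.
Qed.

Lemma integral_affine (a h : R) (f : R -> \bar R) : a != 0 ->
  measurable_fun setT f -> (forall x, 0 <= f x)%E ->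
  (\int[mu]_(x in setT) f x = `|a|%:E * \int[mu]_(x in setT) f (a * x + h)%R)%E.
Proof.
move=> a0 mf f0.
have a_gt0 : 0 <= `|a| by [].
have := @ge0_integral_pushforward _ _ _ _ _ _ (measurable_aff a h) mu setT f.
rewrite preimage_setT => /(_ measurableT mf) <-; last by move=> *; exact: f0.
have := @ge0_integral_mscale _ _ _ (pushaff a h) setT measurableT (NngNum a_gt0) f mf.
move=> /= <-; last by [].
by apply: eq_measure_integral => A mA _; exact: lebesgue_measure_affine.
Qed.

End AffineLine.

(** * Iterated integrals and maps of a single coordinate *)

Section IteratedIntegral.
Variable R : realType.
Local Notation mu := (@lebesgue_measure R).
Local Notation G := (fspace nat R).
Local Open Scope ereal_scope.

Definition mfun0 (f : G -> \bar R) :=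
  measurable_fun setT f /\ forall g, 0 <= f g.

Definition int1 (i : nat) (f : G -> \bar R) (g : G) : \bar R :=
  \int[mu]_(x in setT) f (updf g i x).

Lemma measurable_slice i (f : G -> \bar R) (g : G) : mfun0 f ->
  measurable_fun setT (fun x : R => f (updf g i x)).
Proof.
move=> [mf _]; apply: (measurableT_comp mf).
apply: measurable_fspace => k; rewrite /updf; by case: eqVneq.
Qed.

Lemma mfun0_int1 i f : mfun0 f -> mfun0 (int1 i f).
Proof.
move=> [mf f0]; split; last by move=> g; apply: integral_ge0.
pose F (p : G * R) := f (updf p.1 i p.2).
have mF : measurable_fun setT F by apply: (measurableT_comp mf); exact: measurable_updf.
exact: (@measurable_fun_fubini_tonelli_F _ _ _ _ _ mu F mF (fun p => f0 _)).
Qed.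

Lemma int1C i j f : i != j -> mfun0 f -> int1 i (int1 j f) = int1 j (int1 i f).
Proof.
move=> ij [mf f0]; apply/funext => g; rewrite /int1.
pose F (p : R * R) := f (updf (updf g i p.1) j p.2).
have mF : measurable_fun setT F.
  apply: (measurableT_comp mf); apply: measurable_fspace => k; rewrite /updf.
  case: eqVneq => _; first exact: measurable_snd.
  by case: eqVneq => _; first exact: measurable_fst.
rewrite (@fubini_tonelli _ _ _ _ _ mu mu F mF (fun p => f0 _)).
apply: eq_integral => x _; apply: eq_integral => y _; rewrite /F /=.
by rewrite updfC.
Qed.

Fixpoint ints (s : seq nat) (f : G -> \bar R) : G -> \bar R :=
  if s is i :: s' then int1 i (ints s' f) else f.

Lemma mfun0_ints s f : mfun0 f -> mfun0 (ints s f).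
Proof. by move=> mf; elim: s => //= i s; exact: mfun0_int1. Qed.

Lemma ints_int1 s i f : i \notin s -> mfun0 f ->
  ints s (int1 i f) = int1 i (ints s f).
Proof.
move=> + mf; elim: s => //= j s IH; rewrite inE negb_or => /andP[ij /IH->].
by rewrite int1C// 1?eq_sym//; exact: mfun0_ints.
Qed.

(** Tonelli moves any chosen coordinate innermost, where a map of that coordinate alone is a
    substitution on the line. *)
Lemma ints_rem s i f : uniq s -> i \in s -> mfun0 f ->
  ints s f = ints (rem i s) (int1 i f).
Proof.
move=> + + mf; elim: s => //= j s IH /andP[js us]; rewrite inE eq_sym.
case: (eqVneq j i) => [<- _|ji /= si]; first by rewrite ints_int1.
by rewrite IH.
Qed.

Lemma ints_scale s (c : R) f : (0 <= c)%R -> mfun0 f ->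
  ints s (fun g => c%:E * f g) = (fun g => c%:E * ints s f g).
Proof.
move=> c0 mf; elim: s => //= i s ->; apply/funext => g; rewrite /int1.
apply: ge0_integralZl_EFin => //.
- by move=> x _; apply: (mfun0_ints s mf).2.
- exact: measurable_slice (mfun0_ints s mf).
Qed.

Lemma int1_affine i (a : R) (h : G -> R) (M : G -> G) f : a != 0%R -> mfun0 f ->
  (forall g x, M (updf g i x) = updf g i (a * x + h g)%R) ->
  int1 i f = (fun g => `|a|%:E * int1 i (f \o M) g).
Proof.
move=> a0 mf hM; apply/funext => g; rewrite /int1.
rewrite (@integral_affine R a (h g))//; last 2 first.
- exact: measurable_slice.
- by move=> x; apply: mf.2.
by congr (_ * _); apply: eq_integral => x _ /=; rewrite hM.
Qed.

(** The condition on [M] says that only coordinate [i] changes and forces the shift [h] to be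
    constant along it, so the Jacobian is the slope [a]. *)
Lemma ints_affine s i (a : R) (h : G -> R) (M : G -> G) f : a != 0%R -> mfun0 f ->
  uniq s -> i \in s -> measurable_fun setT M ->
  (forall g x, M (updf g i x) = updf g i (a * x + h g)%R) ->
  ints s f = (fun g => `|a|%:E * ints s (f \o M) g).
Proof.
move=> a0 mf us si mM hM.
have mfM : mfun0 (f \o M).
  by split=> [|g]; [exact: measurableT_comp mf.1 mM|exact: mf.2].
rewrite (ints_rem us si mf) (int1_affine a0 mf hM) (ints_rem us si mfM).
by rewrite ints_scale//; exact: mfun0_int1.
Qed.

Lemma rev_iotaS n : rev (iota 0 n.+1) = n :: rev (iota 0 n).
Proof. by rewrite -addn1 iotaD rev_cat add0n. Qed.

Lemma iint_ints n (f : G -> \bar R) : iint n f = ints (rev (iota 0 n)) f (fun=> 0%R).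
Proof.
(* [iint] ends at the zero function; the induction needs an arbitrary base point, because each layer
   of integration modifies it. *)
pose iintg := fix iintg n (f : G -> \bar R) (g0 : G) := match n with
  | 0 => f g0
  | n'.+1 => \int[mu]_(x in setT) iintg n' (fun g => f (upd g n' x)) g0 end.
have -> : iint n f = iintg n f (fun=> 0%R).
  by elim: n f => //= n IH f; apply: eq_integral => x _; exact: IH.
have H k m x g0 f' : (k <= m)%N ->
  ints (rev (iota 0 k)) (fun g => f' (upd g m x)) g0 = ints (rev (iota 0 k)) f' (upd g0 m x).
  elim: k g0 => [//|k IH] g0 km; rewrite rev_iotaS/= /int1.
  apply: eq_integral => y _; rewrite IH; last exact: ltnW.
  by congr (ints _ _ _); apply: updfC; rewrite ltn_eqF.
elim: n f (fun=> 0%R) => [//|n IH] f' g0.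
by rewrite rev_iotaS/= /int1; apply: eq_integral => x _; rewrite IH H.
Qed.

End IteratedIntegral.

(** * Borel structure on row vectors *)

Section VectorSpaceBorel.
Variables (R : realType) (d : nat).

Definition halfspaces : set (set 'rV[R]_d) :=
  [set B | exists (j : 'I_d) (a : R), B = [set x : 'rV[R]_d | x ord0 j <= a]].

Definition pvec : Type := 'rV[R]_d.
HB.instance Definition _ := Choice.on pvec.
HB.instance Definition _ := isPointed.Build pvec (0 : 'rV[R]_d).

(** Generated by the same half-spaces as [borel_d], so measurability in [vec] is membership in
    [borel_d]. *)
Definition vec := g_sigma_algebraType (halfspaces : set (set pvec)).
HB.instance Definition _ := Measurable.on vec.

Lemma measurable_entry (j : 'I_d) : measurable_fun setT (fun x : vec => x ord0 j).
Proof.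
apply: (measurability _ (RGenOInfty.measurableE R)) => //.
move=> _ [_ [a ->] <-]; rewrite setTI.
have -> : (fun x : vec => x ord0 j) @^-1` `]a, +oo[%classic =
    ~` [set x : vec | x ord0 j <= a].
  by apply/seteqP; split => x /=; rewrite in_itv/= andbT ltNge => /negP.
by apply: measurableC; apply: sub_sigma_algebra; exists j, a.
Qed.

Lemma measurable_vec dT (T : measurableType dT) (F : T -> vec) :
  (forall j, measurable_fun setT (fun t => F t ord0 j)) -> measurable_fun setT F.
Proof.
move=> mF; refine (@measurability _ _ T vec setT F halfspaces _ _) => //.
move=> _ [_ [j [a ->]] <-].
rewrite (_ : F @^-1` _ = (fun t => F t ord0 j) @^-1` `]-oo, a]%classic); last first.
  by apply/seteqP; split => t /=; rewrite in_itv.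
exact: mF.
Qed.

Lemma measurable_dotv dT (T : measurableType dT) (F H : T -> vec) :
  measurable_fun setT F -> measurable_fun setT H ->
  measurable_fun setT (fun t => dotv (F t) (H t)).
Proof.
move=> mF mH; apply: measurable_sum => i; apply: measurable_funM.
  exact: (measurableT_comp (measurable_entry i)).
exact: (measurableT_comp (measurable_entry i)).
Qed.

Lemma measurable_vecD dT (T : measurableType dT) (F H : T -> vec) :
  measurable_fun setT F -> measurable_fun setT H ->
  measurable_fun setT (fun t => F t + H t : vec).
Proof.
move=> mF mH; apply: measurable_vec => i.
under eq_fun do rewrite mxE.
apply: measurable_funD; exact: (measurableT_comp (measurable_entry i)).
Qed.

Lemma measurable_vecZ dT (T : measurableType dT) (a : T -> R) (H : T -> vec) :
  measurable_fun setT a -> measurable_fun setT H ->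
  measurable_fun setT (fun t => a t *: H t : vec).
Proof.
move=> ma mH; apply: measurable_vec => i.
under eq_fun do rewrite mxE.
by apply: measurable_funM => //; exact: (measurableT_comp (measurable_entry i)).
Qed.

Lemma measurable_vecN dT (T : measurableType dT) (H : T -> vec) :
  measurable_fun setT H -> measurable_fun setT (fun t => - H t : vec).
Proof.
move=> mH; under eq_fun do rewrite -scaleN1r.
exact: measurable_vecZ.
Qed.

End VectorSpaceBorel.

(** * Dot product and reflections *)

Section DotProduct.
Variables (R : realType) (d : nat).
Implicit Types (x y z v w : 'rV[R]_d) (a : R).

Lemma dotvC x y : dotv x y = dotv y x.
Proof. by apply: eq_bigr => i _; rewrite mulrC. Qed.

Lemma dotvDl x y z : dotv (x + y) z = dotv x z + dotv y z.
Proof. by rewrite -big_split; apply: eq_bigr => i _; rewrite mxE mulrDl. Qed.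

Lemma dotvZl a x z : dotv (a *: x) z = a * dotv x z.
Proof. by rewrite big_distrr; apply: eq_bigr => i _; rewrite mxE /= mulrA. Qed.

Lemma dotvNl x z : dotv (- x) z = - dotv x z.
Proof. by rewrite -scaleN1r dotvZl mulN1r. Qed.

Lemma dotvDr x y z : dotv z (x + y) = dotv z x + dotv z y.
Proof. by rewrite dotvC dotvDl !(dotvC z). Qed.

Lemma dotvZr a x z : dotv z (a *: x) = a * dotv z x.
Proof. by rewrite dotvC dotvZl dotvC. Qed.

Lemma dotvNr x z : dotv z (- x) = - dotv z x.
Proof. by rewrite dotvC dotvNl dotvC. Qed.

Definition dotvE := (dotvDl, dotvDr, dotvZl, dotvZr, dotvNl, dotvNr).

Lemma dotv_ge0 x : 0 <= dotv x x.
Proof. by apply: sumr_ge0 => i _; rewrite -expr2 sqr_ge0. Qed.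

Lemma dotv_eq0 x : (dotv x x == 0) = (x == 0).
Proof.
apply/eqP/eqP => [|->]; last by rewrite -(scale0r 0) dotvZl mul0r.
move/eqP; rewrite psumr_eq0; last by move=> i _; rewrite -expr2 sqr_ge0.
move=> /allP x0; apply/rowP => i; have := x0 i (mem_index_enum _).
by rewrite mulf_eq0 orbb mxE => /eqP.
Qed.

Lemma cauchy_schwarz x y : (dotv x y) ^+ 2 <= dotv x x * dotv y y.
Proof.
have [->|y0] := eqVneq y 0.
  by rewrite -(scale0r 0) !dotvE !mul0r !mulr0 expr0n.
have yy : 0 < dotv y y by rewrite lt_neqAle dotv_ge0 andbT eq_sym dotv_eq0.
have := dotv_ge0 (dotv y y *: x - dotv x y *: y).
rewrite !dotvE (dotvC y x) => h.
have : 0 <= dotv y y * (dotv x x * dotv y y - dotv x y ^+ 2) by nra.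
by rewrite pmulr_rge0// subr_ge0.
Qed.

Lemma dotv_le1 x y : dotv x x = 1 -> dotv y y = 1 -> `|dotv x y| <= 1.
Proof.
move=> x1 y1; have := cauchy_schwarz x y; rewrite x1 y1 mulr1 -real_normK ?num_real//.
by rewrite expr_le1 ?normr_ge0.
Qed.

Definition reflect v x : 'rV[R]_d := x - (2 * dotv v x) *: v.

Lemma reflectK v : dotv v v = 1 -> involutive (reflect v).
Proof.
move=> v1 x; rewrite /reflect !dotvE v1 mulr1 -addrA -opprD -scalerDl.
have -> : 2 * dotv v x + 2 * (dotv v x - 2 * dotv v x) = 0 by ring.
by rewrite scale0r subr0.
Qed.

Lemma reflect_dotv v x y : dotv v v = 1 -> dotv (reflect v x) (reflect v y) = dotv x y.
Proof. move=> v1; rewrite /reflect !dotvE v1 (dotvC x v); ring. Qed.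

Lemma reflect_dotvr v x y : dotv v v = 1 -> dotv x (reflect v y) = dotv (reflect v x) y.
Proof. by move=> v1; rewrite -(reflect_dotv _ _ v1) reflectK. Qed.

Lemma reflectZ v a x : reflect v (a *: x) = a *: reflect v x.
Proof. by rewrite /reflect dotvZr scalerBr scalerA; congr (_ - _ *: _); ring. Qed.

Lemma measurable_reflect v : measurable_fun setT (reflect v : vec R d -> vec R d).
Proof.
apply: measurable_vecD => //; apply: measurable_vecN; apply: measurable_vecZ => //.
by apply: measurable_funM => //; exact: measurable_dotv.
Qed.

End DotProduct.

(** * Invariance of the cone measure under reflections *)

Section ReflectionInvariance.
Variables (R : realType) (d : nat).
Local Notation G := (fspace nat R).
Local Notation V := (vec R d).

Definition row_of (g : G) : V := \row_(i < d) g (nat_of_ord i).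

Lemma measurable_row_of : measurable_fun setT row_of.
Proof.
apply: measurable_vec => j; rewrite (_ : (fun g => _) = (fun g : G => g j)).
  exact: measurable_coord.
by apply/funext => g; rewrite mxE.
Qed.

Lemma lebesgue_dE (A : set V) :
  lebesgue_d A = ints (rev (iota 0 d)) (fun g : G => (\1_A (row_of g))%:E) (fun=> 0).
Proof. exact: iint_ints. Qed.

Lemma measurable_updf_fun (i : nat) (phi : G -> R) : measurable_fun setT phi ->
  measurable_fun setT (fun g : G => updf g i (phi g) : G).
Proof.
move=> mphi; apply: measurable_fspace => k; rewrite /updf; case: eqVneq => _ //.
exact: measurable_coord.
Qed.

Section Fix_vector.
Variables (v : 'rV[R]_d) (i0 : 'I_d).
Hypothesis vi0 : v ord0 i0 != 0.
Hypothesis v1 : dotv v v = 1.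
Let s := rev (iota 0 d).
Let us : uniq s. Proof. by rewrite rev_uniq iota_uniq. Qed.
Let mem_s (i : 'I_d) : (i : nat) \in s. Proof. by rewrite mem_rev mem_iota ltn_ord. Qed.
Let rest (g : G) : R := \sum_(k < d | k != i0) v ord0 k * g k.
Let mrest : measurable_fun setT rest.
Proof.
rewrite (_ : rest = fun g => \sum_(k <- [seq k <- index_enum 'I_d | k != i0]) v ord0 k * g k); last first.
  by apply/funext => g; rewrite big_filter.
apply: measurable_sum => k; apply: measurable_funM => //; exact: measurable_coord.
Qed.
Let rest_upd (g : G) x : rest (updf g i0 x) = rest g.
Proof. by apply: eq_bigr => k ki0; rewrite updf_other// val_eqE. Qed.

(** A reflection factored into maps of one coordinate each: [toS] stores v.x in coordinate [i0], the
    shears subtract 2 v_j (v.x) from the others, [flip] turns v.x into its opposite, and [fromS]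
    solves for coordinate [i0] again. The Jacobians |v_i0|, 1, 1 and 1/|v_i0| cancel. *)
Let toS (g : G) : G := updf g i0 (v ord0 i0 * g i0 + rest g).
Let fromS (g : G) : G := updf g i0 ((v ord0 i0)^-1 * g i0 + (- (v ord0 i0)^-1 * rest g)).
Let flip (g : G) : G := updf g i0 (- 1 * g i0 + 0).
Let shear1 (j : 'I_d) (g : G) : G := updf g j (1 * g j + (- 2 * v ord0 j * g i0)).
Let shear (l : seq 'I_d) (g : G) : G := foldr shear1 g l.

Let reflG (g : G) : G := fromS (flip (shear [seq k <- enum 'I_d | k != i0] (toS g))).

Let shearE l (g : G) (k : 'I_d) : uniq l -> i0 \notin l ->
  shear l g k = if k \in l then g k - 2 * v ord0 k * g i0 else g k.
Proof.
elim: l k => //= j l IH k /andP[jl ul]; rewrite !inE negb_or => /andP[ji il].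
rewrite /shear1 /updf (IH _ ul il) (IH i0 ul il) (negbTE il) val_eqE.
case: eqVneq => [->|kj] /=; last exact: IH.
by rewrite (negbTE jl); ring.
Qed.

Let row_reflG g : row_of (reflG g) = reflect v (row_of g).
Proof.
pose l := [seq k <- enum 'I_d | k != i0].
have ul : uniq l by rewrite filter_uniq// enum_uniq.
have il : i0 \notin l by rewrite mem_filter eqxx.
have inl (k : 'I_d) : (k \in l) = (k != i0) by rewrite mem_filter mem_enum andbT.
have dotE : dotv v (row_of g) = v ord0 i0 * g i0 + rest g.
  rewrite /dotv (bigD1 i0)//= mxE; congr (_ + _); apply: eq_bigr => k _; by rewrite mxE.
have toSk (k : 'I_d) : toS g k = if k == i0 then dotv v (row_of g) else g k.
  by rewrite /toS /updf val_eqE dotE.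
have sE (k : 'I_d) : flip (shear l (toS g)) k = if k == i0 then - dotv v (row_of g)
    else g k - 2 * v ord0 k * dotv v (row_of g).
  rewrite /flip /updf val_eqE !shearE// !inl !toSk eqxx.
  by case: eqVneq => [_|ki] /=; ring.
apply/rowP => k; rewrite !mxE /reflG -/l /fromS /updf val_eqE sE eqxx sE.
case: eqVneq => [->|ki]; last by ring.
(* The unit norm of [v] enters here: the coordinates other than [i0] carry 1 - v_i0^2 of it. *)
have -> : rest (flip (shear l (toS g))) = rest g - 2 * dotv v (row_of g) * (1 - v ord0 i0 ^+ 2).
  have -> : 1 - v ord0 i0 ^+ 2 = \sum_(k < d | k != i0) v ord0 k * v ord0 k.
    by rewrite -v1 /dotv (bigD1 i0)//=; ring.
  rewrite /rest mulr_sumr -sumrB; apply: eq_bigr => k' k'i0.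
  by rewrite sE (negbTE k'i0); ring.
have -> : rest g = dotv v (row_of g) - v ord0 i0 * g i0 by rewrite dotE; ring.
by field.
Qed.

Let m_toS : measurable_fun setT toS.
Proof.
apply: measurable_updf_fun; apply: measurable_funD => //; apply: measurable_funM => //.
exact: measurable_coord.
Qed.
Let m_fromS : measurable_fun setT fromS.
Proof.
apply: measurable_updf_fun; apply: measurable_funD; apply: measurable_funM => //.
exact: measurable_coord.
Qed.
Let m_flip : measurable_fun setT flip.
Proof.
apply: measurable_updf_fun; apply: measurable_funD => //; apply: measurable_funM => //.
exact: measurable_coord.
Qed.
Let m_shear1 j : measurable_fun setT (shear1 j).
Proof.
apply: measurable_updf_fun; apply: measurable_funD => //; apply: measurable_funM => //;
  exact: measurable_coord.
Qed.
Let m_shear l : measurable_fun setT (shear l).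
Proof.
elim: l => [|j l IH]; first exact: measurable_id.
exact: (measurableT_comp (m_shear1 j) IH).
Qed.

Let mfun0_comp (f : G -> \bar R) (M : G -> G) : mfun0 f -> measurable_fun setT M ->
  mfun0 (f \o M).
Proof.
by move=> mf mM; split=> [|g]; [exact: measurableT_comp mf.1 mM|exact: mf.2].
Qed.

Let ints_shear l f : mfun0 f -> i0 \notin l -> ints s f = ints s (f \o shear l).
Proof.
elim: l f => [|j l IH] f mf; first by [].
rewrite inE negb_or => /andP[ij il].
rewrite (@ints_affine R s j 1 (fun g => - 2 * v ord0 j * g i0) (shear1 j) f)//; last first.
  move=> g x; rewrite /shear1 updf_updf updf_same updf_other//.
rewrite normr1 IH//; last exact: mfun0_comp.
by apply/funext => g; rewrite mul1e.
Qed.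

Lemma lebesgue_d_reflect_aux (A : set V) : measurable A ->
  lebesgue_d (reflect v @^-1` A) = lebesgue_d A.
Proof.
move=> mA; rewrite !lebesgue_dE -/s.
pose f (g : G) : \bar R := (\1_A (row_of g))%:E.
have mf : mfun0 f.
  split=> [|g]; last by rewrite lee_fin.
  have h : measurable_fun setT ((\1_A : V -> R) \o row_of).
    exact: measurableT_comp (measurable_indic mA) measurable_row_of.
  exact/measurable_EFinP.
have -> : (fun g : G => (\1_(reflect v @^-1` A) (row_of g))%:E) = f \o reflG.
  apply/funext => g; by rewrite /f /comp row_reflG.
rewrite [in RHS](@ints_affine R s i0 (v ord0 i0)^-1 (fun g => - (v ord0 i0)^-1 * rest g) fromS f)//; first last.
- by move=> g x; rewrite /fromS updf_updf updf_same rest_upd.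
- by rewrite invr_eq0.
have mf1 := mfun0_comp mf m_fromS.
rewrite [in RHS](@ints_affine R s i0 (-1) (fun g => 0) flip _ _ mf1)//; last first.
  by move=> g x; rewrite /flip updf_updf updf_same.
have mf2 := mfun0_comp mf1 m_flip.
rewrite [in RHS](@ints_shear [seq k <- enum 'I_d | k != i0] _ mf2)//; last by rewrite mem_filter eqxx.
have mf3 := mfun0_comp mf2 (m_shear [seq k <- enum 'I_d | k != i0]).
rewrite [in RHS](@ints_affine R s i0 (v ord0 i0) rest toS _ _ mf3)//; last first.
  by move=> g x; rewrite /toS updf_updf updf_same rest_upd.
rewrite normrN1 mul1e muleA -EFinM -normrM mulVf// normr1 mul1e.
by [].
Qed.

End Fix_vector.

Lemma lebesgue_d_reflect (v : 'rV[R]_d) (A : set V) : dotv v v = 1 -> measurable A ->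
  lebesgue_d (reflect v @^-1` A) = lebesgue_d A.
Proof.
move=> v1 mA; have [i vi] : exists i, v ord0 i != 0.
  apply: contrapT => /forallNP h.
  have v0 : v = 0 by apply/rowP => i; rewrite mxE; apply/eqP/negPn/negP; exact: h.
  by move: v1; rewrite v0 -(scale0r 0) dotvZl mul0r => /eqP; rewrite eq_sym oner_eq0.
exact: lebesgue_d_reflect_aux vi v1 _ mA.
Qed.

Lemma measurable_sphere : measurable (@sphere R d : set V).
Proof.
have -> : (@sphere R d : set V) = (fun x : V => dotv x x) @^-1` [set 1] by [].
by rewrite -[X in measurable X]setTI; apply: measurable_dotv => //; exact: measurable_set1.
Qed.

(** A point of the cone is recognised by its norm and its radial projection y / |y|; the inverse
    norm is written as a power of [dotv y y] so that [measurable_powR] applies. *)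
Lemma cone_sphereE (B : set V) : cone (B `&` @sphere R d) =
  [set y : V | 0 < dotv y y <= 1] `&` (fun y : V => (dotv y y) `^ (- 2^-1) *: y : V) @^-1` B.
Proof.
have sq (r : R) : 0 < r -> (r ^+ 2) `^ (- 2^-1) = r^-1.
  move=> r0; rewrite powRN -powR_mulrn; last exact: ltW.
  by rewrite -powRrM mulfV ?pnatr_eq0// powRr1// ltW.
apply/seteqP; split=> [y [r [x [/andP[r0 r1] [[Bx x1] ->]]]]|y [/= /andP[y0 y1] By]].
  move: x1; rewrite /sphere/= => x1; split => /=; rewrite !dotvE x1 mulr1.
    by rewrite mulr_gt0//= mulr_ile1// ltW.
  by rewrite -expr2 sq// scalerA mulVf ?gt_eqF// scale1r.
exists (Num.sqrt (dotv y y)), (dotv y y `^ (- 2^-1) *: y).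
have r0 : 0 < Num.sqrt (dotv y y) by rewrite sqrtr_gt0.
have E : dotv y y `^ (- 2^-1) = (Num.sqrt (dotv y y))^-1.
  by rewrite -[in LHS](sqr_sqrtr (ltW y0)) sq.
split; first by rewrite r0/= -sqrtr1 ler_sqrt.
split; last by rewrite E scalerA mulfV ?gt_eqF// scale1r.
split=> //; rewrite /sphere/= !dotvE E -[X in _ * (_ * X)](sqr_sqrtr (ltW y0)).
by field; rewrite gt_eqF.
Qed.

Lemma measurable_cone_sphere (B : set V) : measurable B ->
  measurable (cone (B `&` @sphere R d) : set V).
Proof.
move=> mB; have mdot : measurable_fun setT (fun y : V => dotv y y) by exact: measurable_dotv.
rewrite cone_sphereE; apply: measurableI.
  rewrite (_ : [set y | _] = (fun y : V => dotv y y) @^-1` `]0, 1]%classic); last first.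
    by apply/seteqP; split => y /=; rewrite in_itv.
  by rewrite -[X in measurable X]setTI; apply: mdot.
rewrite -[X in measurable X]setTI; apply: measurable_vecZ => //.
exact: (measurableT_comp (measurable_powR _)).
Qed.

Lemma sphere_unif_reflect (v : 'rV[R]_d) (B : set V) : dotv v v = 1 -> measurable B ->
  sphere_unif (reflect v @^-1` B) = sphere_unif B.
Proof.
move=> v1 mB; rewrite /sphere_unif; congr (fine _ / _).
rewrite -(lebesgue_d_reflect v1 (measurable_cone_sphere mB)); congr lebesgue_d.
apply/seteqP; split=> [y [r [x [r01 [[Bx x1] ->]]]]|y [r [x [r01 [[Bx x1] /= E]]]]].
  exists r, (reflect v x); rewrite reflectZ; split=> //; split=> //; split=> //.
  by rewrite /sphere/= reflect_dotv.
exists r, (reflect v x); rewrite -reflectZ -E reflectK//; split=> //; split=> //; split.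
  by rewrite /= reflectK.
by rewrite /sphere/= reflect_dotv.
Qed.

Lemma sphere_unif_sphere : sphere_unif (@sphere R d) = sphere_unif (setT : set 'rV[R]_d).
Proof. by rewrite /sphere_unif setIid setTI. Qed.

End ReflectionInvariance.

(** * Inequalities for exp and cosh *)

Section RealInequalities.
Variable R : realType.
Implicit Types (x y t s : R).

(** The linear term is kept exact because the gain of a step is of first order; all that is given
    away must be of second order. *)
Lemma expR_quadratic x : expR x <= 1 + x + x ^+ 2 * expR `|x|.
Proof.
have [x0|x0] := leP 0 x.
  rewrite ger0_norm//; have h1 : expR x - 1 <= x * expR x.
    have := expR_ge1Dx (- x); rewrite expRN => h.
    have e0 := expR_gt0 x.
    have : (1 + - x) * expR x <= 1 by rewrite -ler_pdivlMr// div1r.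
    lra.
  nra.
have u0 : 0 < - x by rewrite oppr_gt0.
rewrite ltr0_norm//; have h1 : expR x <= (1 - x)^-1.
  rewrite -[x in expR x]opprK expRN lef_pV2 ?posrE ?expR_gt0//; last lra.
  exact: expR_ge1Dx.
have h2 : 1 <= expR (- x) by have := expR_ge1Dx (- x); lra.
apply: (le_trans h1).
rewrite -[X in X <= _]mul1r ler_pdivrMr; last lra.
have : x ^+ 2 <= x ^+ 2 * expR (- x) by rewrite ler_peMr// sqr_ge0.
set u := x ^+ 2 * _ => hu.
have hx : x ^+ 2 * (1 - x) >= x ^+ 2 by nra.
have : u * (1 - x) >= x ^+ 2 * (1 - x) by rewrite ler_pM2r//; lra.
nra.
Qed.

Definition ch x : R := (expR x + expR (- x)) / 2.

Lemma ch_gt0 x : 0 < ch x.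
Proof. by rewrite divr_gt0// addr_gt0// expR_gt0. Qed.

Lemma chN x : ch (- x) = ch x.
Proof. by rewrite /ch opprK addrC. Qed.

Lemma ch0 : ch 0 = 1.
Proof. by rewrite /ch oppr0 expR0; field. Qed.

Lemma ch_abs x : ch `|x| = ch x.
Proof. by have [x0|x0] := leP 0 x; [rewrite ger0_norm|rewrite ltr0_norm// chN]. Qed.

Lemma ch_addsub x y : ch (x + y) + ch (- x + y) = 2 * (ch x * ch y).
Proof. by rewrite /ch !opprD !opprK !expRD; field. Qed.

Lemma expR_le_ch x : expR `|x| <= 2 * ch x.
Proof.
rewrite -ch_abs /ch mulrC divfK// lerDl; exact: expR_ge0.
Qed.

Lemma expR_half_le2 : expR (2^-1 : R) <= 2.
Proof.
have := expR_ge1Dx (- 2^-1 : R); rewrite expRN => h.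
have e0 := expR_gt0 (2^-1 : R).
by rewrite -[(expR _)^-1]div1r ler_pdivlMr// in h; lra.
Qed.

(* cosh x = (e^x + e^-x)/2 <= 1/(1 - x^2) for |x| < 1, which avoids power series. *)
Lemma ch_le_gauss x : ch x <= expR (2 * x ^+ 2).
Proof.
rewrite -ch_abs; set t := `|x|; have t0 : 0 <= t by exact: normr_ge0.
have -> : x ^+ 2 = t ^+ 2 by rewrite real_normK ?num_real.
have [ht|ht] := leP (2 * t ^+ 2) 1.
  have h1 : expR t * (1 - t) <= 1.
    have := expR_ge1Dx (- t); rewrite expRN => h.
    by rewrite mulrC -ler_pdivlMr ?expR_gt0// div1r.
  have h2 : expR (- t) * (1 + t) <= 1.
    have := expR_ge1Dx t => h.
    by rewrite expRN mulrC ler_pdivrMr ?expR_gt0// mul1r.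
  have t1 : t < 1 by nra.
  have h3 : ch t * (1 - t ^+ 2) <= 1.
    rewrite /ch; have : expR t * (1 - t) * (1 + t) <= 1 + t by nra.
    have : expR (- t) * (1 + t) * (1 - t) <= 1 - t by nra.
    lra.
  apply: (le_trans _ (expR_ge1Dx _)).
  have c0 := ch_gt0 t.
  have : 1 <= (1 + 2 * t ^+ 2) * (1 - t ^+ 2) by nra.
  have h5 : 0 < 1 - t ^+ 2 by nra.
  by move=> h4; rewrite -(ler_pM2r h5); lra.
have ht' : t <= 2 * t ^+ 2 by nra.
apply: (@le_trans _ _ (expR t)); last by rewrite ler_expR.
have : expR (- t) <= expR t by rewrite ler_expR; lra.
by rewrite /ch; lra.
Qed.

(** The degree-four term of the exponential series: a bound on the mean of cosh also bounds the
    fourth moment. *)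
Lemma pow4_le_ch t y : (t * y) ^+ 4 <= 48 * ch (t * y).
Proof.
have h := @expR_ge1Dxn R `|t * y| 3 (normr_ge0 _).
have h2 := expR_le_ch (t * y).
have e4 : `|t * y| ^+ 4 = (t * y) ^+ 4.
  by rewrite -normrX ger0_norm// (_ : 4 = 2 * 2)%N// exprM sqr_ge0.
move: h; rewrite e4 (_ : (3.+1`!)%:R = 24 :> R)//; lra.
Qed.

(** Divided by |y| it reads 1 - s + s^3 >= 0 with s = t |y|. Second and fourth moments thus bound a
    first absolute moment from below. *)
Lemma abs_ge_moments t y : 0 <= t -> t * y ^+ 2 - t ^+ 3 * y ^+ 4 <= `|y|.
Proof.
move=> t0; set u := `|y|; have u0 : 0 <= u by exact: normr_ge0.
have -> : y ^+ 2 = u ^+ 2 by rewrite real_normK ?num_real.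
have -> : y ^+ 4 = u ^+ 4.
  by rewrite -normrX ger0_norm// (_ : 4 = 2 * 2)%N// exprM sqr_ge0.
have E : u - (t * u ^+ 2 - t ^+ 3 * u ^+ 4) = u * (1 - t * u + (t * u) ^+ 3) by ring.
rewrite -subr_ge0 E mulr_ge0//.
have s0 : 0 <= t * u by rewrite mulr_ge0.
set s := t * u in s0 *.
have [s1|s1] := leP s 1.
  have : 0 <= s ^+ 3 by rewrite exprn_ge0.
  lra.
have : s <= s ^+ 3 by rewrite ler_eXnr// ltW.
lra.
Qed.

End RealInequalities.

(** * Expectation of functions bounded on a set of full measure *)

Section BoundedExpectation.
Context dT (T : measurableType dT) (R : realType) (mu : probability T R) (S : set T).
Hypotheses (mS : measurable S) (S1 : mu S = 1%E).

(** Boundedness is asked on [S] only: linear forms are unbounded on the whole space but bounded on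
    the sphere, which carries the mass. *)
Definition bm (f : T -> R) :=
  measurable_fun setT f /\ exists M : R, forall x, S x -> `|f x| <= M.

Definition Ex (f : T -> R) : R := Rintegral mu S f.

Lemma bm_integrable f : bm f -> mu.-integrable S (EFin \o f).
Proof.
move=> [mf [M hM]]; apply: measurable_bounded_integrable => //.
- by apply: (le_lt_trans (probability_le1 mu mS)); rewrite ltry.
- exact: measurable_funTS.
- by exists M; split; rewrite ?num_real // => y My x Sx /=; exact: le_trans (hM _ Sx) (ltW My).
Qed.

Lemma bm_cst c : bm (fun=> c).
Proof. by split=> //; exists `|c|. Qed.

Lemma bmD f g : bm f -> bm g -> bm (fun x => f x + g x).
Proof.
move=> [mf [M hM]] [mg [N hN]]; split; first exact: measurable_funD.
by exists (M + N) => x Sx; apply: (le_trans (ler_normD _ _)); rewrite lerD ?hM ?hN.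
Qed.

Lemma bmM f g : bm f -> bm g -> bm (fun x => f x * g x).
Proof.
move=> [mf [M hM]] [mg [N hN]]; split; first exact: measurable_funM.
by exists (M * N) => x Sx; rewrite normrM ler_pM ?hM ?hN.
Qed.

Lemma bmZ c f : bm f -> bm (fun x => c * f x).
Proof. by move=> bf; apply: bmM => //; exact: bm_cst. Qed.

Lemma bmN f : bm f -> bm (fun x => - f x).
Proof. by move=> bf; under eq_fun do rewrite -mulN1r; exact: bmZ. Qed.

Lemma bmX f n : bm f -> bm (fun x => f x ^+ n).
Proof.
move=> bf; elim: n => [|n IH]; first exact: bm_cst.
by under eq_fun do rewrite exprS; exact: bmM.
Qed.

Lemma bm_bool (b : T -> bool) : measurable_fun setT b -> bm (fun x => (b x)%:R).
Proof.
move=> mb; split.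
  rewrite (_ : (fun x => _) = fun x => if b x then 1 else 0); last first.
    by apply/funext => x; case: (b x).
  exact: measurable_fun_ifT.
by exists 1 => x _; case: (b x); rewrite ?normr1 ?normr0.
Qed.

Lemma bm_sum (I : Type) (s : seq I) (F : I -> T -> R) : (forall i, bm (F i)) ->
  bm (fun x => \sum_(i <- s) F i x).
Proof.
move=> bF; elim: s => [|i s IH].
  by under eq_fun do rewrite big_nil; exact: bm_cst.
by under eq_fun do rewrite big_cons; exact: bmD.
Qed.

Lemma bm_continuous (phi : R -> R) f : continuous phi -> bm f -> bm (fun x => phi (f x)).
Proof.
move=> cphi [mf [M hM]]; split.
  exact: measurableT_comp (continuous_measurable_fun cphi) mf.
have cpt : compact (phi @` `[-M, M]%classic).
  apply: continuous_compact; last exact: segment_compact.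
  exact: continuous_subspaceT.
have [N [_ hN]] := compact_bounded cpt.
exists (N + 1) => x Sx; apply: (hN (N + 1)); first by rewrite ltrDl.
by exists (f x) => //=; rewrite in_itv /= -ler_norml hM.
Qed.

Lemma eq_Ex f g : (forall x, S x -> f x = g x) -> Ex f = Ex g.
Proof. by move=> fg; apply: eq_Rintegral => x /set_mem; exact: fg. Qed.

Lemma Ex_cst c : Ex (fun=> c) = c.
Proof. by rewrite /Ex Rintegral_cst// -[X in fine X]/(mu S) S1 /= mulr1. Qed.

Lemma ExD f g : bm f -> bm g -> Ex (fun x => f x + g x) = Ex f + Ex g.
Proof. by move=> bf bg; apply: RintegralD => //; exact: bm_integrable. Qed.

Lemma ExZ c f : bm f -> Ex (fun x => c * f x) = c * Ex f.
Proof. by move=> bf; apply: RintegralZl => //; exact: bm_integrable. Qed.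

Lemma ExN f : bm f -> Ex (fun x => - f x) = - Ex f.
Proof.
move=> bf; rewrite -mulN1r -ExZ//.
by apply: eq_Ex => x _; rewrite mulN1r.
Qed.

Lemma ExB f g : bm f -> bm g -> Ex (fun x => f x - g x) = Ex f - Ex g.
Proof. by move=> bf bg; rewrite ExD// ?ExN//; exact: bmN. Qed.

Lemma le_Ex f g : bm f -> bm g -> (forall x, S x -> f x <= g x) -> Ex f <= Ex g.
Proof. by move=> bf bg fg; apply: le_Rintegral => //; exact: bm_integrable. Qed.

Lemma Ex_ge0 f : (forall x, S x -> 0 <= f x) -> 0 <= Ex f.
Proof. exact: Rintegral_ge0. Qed.

Lemma Ex_sum (I : Type) (s : seq I) (F : I -> T -> R) : (forall i, bm (F i)) ->
  Ex (fun x => \sum_(i <- s) F i x) = \sum_(i <- s) Ex (F i).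
Proof.
move=> bF; elim: s => [|i s IH].
  by rewrite big_nil -[RHS](Ex_cst 0); apply: eq_Ex => x _; rewrite big_nil.
rewrite big_cons -IH -ExD//; last exact: bm_sum.
by apply: eq_Ex => x _; rewrite big_cons.
Qed.

Lemma Ex_bool (b : T -> bool) : measurable_fun setT b ->
  (Ex (fun x => (b x)%:R))%:E = mu [set x | b x].
Proof.
move=> mb.
have mB : measurable [set x | b x].
  rewrite (_ : [set x | b x] = setT `&` b @^-1` [set true]); last first.
    by rewrite setTI; apply/seteqP; split.
  exact: mb.
have -> : (fun x => (b x)%:R) = (\1_[set x | b x] : T -> R).
  apply/funext => x; rewrite indicE; congr (nat_of_bool _)%:R.
  by apply/idP/idP; rewrite inE.
rewrite /Ex /Rintegral integral_indic// fineK; last first.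
  rewrite ge0_fin_numE//; apply: (@le_lt_trans _ _ 1%E); last by rewrite ltry.
  by apply: probability_le1; exact: measurableI.
have mSC : mu (~` S) = 0%E by rewrite probability_setC// S1 subee.
rewrite -[in RHS](setIT [set x | b x]) -(setUv S) setIUr measureU//; last 3 first.
- exact: measurableI.
- by apply: measurableI => //; exact: measurableC.
- by rewrite setIACA setICr setI0.
rewrite [X in (_ + X)%E](_ : _ = 0%E) ?adde0//.
apply/eqP; rewrite eq_le measure_ge0 andbT -mSC le_measure// ?inE//.
- by apply: measurableI => //; exact: measurableC.
- exact: measurableC.
Qed.

End BoundedExpectation.

(** * Moments under a reflection-invariant law on the sphere *)

Section RotationInvariant.
Variables (R : realType) (d : nat) (mu : probability (vec R d) R).
Local Notation V := (vec R d).
Local Notation S := (@sphere R d).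

Definition rotation_invariant :=
  mu (S : set V) = 1%E /\
  forall (v : 'rV[R]_d) (A : set V), dotv v v = 1 -> measurable A ->
    mu (reflect v @^-1` A) = mu A.

Hypothesis mu_rot : rotation_invariant.
Let mS : measurable (S : set V). Proof. exact: measurable_sphere. Qed.
Let S1 : mu (S : set V) = 1%E. Proof. exact: mu_rot.1. Qed.
Local Notation E := (Ex mu S).
Local Notation bmS := (bm (S : set V)).

Let ED (f g : V -> R) : bmS f -> bmS g -> E (fun x => f x + g x) = E f + E g.
Proof. exact: ExD. Qed.
Let EB (f g : V -> R) : bmS f -> bmS g -> E (fun x => f x - g x) = E f - E g.
Proof. exact: ExB. Qed.
Let EZ c (f : V -> R) : bmS f -> E (fun x => c * f x) = c * E f.
Proof. exact: ExZ. Qed.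
Let leE (f g : V -> R) : bmS f -> bmS g -> (forall x, sphere x -> f x <= g x) -> E f <= E g.
Proof. exact: le_Ex. Qed.

Lemma bm_abs (f : V -> R) : bmS f -> bmS (fun x => `|f x|).
Proof. by apply: bm_continuous; exact: norm_continuous. Qed.

Lemma continuous_ch : continuous (@ch R).
Proof.
move=> x; apply: cvgMl; apply: cvgD; first exact: continuous_expR.
by apply: (@continuous_comp R R R (-%R) expR); [exact: opp_continuous|exact: continuous_expR].
Qed.

Lemma bm_ch (f : V -> R) : bmS f -> bmS (fun x => ch (f x)).
Proof. by apply: bm_continuous; exact: continuous_ch. Qed.

Lemma bm_expR (f : V -> R) : bmS f -> bmS (fun x => expR (f x)).
Proof. by apply: bm_continuous; exact: continuous_expR. Qed.

Lemma bm_dotv (w : 'rV[R]_d) : sphere w -> bmS (fun x => dotv w x).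
Proof.
move=> w1; split; first exact: measurable_dotv.
by exists 1 => x x1; exact: dotv_le1.
Qed.

Lemma bm_coord (i : 'I_d) : bmS (fun x => x ord0 i).
Proof.
split; first exact: measurable_entry.
exists 1 => x x1; rewrite -(@expr_le1 _ 2)// real_normK ?num_real//.
have <- : dotv x x = 1 by [].
by rewrite /dotv (bigD1 i)//= -expr2 lerDl sumr_ge0// => j _; rewrite -expr2 sqr_ge0.
Qed.

Ltac bm_auto := repeat first
  [ assumption | apply: bm_cst | apply: bm_coord | apply: bm_dotv; assumption
  | apply: bmX | apply: bm_abs | apply: bm_expR | apply: bm_ch
  | apply: bmN | apply: bmD | apply: bmM | apply: bm_sum => ? ].

Lemma bm_reflect (v : 'rV[R]_d) (f : V -> R) : dotv v v = 1 -> bmS f -> bmS (fun x => f (reflect v x)).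
Proof.
move=> v1 [mf [M hM]]; split; first exact: measurableT_comp mf (measurable_reflect v).
by exists M => x x1; apply: hM; rewrite /sphere/= reflect_dotv.
Qed.

Lemma Ex_reflect (v : 'rV[R]_d) (f : V -> R) : dotv v v = 1 -> bmS f -> E (fun x => f (reflect v x)) = E f.
Proof.
move=> v1 bf; have mr := measurable_reflect v.
have Sr : reflect v @^-1` S = S.
  by apply/seteqP; split => x; rewrite /sphere/= reflect_dotv.
have hi : mu.-integrable S (EFin \o (fun x => f (reflect v x))).
  by apply: bm_integrable => //; exact: bm_reflect.
have h := @integral_pushforward _ _ V V R (reflect v) mr mu S (EFin \o f).
rewrite /Ex /Rintegral; congr fine.
rewrite -[in LHS]Sr -h//; last 2 first.
- by apply/measurable_EFinP; exact: bf.1.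
- by rewrite Sr.
by apply: eq_measure_integral => A mA _; exact: mu_rot.2.
Qed.

Lemma Ex_average (v : 'rV[R]_d) (f g : V -> R) : dotv v v = 1 -> bmS f -> bmS g ->
  (forall x, f x + f (reflect v x) = 2 * g x) -> E f = E g.
Proof.
move=> v1 bf bg fg; have h := Ex_reflect v1 bf.
have h1 := ED bf (bm_reflect v1 bf); have h2 := EZ 2 bg.
have : E (fun x => f x + f (reflect v x)) = E (fun x => 2 * g x) by apply: eq_Ex => x _.
rewrite h1 h2 h; lra.
Qed.

(** The mirror is the hyperplane bisecting [w] and [w'], which contains every vector having the same
    product with both. *)
Lemma reflect_swap (w w' : 'rV[R]_d) : sphere w -> sphere w' -> w != w' ->
  exists2 v, dotv v v = 1 & reflect v w = w' /\
    forall x, dotv x w = dotv x w' -> reflect v x = x.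
Proof.
rewrite /sphere/= => w1 w1' ww'.
pose n := dotv (w - w') (w - w').
have n0 : 0 < n by rewrite lt_neqAle dotv_ge0 andbT eq_sym dotv_eq0 subr_eq0.
have nE : n = 2 - 2 * dotv w w'.
  by rewrite /n !dotvE w1 w1' (dotvC w' w); ring.
pose s := Num.sqrt n; have s0 : 0 < s by rewrite sqrtr_gt0.
have ss : s ^+ 2 = n by rewrite sqr_sqrtr// ltW.
exists (s^-1 *: (w - w')).
  by rewrite !dotvZl !dotvZr -/n -ss; field; rewrite gt_eqF.
split=> [|x xE].
  rewrite /reflect dotvZl !dotvDl !dotvNl w1 (dotvC w' w) scalerA.
  have -> : 2 * (s^-1 * (1 - dotv w w')) * s^-1 = 1.
    have -> : 1 - dotv w w' = s ^+ 2 / 2 by rewrite ss nE; field.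
    by field; rewrite gt_eqF.
  by rewrite scale1r opprB addrC subrK.
rewrite /reflect dotvZl !dotvDl !dotvNl (dotvC w x) (dotvC w' x) xE subrr !mulr0 scale0r.
exact: subr0.
Qed.

Definition orthonormal2 (w e : 'rV[R]_d) := [/\ sphere w, sphere e & dotv w e = 0].

Lemma reflect_sphere (v x : 'rV[R]_d) : dotv v v = 1 -> sphere x -> sphere (reflect v x).
Proof. by move=> v1 x1; rewrite /sphere/= reflect_dotv. Qed.

Lemma Ex_dot1 (w w' : 'rV[R]_d) (phi : R -> R) : sphere w -> sphere w' ->
  (forall w, sphere w -> bmS (fun x => phi (dotv w x))) ->
  E (fun x => phi (dotv w x)) = E (fun x => phi (dotv w' x)).
Proof.
move=> w1 w1' bphi; have [->//|ww'] := eqVneq w w'.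
have [v v1 [vw _]] := reflect_swap w1 w1' ww'.
rewrite -(Ex_reflect v1 (bphi w w1)); apply: eq_Ex => x _.
by rewrite reflect_dotvr// vw.
Qed.

Lemma Ex_dot2 (w e w' e' : 'rV[R]_d) (phi : R -> R -> R) :
  orthonormal2 w e -> orthonormal2 w' e' ->
  (forall w e, sphere w -> sphere e -> bmS (fun x => phi (dotv w x) (dotv e x))) ->
  E (fun x => phi (dotv w x) (dotv e x)) = E (fun x => phi (dotv w' x) (dotv e' x)).
Proof.
move=> [w1 e1 we] [w1' e1' we'] bphi.
have [e2 [e21 we2 ->]] : exists e2, [/\ sphere e2, dotv w' e2 = 0 &
    E (fun x => phi (dotv w x) (dotv e x)) = E (fun x => phi (dotv w' x) (dotv e2 x))].
  have [<-|ww'] := eqVneq w w'; first by exists e.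
  have [v v1 [vw _]] := reflect_swap w1 w1' ww'.
  exists (reflect v e); split; first exact: reflect_sphere.
    by rewrite -vw reflect_dotv.
  rewrite -(Ex_reflect v1 (bphi _ _ w1 e1)); apply: eq_Ex => x _.
  by rewrite !reflect_dotvr// vw.
(* [w'] is orthogonal to both [e2] and [e'], so the second reflection does not disturb it. *)
have [->//|ee'] := eqVneq e2 e'.
have [v v1 [vw fixv]] := reflect_swap e21 e1' ee'.
rewrite -(Ex_reflect v1 (bphi _ _ w1' e21)); apply: eq_Ex => x _.
by rewrite !reflect_dotvr// vw fixv// we2 we'.
Qed.

(** The reflection along [e] fixes w.x and changes the sign of e.x. *)
Lemma Ex_odd (w e : 'rV[R]_d) (g : R -> R) : orthonormal2 w e ->
  bmS (fun x => g (dotv w x)) -> E (fun x => g (dotv w x) * dotv e x) = 0.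
Proof.
move=> [w1 e1 we] bg.
have b : bmS (fun x => g (dotv w x) * dotv e x) by bm_auto.
have h := Ex_reflect e1 b.
have : E (fun x => - (g (dotv w x) * dotv e x)) = E (fun x => g (dotv w x) * dotv e x).
  rewrite -[RHS]h; apply: eq_Ex => x _; rewrite !reflect_dotvr//.
  have -> : reflect e w = w by rewrite /reflect dotvC we mulr0 scale0r subr0.
  have -> : reflect e e = - e.
    by rewrite /reflect (e1 : dotv e e = 1) mulr1 scaler_nat mulr2n opprD addrA subrr sub0r.
  by rewrite dotvNl mulrN.
rewrite ExN//; lra.
Qed.

Section Moments.
Variable B : R -> bool.
Hypothesis mB : measurable_fun setT B.

Definition flipc (j : 'I_d) : V -> V := reflect (delta_mx ord0 j).

Lemma dotv_delta (j : 'I_d) (x : 'rV[R]_d) : dotv (delta_mx ord0 j) x = x ord0 j.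
Proof.
rewrite /dotv (bigD1 j)//= big1 ?addr0 => [|k kj].
  by rewrite mxE !eqxx mul1r.
by rewrite mxE (negbTE kj) andbF mul0r.
Qed.

Lemma sphere_delta j : sphere (delta_mx ord0 j : 'rV[R]_d).
Proof. by rewrite /sphere/= dotv_delta mxE !eqxx. Qed.

Lemma flipcE j x k : flipc j x ord0 k = if k == j then - x ord0 j else x ord0 k.
Proof.
rewrite /flipc /reflect !mxE dotv_delta eqxx /=.
by case: eqVneq => [->|_] /=; ring.
Qed.

(* Symmetrising one coordinate at a time replaces cosh of the sum by a product of cosh's. *)
Lemma Ex_ch_sum_le (a : R) (l : seq 'I_d) (g : V -> R) : uniq l -> bmS g ->
  (forall x, sphere x -> 0 <= g x) -> (forall j x, j \in l -> g (flipc j x) = g x) ->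
  E (fun x => g x * ch (\sum_(j <- l) a * x ord0 j)) <=
  E (fun x => g x * expR (\sum_(j <- l) 2 * (a * x ord0 j) ^+ 2)).
Proof.
elim: l g => [|j l IH] g /=.
  move=> _ bg g0 _; under eq_Ex do rewrite big_nil ch0.
  by rewrite le_eqVlt; apply/orP; left; apply/eqP/eq_Ex => x _; rewrite big_nil expR0.
move=> /andP[jl ul] bg g0 gflip.
have b1 : bmS (fun x => g x * ch (\sum_(j <- j :: l) a * x ord0 j)).
  by bm_auto.
have sflip x : \sum_(k <- l) a * flipc j x ord0 k = \sum_(k <- l) a * x ord0 k.
  apply: eq_big_seq => k kl; rewrite flipcE; case: eqVneq => // kj.
  by rewrite -kj kl in jl.
have E1 : E (fun x => g x * ch (\sum_(j <- j :: l) a * x ord0 j)) =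
    E (fun x => g x * ch (a * x ord0 j) * ch (\sum_(j <- l) a * x ord0 j)).
  apply: (Ex_average (sphere_delta j) b1); first by bm_auto.
  move=> x; rewrite -/(flipc j x) !big_cons gflip ?mem_head// sflip flipcE eqxx mulrN.
  by rewrite -mulrDr ch_addsub; ring.
have b3 : bmS (fun x => g x * expR (2 * (a * x ord0 j) ^+ 2)).
  by bm_auto.
rewrite E1; apply: (@le_trans _ _ (E (fun x => g x * expR (2 * (a * x ord0 j) ^+ 2) *
    ch (\sum_(j <- l) a * x ord0 j)))).
  apply: leE; [by bm_auto|by bm_auto|].
  move=> x x1; rewrite ler_pM2r ?ch_gt0//; apply: ler_wpM2l; first exact: g0.
  exact: ch_le_gauss.
apply: (le_trans (IH _ ul b3 _ _)).
- by move=> x x1; rewrite mulr_ge0 ?g0// expR_ge0.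
- move=> k x kl; rewrite gflip ?inE ?kl ?orbT// flipcE; case: eqVneq => // jk.
  by rewrite jk kl in jl.
by rewrite le_eqVlt; apply/orP; left; apply/eqP/eq_Ex => x _; rewrite big_cons expRD mulrA.
Qed.

Lemma sum_coord_sphere (i : 'I_d) (x : 'rV[R]_d) : sphere x ->
  \sum_(j < d | j != i) (x ord0 j) ^+ 2 = 1 - (x ord0 i) ^+ 2.
Proof.
move=> x1; have : dotv x x = 1 by [].
rewrite /dotv (bigD1 i)//= -expr2; under eq_bigr do rewrite -expr2.
by move=> <-; rewrite addrAC subrr add0r.
Qed.

Lemma bm_B (w : 'rV[R]_d) : sphere w -> bmS (fun x => (B (dotv w x))%:R : R).
Proof. by move=> w1; apply: bm_bool; apply: (measurableT_comp mB); exact: measurable_dotv. Qed.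

Ltac bmB_auto := repeat first [apply: bm_B; assumption | progress bm_auto].

Let m : R := (d.-1)%:R.
Hypothesis d2 : (2 <= d)%N.
Let m0 : 0 < m. Proof. by rewrite ltr0n; lia. Qed.

Lemma card_neq (i : 'I_d) : \sum_(j < d | j != i) (1 : R) = m.
Proof.
by rewrite sumr_const -[X in _ *+ X]/#|predC1 i| cardC1 card_ord.
Qed.

(** By invariance [w] may be a basis vector and [e] the normalised diagonal of the other d - 1
    coordinates. Then e.x is an equally weighted sum of coordinates, and symmetrisation leaves an
    exponent proportional to their sum of squares, which the sphere bounds by 1. *)
Lemma Ex_ch_le (w e : 'rV[R]_d) (t : R) : orthonormal2 w e ->
  E (fun x => (B (dotv w x))%:R * ch (t * dotv e x)) <=
  expR (2 * t ^+ 2 / m) * E (fun x => (B (dotv w x))%:R).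
Proof.
move=> we; have d0 : (0 < d)%N by lia.
pose i : 'I_d := Ordinal d0; pose w' : 'rV[R]_d := delta_mx ord0 i.
pose s := Num.sqrt m; have s0 : 0 < s by rewrite sqrtr_gt0.
have ss : s ^+ 2 = m by rewrite sqr_sqrtr// ltW.
pose e' : 'rV[R]_d := \row_j (if j == i then 0 else s^-1).
have w'E x : dotv w' x = x ord0 i by exact: dotv_delta.
pose l := [seq j <- index_enum 'I_d | j != i].
have e'E x : t * dotv e' x = \sum_(j <- l) (t / s) * x ord0 j.
  rewrite big_filter /dotv (bigD1 i)//= mxE eqxx mul0r add0r mulr_sumr.
  by apply: eq_bigr => j ji; rewrite mxE (negbTE ji) mulrA.
have we' : orthonormal2 w' e'.
  split; first exact: sphere_delta; last by rewrite w'E mxE eqxx.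
  rewrite /sphere/= /dotv (bigD1 i)//= mxE eqxx mul0r add0r.
  transitivity (\sum_(j < d | j != i) s ^- 2 * 1).
    apply: eq_bigr => j ji; rewrite mxE (negbTE ji) mulr1; field.
    by rewrite gt_eqF.
  by rewrite -mulr_sumr card_neq ss mulVf ?gt_eqF.
have w1' : sphere w' by case: we'.
rewrite (@Ex_dot2 w e w' e' (fun z y => (B z)%:R * ch (t * y)) we we'); last first.
  by move=> w1 e1 ? ?; bmB_auto.
rewrite (@Ex_dot1 w w' (fun z => (B z)%:R))//; last 2 first.
- by case: we.
- exact: bm_B.
under eq_Ex do rewrite e'E.
have ul : uniq l by rewrite filter_uniq// index_enum_uniq.
apply: (le_trans (Ex_ch_sum_le (t / s) ul (bm_B w1') _ _)).
- by move=> x _; exact: ler0n.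
- move=> j x; rewrite mem_filter => /andP[ji _]; rewrite !w'E flipcE.
  by rewrite eq_sym (negbTE ji).
rewrite -EZ; last exact: bm_B.
apply: leE; [by bmB_auto|by bmB_auto|].
move=> x x1; rewrite mulrC ler_wpM2r ?ler0n// ler_expR.
have -> : \sum_(j <- l) 2 * (t / s * x ord0 j) ^+ 2 = 2 * t ^+ 2 / m * (1 - x ord0 i ^+ 2).
  rewrite big_filter -sum_coord_sphere// mulr_sumr; apply: eq_bigr => j _.
  by rewrite -ss; field; rewrite gt_eqF.
rewrite ler_piMr//; first by apply: divr_ge0; [apply: mulr_ge0 => //; exact: sqr_ge0|exact: ltW].
by rewrite lerBlDr lerDl sqr_ge0.
Qed.

(** All directions orthogonal to [w] are equivalent, and over d - 1 of them the squares sum to the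
    squared norm of the part of x orthogonal to [w]. *)
Lemma Ex_sqr (w e : 'rV[R]_d) : orthonormal2 w e ->
  m * E (fun x => (B (dotv w x))%:R * (dotv e x) ^+ 2) =
  E (fun x => (B (dotv w x))%:R * (1 - (dotv w x) ^+ 2)).
Proof.
move=> we; have d0 : (0 < d)%N by lia.
pose i : 'I_d := Ordinal d0; pose w' : 'rV[R]_d := delta_mx ord0 i.
have w1 : sphere w by case: we.
have w1' : sphere w' by exact: sphere_delta.
have bphi (w2 e2 : 'rV[R]_d) : sphere w2 -> sphere e2 ->
    bmS (fun x => (B (dotv w2 x))%:R * (dotv e2 x) ^+ 2).
  by move=> ? ?; bmB_auto.
rewrite (@Ex_dot1 w w' (fun z => (B z)%:R * (1 - z ^+ 2)))//; last first.
  by move=> w2 ?; bmB_auto.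
transitivity (\sum_(j <- [seq j <- index_enum 'I_d | j != i])
    E (fun x => (B (dotv w' x))%:R * (x ord0 j) ^+ 2)).
  rewrite -(card_neq i) mulr_suml big_filter; apply: eq_bigr => j ji.
  have we' : orthonormal2 w' (delta_mx ord0 j).
    split => //; first exact: sphere_delta.
    by rewrite dotv_delta mxE eq_sym (negbTE ji) andbF.
  rewrite mul1r (@Ex_dot2 w e w' _ (fun z y => (B z)%:R * y ^+ 2) we we')//.
  by apply: eq_Ex => x _; rewrite dotv_delta.
rewrite -Ex_sum//; last first.
  by move=> j; bmB_auto.
by apply: eq_Ex => x x1; rewrite big_filter -mulr_sumr sum_coord_sphere// dotv_delta.
Qed.

Let p (w : 'rV[R]_d) := E (fun x => (B (dotv w x))%:R).

Lemma Ex_pow4_le (w e : 'rV[R]_d) : orthonormal2 w e ->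
  m ^+ 2 * E (fun x => (B (dotv w x))%:R * (dotv e x) ^+ 4) <= 1536 * p w.
Proof.
move=> we; have [w1 e1 _] := we.
(* This [t] makes the exponent 2 t^2 / m of [Ex_ch_le] equal to 1/2; then 1536 = 48 * 16 * 2. *)
pose t := Num.sqrt m / 2; have t2 : t ^+ 2 = m / 4.
  by rewrite expr_div_n sqr_sqrtr ?ltW//; congr (_ / _); ring.
have h := Ex_ch_le t we.
have bch : bmS (fun x => (B (dotv w x))%:R * ch (t * dotv e x)).
  by bmB_auto.
have b4 : bmS (fun x => (B (dotv w x))%:R * (dotv e x) ^+ 4).
  by bmB_auto.
have p0 : 0 <= p w by apply: Ex_ge0 => x _; exact: ler0n.
have h2 : t ^+ 4 * E (fun x => (B (dotv w x))%:R * (dotv e x) ^+ 4) <=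
    48 * E (fun x => (B (dotv w x))%:R * ch (t * dotv e x)).
  rewrite -!EZ//; apply: leE; [by bmB_auto|by bmB_auto|].
  move=> x _; rewrite !(mulrCA _ (B _)%:R) ler_wpM2l ?ler0n// -exprMn.
  exact: pow4_le_ch.
have e2 : 2 * t ^+ 2 / m = 2^-1 by rewrite t2; field; rewrite gt_eqF.
rewrite e2 in h; have := @expR_half_le2 R => h3.
have t4 : t ^+ 4 = m ^+ 2 / 16 by rewrite (exprM t 2 2) t2; field.
rewrite t4 in h2; rewrite -/(p w) in h.
have : expR 2^-1 * p w <= 2 * p w by rewrite ler_wpM2r.
lra.
Qed.

Lemma Ex_abs_ge (w e : 'rV[R]_d) : orthonormal2 w e ->
  (forall z, B z -> z ^+ 2 <= 2^-1) ->
  p w / (512 * Num.sqrt m) <= E (fun x => (B (dotv w x))%:R * `|dotv e x|).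
Proof.
move=> we hB; have [w1 e1 _] := we.
pose s := Num.sqrt m; have s0 : 0 < s by rewrite sqrtr_gt0.
have ss : s ^+ 2 = m by rewrite sqr_sqrtr// ltW.
have b2 : bmS (fun x => (B (dotv w x))%:R * (dotv e x) ^+ 2).
  by bmB_auto.
have b4 : bmS (fun x => (B (dotv w x))%:R * (dotv e x) ^+ 4).
  by bmB_auto.
have ba : bmS (fun x => (B (dotv w x))%:R * `|dotv e x|).
  by bmB_auto.
pose E2 := E (fun x => (B (dotv w x))%:R * (dotv e x) ^+ 2).
pose E4 := E (fun x => (B (dotv w x))%:R * (dotv e x) ^+ 4).
have h2 : p w / 2 <= m * E2.
  rewrite /E2 Ex_sqr// mulrC -EZ; last exact: bm_B.
  apply: leE; [by bmB_auto|by bmB_auto|].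
  move=> x _; rewrite mulrC; case hb: (B _); rewrite ?mul0r ?mul1r//.
  by have := hB _ hb; lra.
have h4 := Ex_pow4_le we; rewrite -/E4 in h4.
(* Small enough for the second moment to dominate: 4 * (1/2) - 512 * 1536 / 128^3 > 1. *)
pose t := s / 128.
have h : t * E2 - t ^+ 3 * E4 <= E (fun x => (B (dotv w x))%:R * `|dotv e x|).
  rewrite /E2 /E4 -!EZ// -EB; [|by bmB_auto|by bmB_auto].
  apply: leE; [by bmB_auto|by bmB_auto|].
  move=> x _; rewrite !(mulrCA _ (B _)%:R) -mulrBr ler_wpM2l ?ler0n//.
  by apply: abs_ge_moments; rewrite divr_ge0// ltW.
apply: (le_trans _ h).
have p0 : 0 <= p w by apply: Ex_ge0 => x _; exact: ler0n.
rewrite -/s ler_pdivrMr; last lra.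
have -> : (t * E2 - t ^+ 3 * E4) * (512 * s) =
    4 * (s ^+ 2 * E2) - 512 / 128 ^+ 3 * ((s ^+ 2) ^+ 2 * E4) by rewrite /t; field.
rewrite ss; lra.
Qed.

Lemma Ex_expR_abs_le (w e : 'rV[R]_d) : orthonormal2 w e ->
  E (fun x => (B (dotv w x))%:R * expR (2 * Num.sqrt d%:R * `|dotv e x|)) <=
  2 * expR 16 * p w.
Proof.
move=> we; have [w1 e1 _] := we.
have s0 : 0 <= Num.sqrt (d%:R : R) by exact: sqrtr_ge0.
have h := Ex_ch_le (2 * Num.sqrt d%:R) we; rewrite -/(p w) in h.
have p0 : 0 <= p w by apply: Ex_ge0 => x _; exact: ler0n.
have bn : bmS (fun x => `|dotv e x|).
  by bmB_auto.
apply: (@le_trans _ _ (2 * E (fun x => (B (dotv w x))%:R * ch (2 * Num.sqrt d%:R * dotv e x)))).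
  have bch : bmS (fun x => (B (dotv w x))%:R * ch (2 * Num.sqrt d%:R * dotv e x)).
    by bmB_auto.
  rewrite -EZ//; apply: leE; [by bmB_auto|by bmB_auto|].
    move=> x _; rewrite (mulrCA 2) ler_wpM2l ?ler0n//.
    have -> : 2 * Num.sqrt d%:R * `|dotv e x| = `|2 * Num.sqrt d%:R * dotv e x|.
      by rewrite normrM ger0_norm// mulr_ge0.
    exact: expR_le_ch.
rewrite -mulrA ler_pM2l//; apply: (le_trans h); apply: ler_wpM2r => //.
(* The exponent is 8 d / (d - 1), at most 16. *)
rewrite ler_expR exprMn sqr_sqrtr ?ler0n// ler_pdivrMr//.
have : (d%:R : R) <= 2 * m.
  by rewrite /m -natrM ler_nat; lia.
lra.
Qed.

End Moments.
End RotationInvariant.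

Notation ind P := ((nat_of_bool P%R)%:R) (only parsing).

(** * Lower bound for the probability of a band *)

Section BandProbability.
Variables (R : realType) (d : nat) (mu : probability (vec R d) R).
Local Notation V := (vec R d).
Local Notation S := (@sphere R d).
Hypothesis mu_rot : rotation_invariant mu.
Hypothesis d2 : (2 <= d)%N.
Let mS : measurable (S : set V). Proof. exact: measurable_sphere. Qed.
Let S1 : mu (S : set V) = 1%E. Proof. exact: mu_rot.1. Qed.
Local Notation E := (Ex mu S).
Local Notation bmS := (bm (S : set V)).
Let ED (f g : V -> R) : bmS f -> bmS g -> E (fun x => f x + g x) = E f + E g.
Proof. exact: ExD. Qed.
Let EB (f g : V -> R) : bmS f -> bmS g -> E (fun x => f x - g x) = E f - E g.
Proof. exact: ExB. Qed.
Let EZ c (f : V -> R) : bmS f -> E (fun x => c * f x) = c * E f.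
Proof. exact: ExZ. Qed.
Let Ecst c : E (fun=> c) = c.
Proof. exact: Ex_cst. Qed.
Let leE (f g : V -> R) : bmS f -> bmS g -> (forall x, sphere x -> f x <= g x) -> E f <= E g.
Proof. exact: le_Ex. Qed.

Let bmb (b : V -> bool) : measurable_fun setT b -> bmS (fun x => ind (b x) : R).
Proof. exact: bm_bool. Qed.

Lemma measurable_dotvr (w : 'rV[R]_d) : measurable_fun setT (fun x : V => dotv w x).
Proof. exact: measurable_dotv. Qed.

Lemma measurable_band (w : 'rV[R]_d) (b : R) :
  measurable_fun setT (fun x : V => b / 2 <= dotv w x <= b).
Proof.
apply: measurable_and; apply: measurable_fun_ler => //; exact: measurable_dotvr.
Qed.

Definition band_prob (w : 'rV[R]_d) (b : R) := E (fun x => ind (b / 2 <= dotv w x <= b) : R).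

Lemma exists_orthonormal2 : exists w e : 'rV[R]_d, orthonormal2 w e.
Proof.
have d0 : (0 < d)%N by lia. have d1 : (1 < d)%N by lia.
exists (delta_mx ord0 (Ordinal d0)), (delta_mx ord0 (Ordinal d1)); split.
- exact: sphere_delta.
- exact: sphere_delta.
- by rewrite dotv_delta mxE.
Qed.

Lemma Ex_dotv_sqr (e : 'rV[R]_d) : sphere e -> d%:R * E (fun x => (dotv e x) ^+ 2) = 1.
Proof.
move=> e1; have [w0 [e0 we0]] := exists_orthonormal2.
have [w01 e01 _] := we0.
have h := Ex_sqr (B := fun=> true) mu_rot (measurable_cst _) d2 we0.
have bsq (w : 'rV[R]_d) : sphere w -> bmS (fun x => (dotv w x) ^+ 2).
  by move=> w1; apply: bmX; exact: bm_dotv.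
have q1 := Ex_dot1 mu_rot (phi := fun z => z ^+ 2) e1 w01 bsq.
have q2 := Ex_dot1 mu_rot (phi := fun z => z ^+ 2) e1 e01 bsq.
have h1 : E (fun x => true%:R * (dotv e0 x) ^+ 2) = E (fun x => (dotv e x) ^+ 2).
  by rewrite q2; apply: eq_Ex => x _; rewrite mul1r.
have h2 : E (fun x => true%:R * (1 - (dotv w0 x) ^+ 2)) = 1 - E (fun x => (dotv e x) ^+ 2).
  rewrite q1 -[X in _ = X - _](Ecst 1) -EB; [|exact: bm_cst|exact: bsq].
  by apply: eq_Ex => x _; rewrite mul1r.
rewrite h1 h2 in h.
have -> : (d%:R : R) = d.-1%:R + 1 by rewrite natr1 prednK//; lia.
lra.
Qed.

Lemma Ex_dotv_pow4 (e : 'rV[R]_d) : sphere e ->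
  d%:R ^+ 2 * E (fun x => (dotv e x) ^+ 4) <= 4 * 1536.
Proof.
move=> e1; have [w0 [e0 we0]] := exists_orthonormal2.
have [w01 e01 _] := we0.
have h := Ex_pow4_le (B := fun=> true) mu_rot (measurable_cst _) d2 we0.
have q2 := Ex_dot1 mu_rot (phi := fun z => z ^+ 4) e1 e01
  (fun w w1 => bmX 4 (bm_dotv w1)).
have h1 : E (fun x => true%:R * (dotv e0 x) ^+ 4) = E (fun x => (dotv e x) ^+ 4).
  by rewrite q2; apply: eq_Ex => x _; rewrite mul1r.
have h2 : E (fun x : V => true%:R) = 1 by exact: Ecst.
rewrite h1 h2 mulr1 in h.
have e4 : 0 <= E (fun x => (dotv e x) ^+ 4).
  by apply: Ex_ge0 => x _; rewrite (_ : 4 = 2 * 2)%N// exprM sqr_ge0.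
have dm : (d%:R : R) <= 2 * d.-1%:R by rewrite -natrM ler_nat; lia.
have d0 : 0 <= (d%:R : R) by rewrite ler0n.
have : (d%:R : R) ^+ 2 <= 4 * d.-1%:R ^+ 2.
  have -> : 4 * d.-1%:R ^+ 2 = (2 * d.-1%:R) ^+ 2 :> R by ring.
  by rewrite ler_sqr ?nnegrE//; apply: (le_trans d0).
move=> /(ler_wpM2r e4) => h3; lra.
Qed.

Let D : R := Num.sqrt d%:R.
Let D0 : 0 < D. Proof. by rewrite sqrtr_gt0 ltr0n; lia. Qed.
Let DD : D ^+ 2 = d%:R. Proof. by rewrite sqr_sqrtr// ler0n. Qed.

(* Paley-Zygmund: with second and fourth moments of order 1/d and 1/d^2, the point (w.x, e.x)
   lies at scale 1/sqrt d in a prescribed sector with probability bounded below. *)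
Lemma sector_prob_ge (w e : 'rV[R]_d) (be A : R) : orthonormal2 w e ->
  be = 4 * (4 * 1536) -> A = 16 * be ->
  (8 * be)^-1 <= E (fun x => ind [&& `|dotv w x| <= A / D, 2^-1 / D <= dotv e x
                               & dotv e x <= A / D] : R).
Proof.
move=> we beE AE; have [w1 e1 we0] := we.
have be0 : 1 <= be by rewrite beE; lra.
have A0 : 0 < A by rewrite AE; lra.
have e1N : sphere (- e) by rewrite /sphere/= !dotvE opprK.
have mye (f : 'rV[R]_d) c : measurable_fun setT (fun x : V => c <= dotv f x).
  by apply: measurable_fun_ler => //; exact: measurable_dotvr.
have mya (f : 'rV[R]_d) c : measurable_fun setT (fun x : V => dotv f x <= c).
  by apply: measurable_fun_ler => //; exact: measurable_dotvr.
have bsq (f : 'rV[R]_d) n : sphere f -> bmS (fun x => (dotv f x) ^+ n).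
  by move=> f1; apply: bmX; exact: bm_dotv.
pose P1 := E (fun x => (ind (2^-1 / D <= dotv e x) : R)).
have P1N : P1 = E (fun x => (ind (2^-1 / D <= dotv (- e) x) : R)).
  apply: (Ex_dot1 mu_rot (phi := fun y => ind (2^-1 / D <= y))) => //.
  by move=> f f1; apply: bmb; exact: mye.
have hP1 : (4 * be)^-1 <= P1.
  (* With Y = sqrt d (e.x), one of three holds: Y^2 <= 1/4; or |Y| >= 1/2 and Y^2 <= be; or Y^2 <=
     Y^4 / be. Since E Y^2 = 1 and E Y^4 <= be / 4, taking means gives [P1] >= 1 / (4 be). *)
  have : E (fun x => D ^+ 2 * (dotv e x) ^+ 2) <=
      E (fun x => 4^-1 + be * ((ind (2^-1 / D <= dotv e x) : R) + (ind (2^-1 / D <= dotv (- e) x) : R))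
         + D ^+ 4 / be * (dotv e x) ^+ 4).
    apply: leE; [by apply: bmZ; exact: bsq| |].
      apply: bmD; last by apply: bmZ; exact: bsq.
      by apply: bmD; [exact: bm_cst|apply: bmZ; apply: bmD; apply: bmb; exact: mye].
    move=> x _; set y := dotv e x; rewrite dotvNl -/y.
    have -> : D ^+ 4 / be * y ^+ 4 = ((D * y) ^+ 2) ^+ 2 / be by ring.
    have -> : D ^+ 2 * y ^+ 2 = (D * y) ^+ 2 by ring.
    rewrite !ler_pdivrMr// [y * D]mulrC [- y * D]mulrC mulrN.
    set Y := D * y.
    have q0 : 0 <= (Y ^+ 2) ^+ 2 / be by rewrite divr_ge0 ?sqr_ge0//; lra.
    have [hY|hY] := leP 2^-1 Y.
      have [hb|hb] := leP (Y ^+ 2) be.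
        have : 0 <= be * (ind (2^-1 <= - Y) : R) by rewrite mulr_ge0 ?ler0n//; lra.
        rewrite mulrDr mulr1; lra.
      have : Y ^+ 2 <= (Y ^+ 2) ^+ 2 / be by rewrite ler_pdivlMr; [nra|lra].
      have : 0 <= be * (1 + (ind (2^-1 <= - Y) : R)) by rewrite mulr_ge0 ?addr_ge0 ?ler0n//; lra.
      by rewrite /=; lra.
    have [hY2|hY2] := leP 2^-1 (- Y).
      have [hb|hb] := leP (Y ^+ 2) be; first by rewrite /=; lra.
      have : Y ^+ 2 <= (Y ^+ 2) ^+ 2 / be by rewrite ler_pdivlMr; [nra|lra].
      by rewrite /=; lra.
    have : Y ^+ 2 <= 4^-1 by nra.
    by rewrite /=; lra.
  rewrite EZ; last exact: bsq.
  rewrite ED; [|by apply: bmD; [exact: bm_cst|apply: bmZ; apply: bmD; apply: bmb; exact: mye]|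
    by apply: bmZ; exact: bsq].
  rewrite ED; [|exact: bm_cst|by apply: bmZ; apply: bmD; apply: bmb; exact: mye].
  rewrite Ecst EZ; last by apply: bmD; apply: bmb; exact: mye.
  rewrite ED; [|by apply: bmb; exact: mye|by apply: bmb; exact: mye].
  rewrite EZ; last exact: bsq.
  rewrite -P1N -/P1 DD Ex_dotv_sqr//.
  have := Ex_dotv_pow4 e1.
  have -> : D ^+ 4 = d%:R ^+ 2 by rewrite -DD; ring.
  set E4 := E _ => h4.
  have : d%:R ^+ 2 / be * E4 <= 4^-1.
    by rewrite mulrAC ler_pdivrMr; [rewrite beE; lra|lra].
  move=> h5 h6; rewrite -div1r ler_pdivrMr; [nra|lra].
pose G := fun x : V => [&& `|dotv w x| <= A / D, 2^-1 / D <= dotv e x & dotv e x <= A / D].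
have mG : measurable_fun setT G.
  apply: measurable_and; last by apply: measurable_and.
  apply: measurable_fun_ler => //; apply: measurableT_comp => //; exact: measurable_dotvr.
(* Chebyshev: cutting off |w.x| and e.x above A / D costs at most 2 / A^2, which is at most half of
   the bound for [P1]. *)
have : P1 <= E (fun x => (G x)%:R + (D ^+ 2 / A ^+ 2) * ((dotv w x) ^+ 2 + (dotv e x) ^+ 2)).
  apply: leE; [by apply: bmb; exact: mye| |].
    apply: bmD; first exact: bmb.
    by apply: bmZ; apply: bmD; exact: bsq.
  move=> x _; set z := dotv w x; set y := dotv e x; rewrite /G -/z -/y.
  have E0 : D ^+ 2 / A ^+ 2 * (z ^+ 2 + y ^+ 2) = (D * z / A) ^+ 2 + (D * y / A) ^+ 2.
    by field; rewrite gt_eqF.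
  rewrite E0; case hy : (2^-1 / D <= y) => /=; last first.
    by rewrite andbF addr_ge0// ?addr_ge0 ?sqr_ge0.
  have [hz|hz] := leP `|z| (A / D); last first.
    rewrite /= add0r; have : 1 <= (D * z / A) ^+ 2.
      rewrite -[X in _ <= X]real_normK ?num_real// expr_ge1// normf_div normrM.
      rewrite (gtr0_norm A0) (gtr0_norm D0) ler_pdivlMr// mul1r mulrC.
      by rewrite -ler_pdivrMr// ltW.
    by move=> h; have := sqr_ge0 (D * y / A); lra.
  have [hy2|hy2] := leP y (A / D) => /=.
    have := sqr_ge0 (D * y / A); have := sqr_ge0 (D * z / A); lra.
  rewrite add0r; have : 1 <= (D * y / A) ^+ 2.
    have hY : 1 <= D * y / A by rewrite ler_pdivlMr// mul1r mulrC -ler_pdivrMr// ltW.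
    by rewrite expr_ge1// (le_trans _ hY).
  by move=> h; have := sqr_ge0 (D * z / A); lra.
rewrite ED; [|exact: bmb|by apply: bmZ; apply: bmD; exact: bsq].
rewrite EZ; last by apply: bmD; exact: bsq.
rewrite ED; [|exact: bsq|exact: bsq].
have h1 := Ex_dotv_sqr w1; have h2 := Ex_dotv_sqr e1.
have -> : D ^+ 2 / A ^+ 2 * (E (fun x => dotv w x ^+ 2) + E (fun x => dotv e x ^+ 2)) =
    2 / A ^+ 2.
  rewrite DD -mulrA mulrCA mulrDr h1 h2; field; rewrite gt_eqF//.
move=> h.
have hA : 2 / A ^+ 2 <= (8 * be)^-1.
  rewrite ler_pdivrMr; last by rewrite exprn_gt0.
  rewrite mulrC ler_pdivlMr; last lra.
  by rewrite AE; nra.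
have E8 : (4 * be)^-1 = (8 * be)^-1 + (8 * be)^-1 by field; lra.
rewrite -/(G _); rewrite E8 in hP1.
have : (fun x => (G x)%:R : R) = (fun x => (G x)%:R) by [].
by move=> _; move: h hA hP1; set X := E _; set Y := (8 * be)^-1; set Z := 2 / _; lra.
Qed.

(** The function sqrt (1 + t^2) is 1-Lipschitz; it is the norm of the tilted direction w + t e,
    which must vary little between neighbouring slopes. *)
Lemma sqrt_shift_le (t h : R) : 0 <= h ->
  Num.sqrt (1 + (t - h) ^+ 2) <= Num.sqrt (1 + t ^+ 2) + h.
Proof.
move=> h0; set s := Num.sqrt (1 + t ^+ 2).
have s0 : 0 <= s by exact: sqrtr_ge0.
have ss : s ^+ 2 = 1 + t ^+ 2 by rewrite sqr_sqrtr// addr_ge0// sqr_ge0.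
have ts : - t <= s.
  have [t0|t0] := leP 0 t; first lra.
  rewrite -(@ler_sqr _ (- t) s) ?nnegrE//; last lra.
  by rewrite ss sqrrN; lra.
rewrite -[X in _ <= X]ger0_norm; last lra.
rewrite -sqrtr_sqr ler_sqrt; last by rewrite sqr_ge0.
nra.
Qed.

(* Sectors at scale 1/sqrt d are covered by O(1/(b sqrt d)) rotated copies of the band. *)
Lemma band_prob_ge_aux (be A b : R) (v : 'rV[R]_d) : be = 4 * (4 * 1536) -> A = 16 * be ->
  sphere v -> 0 < b -> b * D <= 4^-1 ->
  (8 * be)^-1 / (34 * A ^+ 2) * (b * D) <= band_prob v b.
Proof.
move=> beE AE v1 b0 bD; have [w [e we]] := exists_orthonormal2.
have [w1 e1 we0] := we.
have be0 : 1 <= be by rewrite beE; lra.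
have A0 : 1 <= A by rewrite AE; lra.
have hsec := sector_prob_ge we beE AE; clear beE AE.
have bD0 : 0 < b * D by rewrite mulr_gt0.
pose h := b * D / (4 * A).
have h0 : 0 < h by rewrite divr_gt0//; lra.
have h2 : h <= 2^-1 by rewrite /h ler_pdivrMr; lra.
(* Slopes from -4A to 4A suffice: on the sector |w.x| <= A / D and e.x >= 1 / (2 D), so the sign of
   w.x + t (e.x) is settled at both ends. *)
pose t (i : nat) := - (4 * A) + i%:R * h.
pose n (i : nat) := Num.sqrt (1 + (t i) ^+ 2).
have n1 i : 1 <= n i.
  by rewrite -[X in X <= _]sqrtr1 ler_sqrt ?lerDl ?addr_ge0 ?sqr_ge0.
have nn i : (n i) ^+ 2 = 1 + (t i) ^+ 2 by rewrite sqr_sqrtr// addr_ge0// sqr_ge0.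
pose wt i := (n i)^-1 *: (w + t i *: e).
have wt1 i : sphere (wt i).
  rewrite /sphere/= /wt !dotvE (w1 : dotv w w = 1) (e1 : dotv e e = 1) (dotvC e w) we0.
  have := nn i; have := n1 i; set a := n i => ha haa.
  transitivity (a^-1 ^+ 2 * (1 + t i ^+ 2)); first by ring.
  by rewrite -haa exprVn mulVf// expf_neq0// gt_eqF//; lra.
have wtE i x : dotv (wt i) x = (dotv w x + t i * dotv e x) / n i.
  by rewrite /wt !dotvE mulrC.
have [N hN1 hN2] : exists2 N : nat, 8 * A <= N%:R * h & N.+1%:R * h <= 8 * A + 2 * h.
  exists (absz (Num.ceil (8 * A / h))).
    rewrite -ler_pdivrMr// natr_absz ger0_norm; first exact: ceil_ge.
    by rewrite ceil_ge0; apply: (@lt_le_trans _ _ 0); rewrite ?ltrN10// divr_ge0// ?ltW//; lra.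
  rewrite -natr1 natr_absz ger0_norm; last first.
    by rewrite ceil_ge0; apply: (@lt_le_trans _ _ 0); rewrite ?ltrN10// divr_ge0// ?ltW//; lra.
  have : ((Num.ceil (8 * A / h) - 1)%:~R : R) <= 8 * A / h by rewrite ltW// gt_pred_ceil// num_real.
  by rewrite intrB ler_pdivlMr//; lra.
pose G := fun x : V => [&& `|dotv w x| <= A / D, 2^-1 / D <= dotv e x & dotv e x <= A / D].
have cover x : G x -> exists2 i : nat, (i <= N)%N & b / 2 <= dotv (wt i) x <= b.
  move=> /and3P[]; set z := dotv w x; set y := dotv e x => hz hy1 hy2.
  have hz1 : z <= A / D by apply: le_trans (ler_norm _) hz.
  have hz2 : - (A / D) <= z by move: hz; rewrite ler_norml => /andP[].
  pose a := D^-1; have a0 : 0 < a by rewrite invr_gt0.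
  rewrite -/a in hz1 hz2 hy1 hy2.
  have ba : b <= a / 4.
    by rewrite /a mulrC ler_pdivlMr//; lra.
  (* At the least slope reaching b / 2 the upper limit b is not yet passed: by the choice of [h],
     one step adds at most b / 4 to w.x + t (e.x), and h <= 1/2 controls the change of the norm. *)
  pose Q i := b / 2 * n i <= z + t i * y.
  have exQ : exists i, Q i.
    exists N; rewrite /Q.
    have tN : 4 * A <= t N by rewrite /t; lra.
    have nN : n N <= 1 + t N.
      rewrite -[X in _ <= X]ger0_norm; last lra.
      by rewrite -sqrtr_sqr ler_sqrt ?sqr_ge0//; nra.
    nra.
  have [i Qi mini] := ex_minnP exQ.
  have iN : (i <= N)%N.
    apply: mini; rewrite /Q.
    have tN : 4 * A <= t N by rewrite /t; lra.
    have nN : n N <= 1 + t N.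
      rewrite -[X in _ <= X]ger0_norm; last lra.
      by rewrite -sqrtr_sqr ler_sqrt ?sqr_ge0//; nra.
    nra.
  exists i => //; rewrite wtE -/z -/y.
  have ni0 : 0 < n i by have := n1 i; lra.
  rewrite ler_pdivlMr// ler_pdivrMr//; apply/andP; split; first exact: Qi.
  case: i Qi mini iN ni0 => [|i] Qi mini iN ni0.
    exfalso; move: Qi; rewrite /Q /t mul0r addr0.
    have := n1 0%N; nra.
  have Qi' : ~~ Q i by apply/negP => /mini; rewrite ltnn.
  rewrite /Q -ltNge in Qi'.
  have ti : t i = t i.+1 - h by rewrite /t -natr1; ring.
  have hs := sqrt_shift_le (t i.+1) (ltW h0).
  rewrite -ti -/(n i) -/(n i.+1) in hs.
  have hhy : h * y <= b / 4.
    have : h * y <= h * (A * a) by rewrite ler_pM2l.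
    have -> : h * (A * a) = b / 4 by rewrite /h /a; field; rewrite gt_eqF//=; lra.
    by [].
  have := n1 i.+1; rewrite ti in Qi'; nra.
have mG : measurable_fun setT G.
  apply: measurable_and; last apply: measurable_and.
  - apply: measurable_fun_ler => //; apply: measurableT_comp => //; exact: measurable_dotvr.
  - by apply: measurable_fun_ler => //; exact: measurable_dotvr.
  - by apply: measurable_fun_ler => //; exact: measurable_dotvr.
have hcov : E (fun x => (G x)%:R) <=
    E (fun x => \sum_(i < N.+1) (ind (b / 2 <= dotv (wt i) x <= b) : R)).
  apply: leE; [exact: bmb|by apply: bm_sum => i; apply: bmb; exact: measurable_band|].
  move=> x _; case: (boolP (G x)) => [/cover[i iN hi]|_]; last by rewrite sumr_ge0.
  rewrite (bigD1 (Ordinal (iN : (i < N.+1)%N)))//= hi lerDl sumr_ge0//.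
have : E (fun x => \sum_(i < N.+1) (ind (b / 2 <= dotv (wt i) x <= b) : R)) = N.+1%:R * band_prob v b.
  rewrite Ex_sum//; last by move=> i; apply: bmb; exact: measurable_band.
  rewrite (eq_bigr (fun=> band_prob v b)); first by rewrite sumr_const card_ord mulr_natl.
  move=> i _; apply: (Ex_dot1 mu_rot (phi := fun z => ind (b / 2 <= z <= b))) => //.
  by move=> f f1; apply: bmb; exact: measurable_band.
move=> E1; rewrite E1 in hcov.
have {}hcov := le_trans hsec hcov.
have hN3 : N.+1%:R * (b * D) <= 34 * A ^+ 2.
  have : N.+1%:R * h * (4 * A) <= (8 * A + 2 * h) * (4 * A) by rewrite ler_pM2r//; lra.
  have -> : N.+1%:R * h * (4 * A) = N.+1%:R * (b * D) by rewrite /h; field; lra.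
  nra.
have p0 : 0 <= band_prob v b by apply: Ex_ge0 => x _; exact: ler0n.
have A34 : 0 < 34 * A ^+ 2 by nra.
rewrite mulrAC ler_pdivrMr//.
have : (8 * be)^-1 * (b * D) <= N.+1%:R * band_prob v b * (b * D) by rewrite ler_pM2r.
nra.
Qed.

End BandProbability.

(** * Disagreement of two half-spaces and distance of their normals *)

Section Disagreement.
Variables (R : realType) (d : nat) (mu : probability (vec R d) R).
Local Notation V := (vec R d).
Local Notation S := (@sphere R d).
Hypothesis mu_rot : rotation_invariant mu.
Let mS : measurable (S : set V). Proof. exact: measurable_sphere. Qed.
Let S1 : mu (S : set V) = 1%E. Proof. exact: mu_rot.1. Qed.
Local Notation E := (Ex mu S).
Local Notation bmS := (bm (S : set V)).

Definition dist (v w : 'rV[R]_d) : R := Num.sqrt (dotv (v - w) (v - w)).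

Lemma dist_ge0 v w : 0 <= dist v w. Proof. exact: sqrtr_ge0. Qed.

Lemma dist_sqr v w : (dist v w) ^+ 2 = dotv (v - w) (v - w).
Proof. by rewrite sqr_sqrtr// dotv_ge0. Qed.

Lemma dist_sphere v w : sphere v -> sphere w -> (dist v w) ^+ 2 = 2 - 2 * dotv v w.
Proof.
move=> v1 w1; rewrite dist_sqr !dotvE (v1 : dotv v v = 1) (w1 : dotv w w = 1) (dotvC w v).
by ring.
Qed.

(** [s] is the sine of the angle, written through the chord [dist v u]; the bounds on the chord
    exclude parallel vectors, which do not determine [e]. *)
Lemma orthonormal_decomp (v u : 'rV[R]_d) : sphere v -> sphere u -> 0 < dist v u < 2 ->
  exists e s, [/\ orthonormal2 v e, 0 < s, u = dotv v u *: v + s *: e,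
    s ^+ 2 = (dist v u) ^+ 2 * (1 - (dist v u) ^+ 2 / 4) & s <= dist v u].
Proof.
move=> v1 u1 /andP[r0 r2]; have rE := dist_sphere v1 u1.
set r := dist v u in r0 r2 rE *; set k := dotv v u in rE *.
have kE : k = 1 - r ^+ 2 / 2 by lra.
have sE : 1 - k ^+ 2 = r ^+ 2 * (1 - r ^+ 2 / 4) by rewrite kE; field.
have pos : 0 < r ^+ 2 * (1 - r ^+ 2 / 4) by rewrite mulr_gt0//; nra.
pose s := Num.sqrt (1 - k ^+ 2).
have s0 : 0 < s by rewrite sqrtr_gt0 sE.
have ss : s ^+ 2 = 1 - k ^+ 2 by rewrite sqr_sqrtr// sE ltW.
exists (s^-1 *: (u - k *: v)), s; split => //.
- split=> //.
    rewrite /sphere/= !dotvE (u1 : dotv u u = 1) (v1 : dotv v v = 1) (dotvC u v) -/k.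
    transitivity (s^-1 ^+ 2 * (1 - k ^+ 2)); first by ring.
    by rewrite -ss exprVn mulVf// expf_neq0// gt_eqF.
  by rewrite !dotvE (v1 : dotv v v = 1) -/k mulr1 subrr mulr0.
- by rewrite scalerA mulfV ?gt_eqF// scale1r addrC subrK.
- by rewrite ss.
- rewrite -(@ler_sqr _ s r) ?nnegrE ?ltW// ss sE; nra.
Qed.

Lemma sum_ind_disjoint (N : nat) (b : 'I_N -> bool) :
  (forall i j, b i -> b j -> i = j) -> \sum_(i < N) (ind (b i) : R) <= 1.
Proof.
move=> bij; case: (pickP b) => [i bi|nb].
  rewrite (bigD1 i)//= bi big1 ?addr0// => j ji.
  by case bj: (b j) => //; move: ji; rewrite (bij _ _ bj bi) eqxx.
by rewrite big1 // => i _; rewrite nb.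
Qed.

(** Points orthogonal to both directions would lie in every rotated copy; [y != 0] removes them, so
    that copies can be disjoint. *)
Definition wedge (tau : R) (z y : R) : bool := (y != 0) && (`|z| <= tau * `|y|).

Let measurable_wedge tau (v e : 'rV[R]_d) :
  measurable_fun setT (fun x : V => wedge tau (dotv v x) (dotv e x)).
Proof.
have mv (f : 'rV[R]_d) : measurable_fun setT (fun x : V => dotv f x) by exact: measurable_dotv.
apply: measurable_and.
  by apply: measurable_neg; apply: measurable_fun_eqr.
apply: measurable_fun_ler; first exact: measurableT_comp.
by apply: measurable_funM => //; exact: measurableT_comp.
Qed.

Let bm_wedge tau (v e : 'rV[R]_d) : bmS (fun x => ind (wedge tau (dotv v x) (dotv e x)) : R).
Proof. exact: bm_bool. Qed.

(* Rotating the wedge by about 1/(6 tau) angles gives disjoint sets of equal measure. *)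
Lemma wedge_prob_le (tau : R) (v e : 'rV[R]_d) : orthonormal2 v e -> 0 < tau <= 1 ->
  E (fun x => ind (wedge tau (dotv v x) (dotv e x)) : R) <= 6 * tau.
Proof.
move=> ve /andP[t0 t1]; have [v1 e1 ve0] := ve.
(* Two wedges with a common point have slopes at most 5 tau apart, so slopes spaced by 6 tau in
   [0, 1] give disjoint wedges. *)
pose h := 6 * tau; have h0 : 0 < h by rewrite /h; lra.
pose N := (absz (Num.floor h^-1)).+1.
have fl0 : (0 <= Num.floor h^-1)%R by rewrite floor_ge0 invr_ge0 ltW.
have N1 : N.-1%:R * h <= 1.
  rewrite -ler_pdivlMr// div1r /= natr_absz ger0_norm//; exact: floor_le.
have N2 : 1 <= N%:R * h.
  rewrite -ler_pdivrMr// div1r /N -natr1 natr_absz ger0_norm// ltW//.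
  have : h^-1 < ((Num.floor h^-1 + 1)%:~R : R) by rewrite lt_succ_floor// num_real.
  by rewrite intrD.
pose t (i : nat) := i%:R * h.
have ti (i : 'I_N) : 0 <= t i <= 1.
  apply/andP; split; first by rewrite /t mulr_ge0 ?ler0n// ltW.
  rewrite /t; apply: le_trans N1.
  by rewrite ler_pM2r// ler_nat -ltnS; exact: ltn_ord.
pose n (i : nat) := Num.sqrt (1 + (t i) ^+ 2).
have n0 i : 0 < n i by rewrite sqrtr_gt0 ltr_wpDr// sqr_ge0.
have nn i : (n i) ^+ 2 = 1 + (t i) ^+ 2 by rewrite sqr_sqrtr// addr_ge0// sqr_ge0.
pose vt i := (n i)^-1 *: (v + t i *: e).
pose et i := (n i)^-1 *: (e - t i *: v).
have vtE i x : dotv (vt i) x = (n i)^-1 * (dotv v x + t i * dotv e x) by rewrite /vt !dotvE.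
have etE i x : dotv (et i) x = (n i)^-1 * (dotv e x - t i * dotv v x) by rewrite /et !dotvE.
have ort i : orthonormal2 (vt i) (et i).
  have nV : (n i)^-1 ^+ 2 * (1 + t i ^+ 2) = 1.
    by rewrite -nn exprVn mulVf// expf_neq0// gt_eqF.
  have ev0 : dotv e v = 0 by rewrite dotvC.
  split.
  - rewrite /sphere/= -[RHS]nV /vt !dotvE (v1 : dotv v v = 1) (e1 : dotv e e = 1) ve0 ev0; ring.
  - rewrite /sphere/= -[RHS]nV /et !dotvE (v1 : dotv v v = 1) (e1 : dotv e e = 1) ve0 ev0; ring.
  - by rewrite /vt /et !dotvE (v1 : dotv v v = 1) (e1 : dotv e e = 1) ve0 ev0; ring.
have disj_lt (x : V) (i j : nat) : 0 <= t i <= 1 -> 0 <= t j <= 1 -> (i < j)%N ->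
    wedge tau (dotv (vt i) x) (dotv (et i) x) -> wedge tau (dotv (vt j) x) (dotv (et j) x) -> False.
  move=> /andP[ti0 ti1] /andP[tj0 tj1] ij; rewrite /wedge !vtE !etE.
  set z := dotv v x; set y := dotv e x.
  have ni := n0 i; have nj := n0 j.
  rewrite !normrM !(gtr0_norm (_ : 0 < (n _)^-1)) ?invr_gt0//.
  rewrite !(mulrCA tau) !ler_pM2l ?invr_gt0//.
  rewrite mulf_eq0 negb_or => /andP[/andP[_ be0] hal] /andP[_ hj].
  set al := z + t i * y in hal; set be := y - t i * z in be0 hal.
  have be_gt0 : 0 < `|be| by rewrite normr_gt0.
  have tij : h <= t j - t i.
    have ij' : (i%:R + 1 : R) <= j%:R by rewrite natr1 ler_nat.
    by rewrite /t -mulrBl -[X in X <= _]mul1r ler_pM2r//; lra.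
  set ti' := t i in ti0 ti1 tij al be hal be0 be_gt0 hj *; set tj' := t j in tj0 tj1 tij hj.
  (* The coordinates for slope t_j expressed through those for slope t_i, which are [al] and [be] up
     to normalisation. *)
  have e1' : (1 + ti' ^+ 2) * (z + tj' * y) = (tj' - ti') * be + (1 + ti' * tj') * al.
    by rewrite /al /be; ring.
  have e2' : (1 + ti' ^+ 2) * (y - tj' * z) = (1 + ti' * tj') * be - (tj' - ti') * al.
    by rewrite /al /be; ring.
  have c0 : 0 < 1 + ti' ^+ 2 by rewrite ltr_wpDr// sqr_ge0.
  have a1 : 0 <= tj' - ti' <= 1 by rewrite (le_trans (ltW h0) tij)/=; lra.
  have a2 : 0 <= 1 + ti' * tj' <= 2.
    by have : 0 <= ti' * tj' <= 1 by [rewrite mulr_ge0//= mulr_ile1//]; lra.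
  have hj2 : `|(1 + ti' ^+ 2) * (z + tj' * y)| <= tau * `|(1 + ti' ^+ 2) * (y - tj' * z)|.
    by rewrite !normrM (gtr0_norm c0) mulrCA ler_pM2l.
  move: hj2; rewrite e1' e2'.
  have low : (tj' - ti') * `|be| - 2 * `|al| <= `|(tj' - ti') * be + (1 + ti' * tj') * al|.
    have : `|(tj' - ti') * be| - `|(1 + ti' * tj') * al| <= `|(tj' - ti') * be + (1 + ti' * tj') * al|.
      by rewrite -[(1 + _) * al]opprK normrN; exact: lerB_dist.
    rewrite !normrM (ger0_norm (_ : 0 <= tj' - ti')); last by case/andP: a1.
    rewrite (ger0_norm (_ : 0 <= 1 + ti' * tj')); last by case/andP: a2.
    have : (1 + ti' * tj') * `|al| <= 2 * `|al| by rewrite ler_wpM2r//; case/andP: a2.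
    lra.
  have upp : `|(1 + ti' * tj') * be - (tj' - ti') * al| <= 2 * `|be| + `|al|.
    apply: (le_trans (ler_normB _ _)); rewrite !normrM.
    rewrite (ger0_norm (_ : 0 <= tj' - ti')); last by case/andP: a1.
    rewrite (ger0_norm (_ : 0 <= 1 + ti' * tj')); last by case/andP: a2.
    apply: lerD; first by rewrite ler_wpM2r//; case/andP: a2.
    by rewrite -[X in _ <= X]mul1r ler_wpM2r//; case/andP: a1.
  move=> hh; have h3 : tau * `|(1 + ti' * tj') * be - (tj' - ti') * al| <= tau * (2 * `|be| + `|al|).
    by rewrite ler_pM2l.
  have h4 : h * `|be| <= (tj' - ti') * `|be| by rewrite ler_pM2r.
  have h5 : tau * `|al| <= tau * (tau * `|be|) by rewrite ler_pM2l.
  have h6 : tau * (tau * `|be|) <= tau * `|be|.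
    by rewrite ler_pM2l// -[X in _ <= X]mul1r ler_pM2r.
  have h7 : 0 < tau * `|be| by rewrite mulr_gt0.
  by rewrite /h in h4; lra.
have hsum : E (fun x => \sum_(i < N) (ind (wedge tau (dotv (vt i) x) (dotv (et i) x)) : R)) <= 1.
  rewrite -[X in _ <= X](Ex_cst mS S1 1); apply: le_Ex => //.
  - by apply: bm_sum => i; exact: bm_wedge.
  - exact: bm_cst.
  move=> x _; apply: sum_ind_disjoint => i j wi wj; apply: val_inj => /=.
  case: (ltngtP i j) => // ij.
    by case: (disj_lt x i j (ti i) (ti j) ij wi wj).
  by case: (disj_lt x j i (ti j) (ti i) ij wj wi).
rewrite Ex_sum// in hsum.
have eqi (i : 'I_N) : E (fun x => ind (wedge tau (dotv (vt i) x) (dotv (et i) x)) : R) =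
    E (fun x => ind (wedge tau (dotv v x) (dotv e x)) : R).
  by apply: (Ex_dot2 mu_rot (phi := fun z y => ind (wedge tau z y))) => // w f _ _; exact: bm_wedge.
rewrite (eq_bigr _ (fun i _ => eqi i)) sumr_const card_ord -mulr_natl in hsum.
rewrite -/h; set p := E _ in hsum *.
have p0 : 0 <= p by apply: Ex_ge0 => x _; exact: ler0n.
have : p * 1 <= p * (N%:R * h) by rewrite ler_wpM2l.
nra.
Qed.

Lemma sgnp_neq_wedge (k s z y : R) : 2^-1 <= k -> 0 < s ->
  sgnp z <> sgnp (k * z + s * y) -> wedge (2 * s) z y.
Proof.
move=> k2 s0; rewrite /sgnp /wedge.
have [z0|z0] := leP 0 z; have [w0|w0] := leP 0 (k * z + s * y) => // _.
  have y0 : y < 0 by nra.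
  by rewrite lt_eqF//= (ltr0_norm y0) (ger0_norm z0); nra.
have y0 : 0 < y by nra.
by rewrite gt_eqF//= (gtr0_norm y0) (ltr0_norm z0); nra.
Qed.

Lemma measurable_sgnp (f : 'rV[R]_d) : measurable_fun setT (fun x : V => sgnp (dotv f x)).
Proof.
by apply: measurable_fun_ifT => //; apply: measurable_fun_ler => //; exact: measurable_dotv.
Qed.

(** For a chord below 1/2 the cosine exceeds 1/2, and a change of sign puts x in a wedge of slope 2
    s, at most twice the chord. For longer chords the bound exceeds 1. *)
Lemma disagreement_prob_le (v u : 'rV[R]_d) : sphere v -> sphere u ->
  E (fun x => ind (sgnp (dotv v x) != sgnp (dotv u x)) : R) <= 12 * dist v u.
Proof.
move=> v1 u1; set r := dist v u; have r0 : 0 <= r by exact: dist_ge0.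
have bd : bmS (fun x => ind (sgnp (dotv v x) != sgnp (dotv u x)) : R).
  apply: bm_bool; apply: measurable_neg; apply: measurable_fun_eqr; exact: measurable_sgnp.
have [rh|rh] := leP 2^-1 r.
  apply: (@le_trans _ _ 1); last lra.
  rewrite -[X in _ <= X](Ex_cst mS S1 1); apply: le_Ex => //; first exact: bm_cst.
  by move=> x _; case: (_ != _).
have [r00|rn0] := eqVneq r 0.
  have vu : v = u.
    apply/eqP; rewrite -subr_eq0 -dotv_eq0 -dist_sqr -/r r00 expr0n//.
  rewrite r00 mulr0 -[X in _ <= X](Ex_cst mS S1 0); apply: le_Ex => //; first exact: bm_cst.
  by move=> x _; rewrite vu eqxx.
have rgt0 : 0 < r by rewrite lt_neqAle eq_sym rn0.
have r2 : 0 < r < 2 by rewrite rgt0/=; lra.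
have [e [s [ve s0 uE ss sr]]] := orthonormal_decomp v1 u1 r2.
have rE := dist_sphere v1 u1; rewrite -/r in rE ss sr.
have k2 : 2^-1 <= dotv v u by nra.
apply: (@le_trans _ _ (6 * (2 * s))); last lra.
apply: (@le_trans _ _ (E (fun x => ind (wedge (2 * s) (dotv v x) (dotv e x)) : R))); last first.
  by apply: wedge_prob_le => //; lra.
apply: le_Ex => //.
move=> x _; case: (boolP (sgnp (dotv v x) != _)) => [/eqP|_]; last by rewrite ler0n.
rewrite [in dotv u x]uE dotvDl !dotvZl => /(sgnp_neq_wedge k2 s0) ->.
by [].
Qed.

End Disagreement.

(** * Pointwise drift of the exponential potential *)

Section DriftInequality.
Variable R : realType.

(* Averaging over the noisy label costs a factor (1 - 2 eta) on |X|. *)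
Lemma noisy_exp_le (q eta X xi : R) : 0 <= q <= 1 -> eta <= 2^-1 ->
  (if sgnp xi == 1 then 1 - q else q) <= eta -> 0 <= X * xi -> (xi = 0 -> X = 0) ->
  q + (1 - q) * expR X <=
  1 + X / 2 - (1 - 2 * eta) / 2 * `|X| + X ^+ 2 * expR `|X|.
Proof.
move=> /andP[q0 q1] eta2; rewrite /sgnp => hq Xxi xi0.
have hX := expR_quadratic X.
have sq : 0 <= X ^+ 2 * expR `|X| by rewrite mulr_ge0 ?sqr_ge0// expR_ge0.
move: hq; have [xi_ge0|xi_lt0] := leP 0 xi => hq.
  rewrite eqxx in hq.
  have X0 : 0 <= X.
    have [e|n] := eqVneq xi 0; first by rewrite xi0.
    by rewrite pmulr_lge0// in Xxi; rewrite lt_neqAle eq_sym n.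
  rewrite (ger0_norm X0) in hX sq *; nra.
rewrite (_ : (-1 == 1 :> R) = false) in hq; last by apply/eqP; lra.
have X0 : X <= 0 by rewrite nmulr_lge0 in Xxi.
by rewrite (ler0_norm X0) in hX sq *; nra.
Qed.

Lemma sqr_le_exp (t : R) : 0 <= t -> t ^+ 2 <= 2 * expR t.
Proof.
by move=> t0; have := @expR_ge1Dxn R t 1 t0; rewrite (_ : 2`!%:R = 2 :> R)//; lra.
Qed.

(** Growth in y is absorbed by exp (2 D y), whose mean over the band is bounded, while the small
    factor (ka ga)^2 survives. In 24 = 8 + 16, the 8 comes from [al] and the 16 from Y^2 <= 2 exp
    Y. *)
Lemma expR_lin_sq (al h y ka ga D : R) : 0 <= al -> al <= 2 * (ka * ga) ->
  al <= 1 -> h = ka * ga * D -> 0 <= D -> 0 <= ka * ga -> ka * ga <= 2^-1 -> 0 <= y ->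
  (al + 2 * h * y) ^+ 2 * expR (al + 2 * h * y) <=
  24 * expR 1 * (ka * ga) ^+ 2 * expR (2 * D * y).
Proof.
move=> al0 al2 al1 hE D0 kg0 kg1 y0; set k := ka * ga in al2 hE kg0 kg1 *.
have Dy0 : 0 <= D * y by rewrite mulr_ge0.
set Y := D * y in Dy0.
have -> : 2 * h * y = 2 * k * Y by rewrite hE /Y; ring.
have -> : 2 * D * y = Y + Y by rewrite /Y; ring.
have e1 : expR (al + 2 * k * Y) <= expR 1 * expR Y.
  by rewrite -expRD ler_expR; apply: lerD => //; nra.
have e2 : (al + 2 * k * Y) ^+ 2 <= 24 * k ^+ 2 * expR Y.
  have h1 : (al + 2 * k * Y) ^+ 2 <= 2 * al ^+ 2 + 8 * k ^+ 2 * Y ^+ 2.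
    by have := sqr_ge0 (al - 2 * k * Y); nra.
  have h2 := sqr_le_exp Dy0.
  have h3 : 1 <= expR Y by rewrite -expR0 ler_expR.
  have h4 : al ^+ 2 <= 4 * k ^+ 2 by nra.
  have h5 : k ^+ 2 * Y ^+ 2 <= k ^+ 2 * (2 * expR Y) by rewrite ler_wpM2l ?sqr_ge0.
  have h6 : k ^+ 2 * 1 <= k ^+ 2 * expR Y by rewrite ler_wpM2l ?sqr_ge0.
  lra.
apply: (@le_trans _ _ (24 * k ^+ 2 * expR Y * (expR 1 * expR Y))).
  by apply: ler_pM => //; rewrite ?sqr_ge0 ?expR_ge0.
rewrite expRD le_eqVlt; apply/orP; left; apply/eqP; ring.
Qed.

(** Here z = w.x, y = e.x and xi = u.x. The right side is arranged by known means over the band: the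
    term linear in y vanishes by symmetry, the one in |y| is the gain, the exponential one is the
    remainder. *)
Lemma drift_le (q eta k s y z xi r lam b D ka ga nu : R) :
  0 <= q <= 1 -> eta <= 2^-1 -> ga = 1 - 2 * eta ->
  (if sgnp xi == 1 then 1 - q else q) <= eta ->
  xi = k * z + s * y -> b / 2 <= z -> z <= b -> 0 < b -> 0 < lam -> 0 < r -> 0 < s -> s <= r ->
  `|k| <= 1 -> 0 < ga <= 1 -> 0 < ka <= 2^-1 -> 0 <= nu <= 1 -> 0 < D ->
  lam * b = ka * ga * D -> ka * ga * D / r * b <= ka * ga ^+ 2 * nu ->
  q + (1 - q) * expR (lam * (2 * (z * xi) / r)) <=
  1 + 3 / 2 * (ka * ga * D / r * b) + lam * s / r * (z * y) -
  ga * (ka * ga * D / r) * s / 2 * `|y| +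
  24 * expR 1 * (ka * ga) ^+ 2 * expR (2 * D * `|y|).
Proof.
move=> q01 eta2 gaE hq xiE z1 z2 b0 lam0 r0 s0 sr k1 /andP[ga0 ga1] /andP[ka0 ka1] /andP[nu0 nu1] D0 hE hbr.
have kg0 : 0 < ka * ga by rewrite mulr_gt0.
have z0 : 0 < z by apply: lt_le_trans z1; rewrite divr_gt0.
set hr := ka * ga * D / r in hbr *.
have hr0 : 0 <= hr by apply: divr_ge0; [apply: mulr_ge0|]; exact: ltW.
set K := 24 * _ * _.
pose X := lam * (2 * (z * xi) / r); rewrite -/X.
have c0 : 0 < lam * (2 * z / r) by rewrite mulr_gt0// divr_gt0// mulr_gt0.
have XE : X = lam * (2 * z / r) * xi by rewrite /X; ring.
have hn : q + (1 - q) * expR X <= 1 + X / 2 - ga / 2 * `|X| + X ^+ 2 * expR `|X|.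
  rewrite gaE; apply: (@noisy_exp_le q eta X xi) => //.
    by rewrite XE -mulrA; apply: mulr_ge0; [exact: ltW|rewrite -expr2 sqr_ge0].
  by rewrite XE => ->; rewrite mulr0.
apply: (le_trans hn); clear hn hq.
have absX : `|X| = lam * (2 * z / r) * `|xi| by rewrite XE normrM gtr0_norm.
have hrE : hr * b = lam * b ^+ 2 / r by rewrite /hr -hE; ring.
have xi_le : `|xi| <= b + s * `|y|.
  rewrite xiE; apply: (le_trans (ler_normD _ _)); rewrite !normrM (gtr0_norm s0) (gtr0_norm z0).
  by rewrite lerD2r; apply: le_trans z2; rewrite -[X in _ <= X]mul1r ler_pM2r.
have xi_ge : s * `|y| - b <= `|xi|.
  have : s * `|y| <= `|xi| + `|k * z|.
    rewrite -[X in X * _](gtr0_norm s0) -normrM (_ : s * y = xi - k * z); last by rewrite xiE; ring.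
    exact: ler_normB.
  rewrite normrM (gtr0_norm z0); have : `|k| * z <= z by rewrite -[X in _ <= X]mul1r ler_pM2r.
  lra.
have t1 : X / 2 <= hr * b + lam * s / r * (z * y).
  have -> : X / 2 = lam / r * (k * z ^+ 2) + lam * s / r * (z * y) by rewrite XE xiE; field; rewrite gt_eqF.
  rewrite lerD2r hrE mulrAC ler_pdivrMr//.
  have -> : lam * b ^+ 2 / r * r = lam * b ^+ 2 by field; rewrite gt_eqF.
  rewrite ler_pM2l//; have kk : k <= 1 by apply: le_trans (ler_norm _) k1.
  have : k * z ^+ 2 <= 1 * z ^+ 2 by rewrite ler_wpM2r ?sqr_ge0.
  nra.
(* The lower edge z >= b / 2 of the band is used here: it keeps the first-order effect |X|
   proportional to |xi|. *)
have t2 : hr * (s * `|y| - b) <= `|X|.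
  have [neg|pos] := leP (s * `|y| - b) 0.
    by apply: (@le_trans _ _ 0) => //; rewrite mulr_ge0_le0.
  rewrite absX; apply: ler_pM => //; first exact: ltW.
  have -> : hr = lam * (2 * (b / 2) / r) by rewrite /hr -hE; field; rewrite gt_eqF.
  by rewrite ler_pM2l// ler_pM2r ?invr_gt0// ler_pM2l.
have t2' : - (ga / 2) * `|X| <= - (ga * hr * s / 2) * `|y| + hr * b / 2.
  have h1 : ga / 2 * (hr * (s * `|y| - b)) <= ga / 2 * `|X| by rewrite ler_wpM2l// divr_ge0// ltW.
  have h2 : ga * (hr * b) <= 1 * (hr * b) by rewrite ler_wpM2r// mulr_ge0// ltW.
  lra.
pose al := 2 * (hr * b).
have al0 : 0 <= al by apply: mulr_ge0 => //; apply: mulr_ge0 => //; exact: ltW.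
have al2 : al <= 2 * (ka * ga).
  rewrite /al ler_pM2l//; apply: (le_trans hbr).
  have -> : ka * ga ^+ 2 * nu = ka * ga * (ga * nu) by ring.
  by apply: ler_piMr; [exact: ltW|nra].
have kg1 : ka * ga <= 2^-1 by clear -ka0 ka1 ga0 ga1; nra.
have Xle : `|X| <= al + 2 * (ka * ga * D) * `|y|.
  rewrite absX; apply: (@le_trans _ _ (lam * (2 * b / r) * (b + s * `|y|))).
    apply: ler_pM => //; first exact: ltW.
    by rewrite ler_pM2l// ler_pM2r ?invr_gt0// ler_pM2l.
  have -> : lam * (2 * b / r) * (b + s * `|y|) = al + 2 * (lam * b) * (s / r) * `|y|.
    by rewrite /al hrE; field; rewrite gt_eqF.
  rewrite lerD2l hE ler_wpM2r//.
  apply: ler_piMr; last by rewrite ler_pdivrMr// mul1r.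
  by rewrite mulr_ge0// -hE mulr_ge0// ltW.
have t3 : X ^+ 2 * expR `|X| <= K * expR (2 * D * `|y|).
  apply: (le_trans _ (@expR_lin_sq al (ka * ga * D) `|y| ka ga D al0 al2 _ _ _ _ kg1 _)) => //.
  - rewrite -[X ^+ 2]real_normK ?num_real//; apply: ler_pM; rewrite ?sqr_ge0 ?expR_ge0 ?ler_expR//.
    by rewrite ler_sqr ?nnegrE// (le_trans _ Xle).
  - lra.
  - exact: ltW.
  - by rewrite mulr_ge0// ltW.
lra.
Qed.

(** In units of p ka ga^2 / 1024 the gain is at least 1/2, because s >= r / 2; the two losses are at
    most 1/8 each, and 1/4 remains. *)
Lemma drift_total_le (p E4 E5 c hrb D r s ka ga nu : R) :
  0 <= p -> 0 < ga <= 1 -> 0 < ka -> 0 < D -> 0 < r -> r / 2 <= s ->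
  hrb <= ka * ga ^+ 2 * nu -> nu * (12 * 1024) <= 1 ->
  ka * (24 * expR 1 * (2 * expR 16)) * (8 * 1024) <= 1 ->
  p / (512 * D) <= E4 -> E5 <= 2 * expR 16 * p ->
  (1 + 3 / 2 * hrb) * p + c * 0 + - (ga * (ka * ga * D / r) * s / 2) * E4 +
  24 * expR 1 * (ka * ga) ^+ 2 * E5 <= p * (1 - ka * ga ^+ 2 / (4 * 1024)).
Proof.
move=> p0 /andP[ga0 ga1] ka0 D0 r0 s2 hbr nuC kaC h4 h5.
have s0 : 0 < s by apply: lt_le_trans s2; rewrite divr_gt0.
set hr := ka * ga * D / r.
have hr0 : 0 <= hr by apply: divr_ge0; [apply: mulr_ge0; [apply: mulr_ge0|]|]; exact: ltW.
set K := 24 * _ * _.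
have K0 : 0 <= K by apply: mulr_ge0; [apply: mulr_ge0 => //; exact: expR_ge0|exact: sqr_ge0].
have f1 : K * E5 <= ka * ga ^+ 2 / (8 * 1024) * p.
  apply: (@le_trans _ _ (K * (2 * expR 16 * p))); first by rewrite ler_wpM2l.
  rewrite mulrA ler_wpM2r// /K.
  have -> : 24 * expR 1 * (ka * ga) ^+ 2 * (2 * expR 16) =
    ka * ga ^+ 2 * (ka * (24 * expR 1 * (2 * expR 16))) by ring.
  have kg2 : 0 <= ka * ga ^+ 2 by rewrite mulr_ge0 ?sqr_ge0// ltW.
  apply: ler_wpM2l => //.
  by rewrite -div1r ler_pdivlMr; [exact: kaC|apply: mulr_gt0; rewrite ltr0n].
have f2 : ka * ga ^+ 2 / (2 * 1024) * p <= ga * hr * s / 2 * E4.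
  have : ga * hr * s / 2 * (p / (512 * D)) <= ga * hr * s / 2 * E4.
    by apply: ler_wpM2l => //; apply: divr_ge0 => //; apply: mulr_ge0; [apply: mulr_ge0 => //|]; exact: ltW.
  apply: le_trans.
  have -> : ga * hr * s / 2 * (p / (512 * D)) = ka * ga ^+ 2 * (s / r) / 1024 * p.
    by rewrite /hr; field; rewrite !gt_eqF.
  rewrite ler_wpM2r//.
  have : 2^-1 <= s / r by rewrite ler_pdivlMr//; lra.
  have : 0 <= ka * ga ^+ 2 by rewrite mulr_ge0 ?sqr_ge0// ltW.
  nra.
have f3 : 3 / 2 * (hrb) * p <= ka * ga ^+ 2 / (8 * 1024) * p.
  rewrite ler_wpM2r//.
  have : ka * ga ^+ 2 * nu * (12 * 1024) <= ka * ga ^+ 2 * 1.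
    by rewrite -mulrA ler_wpM2l// mulr_ge0 ?sqr_ge0// ltW.
  lra.
lra.
Qed.

End DriftInequality.

(** * Mean effect of one labelled point *)

Section OneStep.
Variables (R : realType) (d : nat) (mu : probability (vec R d) R).
Local Notation V := (vec R d).
Local Notation S := (@sphere R d).
Hypothesis mu_rot : rotation_invariant mu.
Hypothesis d2 : (2 <= d)%N.
Let mS : measurable (S : set V). Proof. exact: measurable_sphere. Qed.
Let S1 : mu (S : set V) = 1%E. Proof. exact: mu_rot.1. Qed.
Local Notation E := (Ex mu S).
Local Notation bmS := (bm (S : set V)).
Let ED (f g : V -> R) : bmS f -> bmS g -> E (fun x => f x + g x) = E f + E g.
Proof. exact: ExD. Qed.
Let EZ c (f : V -> R) : bmS f -> E (fun x => c * f x) = c * E f.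
Proof. exact: ExZ. Qed.
Let leE (f g : V -> R) : bmS f -> bmS g -> (forall x, sphere x -> f x <= g x) -> E f <= E g.
Proof. exact: le_Ex. Qed.

Lemma dist_reflect_sqr (w u x : 'rV[R]_d) : sphere x ->
  (dist (reflect x w) u) ^+ 2 = (dist w u) ^+ 2 + 4 * (dotv w x * dotv u x).
Proof.
move=> x1; rewrite !dist_sqr /reflect !dotvE (x1 : dotv x x = 1).
rewrite (dotvC x w) (dotvC x u) (dotvC u w); ring.
Qed.

(** Concavity of the square root: sqrt (r^2 + 4 P) <= r + 2 P / r. *)
Lemma dist_reflect_le (w u x : 'rV[R]_d) : sphere x -> 0 < dist w u ->
  dist (reflect x w) u <= dist w u + 2 * (dotv w x * dotv u x) / dist w u.
Proof.
move=> x1; set r := dist w u => r0; set P := dotv w x * dotv u x.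
have h := dist_reflect_sqr w u x1; rewrite -/r -/P in h.
have h0 := dist_ge0 (reflect x w) u.
have P2 : - (r ^+ 2) / 4 <= P.
  by have := sqr_ge0 (dist (reflect x w) u); rewrite h; lra.
have q0 : 0 <= r + 2 * P / r.
  have -> : r + 2 * P / r = (r ^+ 2 + 2 * P) / r by field; rewrite gt_eqF.
  by apply: divr_ge0; [have := sqr_ge0 r; lra|exact: ltW].
rewrite -(@ler_sqr _ (dist _ _)) ?nnegrE// h.
have -> : (r + 2 * P / r) ^+ 2 = r ^+ 2 + 4 * P + (2 * P / r) ^+ 2 by field; rewrite gt_eqF.
by rewrite lerDl sqr_ge0.
Qed.

(** The bound above degenerates as r tends to 0. Here u.x <= w.x + r gives r^2 + 4 b (b + r) = (r +
    2 b)^2 under the root. *)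
Lemma dist_reflect_near (w u x : 'rV[R]_d) (b : R) : sphere x -> 0 <= dotv w x <= b ->
  dist (reflect x w) u <= dist w u + 2 * b.
Proof.
move=> x1 /andP[z0 zb]; have h := dist_reflect_sqr w u x1.
set r := dist w u in h *; have r0 : 0 <= r by exact: dist_ge0.
rewrite -(@ler_sqr _ (dist _ _)) ?nnegrE ?dist_ge0//; last lra.
rewrite h; have : (dotv u x - dotv w x) ^+ 2 <= r ^+ 2.
  have -> : dotv u x - dotv w x = dotv (u - w) x by rewrite !dotvE.
  apply: (le_trans (cauchy_schwarz _ _)); rewrite (x1 : dotv x x = 1) mulr1 dist_sqr.
  by rewrite -[w - u]opprB !dotvE; lra.
move=> hh; have : dotv u x - dotv w x <= r.
  by have [//|h1] := leP (dotv u x - dotv w x) r; nra.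
nra.
Qed.

Variables (u : 'rV[R]_d) (q : 'rV[R]_d -> R) (eta : R).
Hypotheses (u1 : sphere u) (eta0 : 0 <= eta < 2^-1).
Hypothesis mq : measurable_fun setT (q : V -> R).
Hypothesis q01 : forall x, sphere x -> 0 <= q x <= 1.
Hypothesis noise : bounded_noise eta u q.

Let ga := 1 - 2 * eta.
Let D : R := Num.sqrt d%:R.

Lemma bm_q : bmS q.
Proof.
split=> //; exists 1 => x /q01 /andP[q0 q1].
by rewrite ger0_norm.
Qed.

Lemma continuous_sqrtr : continuous (@Num.sqrt R).
Proof. exact: sqrt_continuous. Qed.

Lemma bm_dist_reflect (w : 'rV[R]_d) : bmS (fun x => dist (reflect x w) u).
Proof.
apply: (bm_continuous (phi := Num.sqrt)); first exact: continuous_sqrtr.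
split.
  have m : measurable_fun setT (fun x : V => reflect x w - u : V).
    apply: measurable_vecD => //; apply: measurable_vecD => //; apply: measurable_vecN.
    apply: measurable_vecZ => //; apply: measurable_funM => //; exact: measurable_dotv.
  exact: measurable_dotv.
exists ((dist w u) ^+ 2 + 4 * (dotv w w * dotv u u + 1)) => x x1.
rewrite -dist_sqr ger0_norm ?sqr_ge0// dist_reflect_sqr//.
have := cauchy_schwarz w x; have := cauchy_schwarz u x; rewrite (x1 : dotv x x = 1) !mulr1.
have w0 := dotv_ge0 w; have u0 := dotv_ge0 u.
set a := dotv w x; set c := dotv u x => h1 h2.
suff : a * c <= dotv w w * dotv u u + 1 by lra.
have h3 : (a * c) ^+ 2 <= dotv w w * dotv u u.
  by rewrite exprMn; apply: ler_pM; rewrite ?sqr_ge0.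
have := sqr_ge0 (a * c - 2^-1); nra.
Qed.

(** Left unnormalised by the probability of the band, so that draws outside it are added without
    conditioning. A positive label where w.x > 0 leaves [w] unchanged, whence the constant [f0]. *)
Definition step_mean (w : 'rV[R]_d) (b : R) (f0 : R) (f : V -> R) :=
  E (fun x => ind (b / 2 <= dotv w x <= b) * (q x * f0 + (1 - q x) * f x)).

(** Within distance [a] no contraction is claimed: there r + 2 b <= 2 a, which produces the additive
    term. Beyond [a] the gain of [drift_total_le] is available, since b sqrt d is small compared
    with r. *)
Lemma one_step_contraction (w : 'rV[R]_d) (b lam a ka nu : R) : sphere w ->
  0 < b -> 0 < ka -> ka * (24 * expR 1 * (2 * expR 16)) * (8 * 1024) <= 1 -> ka <= 2^-1 ->
  0 <= nu -> nu * (12 * 1024) <= 1 ->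
  lam * b = ka * ga * D -> b <= a / 2 -> b ^+ 2 <= 2^-1 -> b * D <= nu * ga * a ->
  dist w u <= Num.sqrt 3 ->
  step_mean w b (expR (lam * dist w u)) (fun x => expR (lam * dist (reflect x w) u)) <=
  ((1 - ka * ga ^+ 2 / (4 * 1024)) * expR (lam * dist w u) + expR (2 * lam * a)) * band_prob mu w b.
Proof.
move=> w1 b0 ka0 kaC ka1 nu0 nuC hE ba b2 bD r3.
have [ga0 ga1] : 0 < ga /\ ga <= 1 by move: eta0 => /andP[h1 h2]; rewrite /ga; clear kaC nuC; split; lra.
have d0 : (0 < d)%N by exact: leq_trans d2.
have D0 : 0 < D by rewrite sqrtr_gt0 ltr0n.
have h0 : 0 < ka * ga * D by rewrite !mulr_gt0.
have kg0 : 0 < ka * ga by rewrite mulr_gt0.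
have lam0 : 0 < lam by rewrite -(pmulr_lgt0 _ b0) hE.
set r := dist w u in r3 *; have r_ge0 : 0 <= r by exact: dist_ge0.
pose B := fun z : R => b / 2 <= z <= b.
have mB : measurable_fun setT B by apply: measurable_and; exact: measurable_fun_ler.
have p0 : 0 <= band_prob mu w b by apply: Ex_ge0 => x _; exact: ler0n.
have bB : bmS (fun x => ind (B (dotv w x)) : R) by exact: bm_B.
have bm1 : bmS (fun x => ind (B (dotv w x)) * (q x * expR (lam * r) +
    (1 - q x) * expR (lam * dist (reflect x w) u))).
  have bq := bm_q.
  have be : bmS (fun x => expR (lam * dist (reflect x w) u)).
    by apply: bm_expR; apply: bmZ; exact: bm_dist_reflect.
  apply: bmM; first exact: bB.
  apply: bmD; first by apply: bmM; [exact: bq|exact: bm_cst].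
  by apply: bmM; last exact: be; apply: bmD; [exact: bm_cst|exact: bmN].
have ka_ga : 0 <= 1 - ka * ga ^+ 2 / (4 * 1024).
  have h : ka * ga ^+ 2 <= 1 by clear kaC nuC; nra.
  clear kaC nuC; lra.
have [ra|ra] := leP r a.
  apply: (@le_trans _ _ (E (fun x => expR (2 * lam * a) * ind (B (dotv w x))))).
    apply: leE => //; first exact: bmZ.
    move=> x x1; rewrite -/(B _); case hB: (B _); last by rewrite mulr0 mul0r.
    rewrite mulr1 mul1r; move: hB => /andP[hB1 hB2]; have /andP[q0 q1] := q01 x1.
    have e1 : expR (lam * r) <= expR (2 * lam * a) by rewrite ler_expR; clear kaC nuC; nra.
    have e2 : expR (lam * dist (reflect x w) u) <= expR (2 * lam * a).
      rewrite ler_expR; have := @dist_reflect_near w u x b x1; rewrite -/r => hh.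
      have : dist (reflect x w) u <= r + 2 * b by apply: hh; clear kaC nuC; lra.
      move=> h; clear kaC nuC; nra.
    clear kaC nuC; nra.
  rewrite EZ// -/(band_prob mu w b) ler_wpM2r// lerDr mulr_ge0// expR_ge0//.
have a0 : 0 < a by clear kaC nuC; lra.
have r0 : 0 < r by clear kaC nuC; lra.
have r2 : r < 2.
  apply: (le_lt_trans r3); rewrite -(@ltr_sqr _ _ 2) ?nnegrE ?sqrtr_ge0// sqr_sqrtr//; clear kaC nuC; lra.
have r0r2 : 0 < dist w u < 2 by rewrite -/r r0.
have [e [s [we s0 uE ss sr]]] := orthonormal_decomp w1 u1 r0r2.
rewrite -/r in ss sr; set k := dotv w u in uE.
have e1 : sphere e by case: we.
have k1 : `|k| <= 1 by exact: dotv_le1.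
have rr : r ^+ 2 <= 3.
  by rewrite -[X in _ <= X](@sqr_sqrtr R 3)// ler_sqr ?nnegrE ?sqrtr_ge0.
have s2 : r / 2 <= s.
  have h3 : 0 <= r ^+ 2 * (3 - r ^+ 2) by rewrite mulr_ge0 ?sqr_ge0 ?subr_ge0.
  by rewrite -(@ler_sqr _ (r / 2)) ?nnegrE ?divr_ge0 ?(ltW r0) ?(ltW s0)// ss; clear kaC nuC; lra.
pose K := 24 * expR 1 * (ka * ga) ^+ 2.
pose hr := ka * ga * D / r.
have hr0 : 0 <= hr by rewrite divr_ge0 ?ltW.
have hbr : hr * b <= ka * ga ^+ 2 * nu.
  rewrite /hr mulrAC ler_pdivrMr//.
  have -> : ka * ga * D * b = ka * ga * (b * D) by ring.
  have -> : ka * ga ^+ 2 * nu * r = ka * ga * (nu * ga * r) by ring.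
  rewrite (ler_pM2l kg0); apply: (le_trans bD).
  by apply: ler_wpM2l; [apply: mulr_ge0 => //; exact: ltW|exact: ltW].
have lamE : lam = ka * ga * D / b by rewrite -hE mulfK// gt_eqF.
pose y x := dotv e x.
have nu1 : nu <= 1 by clear kaC; lra.
have pw x : sphere x ->
   ind (B (dotv w x)) * (q x * expR (lam * r) + (1 - q x) * expR (lam * dist (reflect x w) u)) <=
   expR (lam * r) * ((1 + 3 / 2 * (hr * b)) * ind (B (dotv w x)) +
     (lam * s / r) * (ind (B (dotv w x)) * dotv w x * y x) +
     - (ga * hr * s / 2) * (ind (B (dotv w x)) * `|y x|) +
     K * (ind (B (dotv w x)) * expR (2 * D * `|y x|))).
  clear kaC nuC ka_ga bm1; move=> x1; case hB: (B _); last by rewrite !(mul0r, mulr0, addr0).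
  rewrite mulr1 !mul1r; move: hB => /andP[z1 z2].
  set z := dotv w x in z1 z2 *.
  have xiE : dotv u x = k * z + s * y x by rewrite [in LHS]uE dotvDl !dotvZl.
  set xi := dotv u x in xiE.
  pose X := lam * (2 * (z * xi) / r).
  have hq := noise x1; rewrite -/xi in hq.
  have eX : expR (lam * dist (reflect x w) u) <= expR (lam * r) * expR X.
    rewrite -expRD ler_expR /X -mulrDr ler_pM2l//; exact: dist_reflect_le.
  have dr := @drift_le R (q x) eta k s (y x) z xi r lam b D ka ga nu (q01 x1) _ erefl hq xiE z1 z2
    b0 lam0 r0 s0 sr k1 _ _ _ D0 hE hbr.
  apply: (@le_trans _ _ (expR (lam * r) * (q x + (1 - q x) * expR X))).
    have /andP[q0 q1] := q01 x1.
    rewrite mulrDr (mulrC (q x)) lerD2l mulrCA; apply: ler_wpM2l; last exact: eX.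
    by rewrite subr_ge0.
  rewrite ler_pM2l ?expR_gt0// mulNr; apply: dr.
  - by case/andP: eta0 => _ /ltW.
  - by rewrite ga0.
  - by rewrite ka0.
  - by rewrite nu0.
have b1 : bmS (fun x => ind (B (dotv w x)) * dotv w x * y x).
  by apply: bmM; [apply: bmM => //|]; exact: bm_dotv.
have b4 : bmS (fun x => ind (B (dotv w x)) * `|y x|).
  by apply: bmM => //; apply: bm_abs; exact: bm_dotv.
have b5 : bmS (fun x => ind (B (dotv w x)) * expR (2 * D * `|y x|)).
  by apply: bmM => //; apply: bm_expR; apply: bmZ; apply: bm_abs; exact: bm_dotv.
have bA1 := bmZ (1 + 3 / 2 * (hr * b)) bB.
have bA2 := bmZ (lam * s / r) b1.
have bA3 := bmZ (- (ga * hr * s / 2)) b4.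
have bA4 := bmZ K b5.
have b12 := bmD bA1 bA2. have b123 := bmD b12 bA3. have b1234 := bmD b123 bA4.
have := leE bm1 (bmZ (expR (lam * r)) b1234) pw.
rewrite (EZ _ b1234) (ED b123 bA4) (ED b12 bA3) (ED bA1 bA2) (EZ _ bB) (EZ _ b1) (EZ _ b4) (EZ _ b5).
rewrite -/(band_prob mu w b); set p := band_prob mu w b in p0 *.
have -> : E (fun x => ind (B (dotv w x)) * dotv w x * y x) = 0.
  apply: (@Ex_odd _ _ _ mu_rot w e (fun z => ind (B z) * z) we).
  by apply: bmM => //; exact: bm_dotv.
have hB2 z : B z -> z ^+ 2 <= 2^-1.
  move=> /andP[z1 z2]; have z0 : 0 <= z by apply: le_trans z1; rewrite divr_ge0// ltW.
  by apply: le_trans b2; rewrite ler_sqr ?nnegrE// ltW.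
have h4 := Ex_abs_ge mu_rot mB d2 we hB2.
have h5 := Ex_expR_abs_le mu_rot mB d2 we.
rewrite -/(band_prob mu w b) -/p in h4 h5.
have {}h4 : p / (512 * D) <= E (fun x => ind (B (dotv w x)) * `|y x|).
  have c512 : 0 < 512 :> R by rewrite ltr0n.
  apply: le_trans h4; apply: ler_wpM2l => //; rewrite lef_pV2 ?posrE; last 2 first.
  - exact: mulr_gt0.
  - by apply: mulr_gt0; [exact: c512|rewrite sqrtr_gt0 ltr0n -ltnS prednK].
  by rewrite (ler_pM2l c512) ler_sqrt ?ler0n// ler_nat leq_pred.
set E4 := E _ in h4 *; set E5 := E _ in h5 *.
move=> main; apply: (le_trans main).
have eLR := expR_gt0 (lam * r).
have eA : 0 <= expR (2 * lam * a) * p by rewrite mulr_ge0 ?expR_ge0.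
have fin (c1 c2 c3 c4 : R) : (c1 * c2 + c3) * c4 = c2 * (c4 * c1) + c3 * c4 by ring.
rewrite fin; apply: (@le_trans _ _ (expR (lam * r) * (p * (1 - ka * ga ^+ 2 / (4 * 1024))))); last by rewrite lerDl.
rewrite ler_pM2l//.
have g01 : 0 < ga <= 1 by rewrite ga0.
have := @drift_total_le R p E4 E5 (lam * s / r) (hr * b) D r s ka ga nu p0 g01 ka0 D0 r0 s2 hbr nuC kaC h4 h5.
exact.
Qed.

End OneStep.

(** * Resampling one coordinate of an independent family *)

Section Resampling.
Context {I : eqType} {dE : measure_display} {E : measurableType dE}.
Context {dT : measure_display} {T : measurableType dT} {R : realType}.
Variables (P : probability T R) (W : T -> fspace I E).
Hypothesis mW : forall i, measurable_fun setT (fun t => W t i).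
Hypothesis indepW : forall (s : seq I) (B : I -> set E), uniq s ->
  (forall i, measurable (B i)) ->
  fine (P [set t | forall i, i \in s -> B i (W t i)]) =
  \prod_(i <- s) fine (P [set t | B i (W t i)]).
Local Notation G := (fspace I E).

Definition cylinders : set (set G) :=
  [set A | exists (s : seq I) (B : I -> set E), (forall i, measurable (B i)) /\
    A = [set g | forall i, i \in s -> B i (g i)]].

Lemma setI_cylinders : setI_closed cylinders.
Proof.
move=> _ _ [s1 [B1 [mB1 ->]]] [s2 [B2 [mB2 ->]]].
exists (s1 ++ s2), (fun i => (if i \in s1 then B1 i else setT) `&`
  (if i \in s2 then B2 i else setT)); split.
  by move=> i; apply: measurableI; case: ifP.
apply/seteqP; split=> [g /= [h1 h2] i|g /= h]; last first.
  split=> i i_s; have := h i; rewrite mem_cat i_s ?orbT => /(_ isT) [].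
    by [].
  by [].
move=> _; split; case: ifP => // i_s; [exact: h1|exact: h2].
Qed.

Lemma measurable_cylinder (s : seq I) (B : I -> set E) : (forall i, measurable (B i)) ->
  measurable ([set g | forall i, i \in s -> B i (g i)] : set G).
Proof.
move=> mB; elim: s => [|j s IH].
  by rewrite (_ : [set g | _] = setT)//; apply/seteqP; split.
rewrite (_ : [set g | _] = ((fun g : G => g j) @^-1` B j) `&`
  [set g | forall i, i \in s -> B i (g i)]).
  apply: measurableI => //; rewrite -[X in measurable X]setTI.
  exact: (measurable_coord j).
apply/seteqP; split=> [g /= h|g /= [h1 h2] i].
  by split=> [|i i_s]; apply: h; rewrite inE ?eqxx ?i_s ?orbT.
by rewrite inE => /orP[/eqP->//|]; exact: h2.
Qed.

Lemma measurable_cylindersE : (measurable : set (set G)) = <<s cylinders >>.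
Proof.
apply/seteqP; split; apply: smallest_sub.
- exact: smallest_sigma_algebra.
- move=> _ [i [B [mB ->]]]; apply: sub_sigma_algebra.
  exists [:: i], (fun=> B); split=> //.
  apply/seteqP; split=> [g /= Bg j|g /=]; first by rewrite inE => /eqP->.
  by apply; rewrite inE.
- exact: smallest_sigma_algebra.
- move=> _ [s [B [mB ->]]]; exact: measurable_cylinder.
Qed.

Let mWf : measurable_fun setT W.
Proof. exact: measurable_fspace. Qed.

Definition splice (i : I) (p : T * T) : G := updf (W p.1) i (W p.2 i).

Lemma measurable_splice i : measurable_fun setT (splice i).
Proof.
apply: measurable_fspace => k; rewrite /splice /updf; case: eqVneq => _.
  exact: (measurableT_comp (mW i) measurable_snd).
exact: (measurableT_comp (mW k) measurable_fst).
Qed.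

Let meas_event j (B : set E) : measurable B -> measurable [set t | B (W t j)].
Proof.
move=> mB; rewrite -[X in measurable X]setTI; exact: (mW j).
Qed.

Let meas_events (s : seq I) (B : I -> set E) : (forall i, measurable (B i)) ->
  measurable [set t | forall i, i \in s -> B i (W t i)].
Proof.
move=> mB; have := measurable_cylinder s mB => mC.
have := mWf measurableT mC; rewrite setTI; exact.
Qed.

Lemma splice_cylinder i (s : seq I) (B : I -> set E) : uniq s ->
  (forall i, measurable (B i)) ->
  (P \x P)%E (splice i @^-1` [set g | forall j, j \in s -> B j (g j)]) =
  P (W @^-1` [set g | forall j, j \in s -> B j (g j)]).
Proof.
move=> us mB; pose s' := [seq j <- s | j != i].
pose A2 := [set t | i \in s -> B i (W t i)].
have -> : splice i @^-1` [set g | forall j, j \in s -> B j (g j)] =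
    [set t | forall j, j \in s' -> B j (W t j)] `*` A2.
  apply/seteqP; split=> [[t t'] /= h|[t t'] /= [h1 h2] j js].
    split=> [j|is_].
      rewrite mem_filter => /andP[ji js]; have := h j js.
      by rewrite /splice /= updf_other.
    by have := h i is_; rewrite /splice /= updf_same.
  rewrite /splice /=; have [ji|ji] := eqVneq j i.
    by move: js; rewrite ji updf_same => /h2.
  by rewrite updf_other//; apply: h1; rewrite mem_filter ji.
have mA2 : measurable A2.
  rewrite /A2; case: (boolP (i \in s)) => is_.
    rewrite (_ : [set t | _] = [set t | B i (W t i)]); first exact: meas_event.
    by apply/seteqP; split=> t /=; [apply|move=> + _].
  by rewrite (_ : [set t | _] = setT)//; apply/seteqP; split.
rewrite product_measure1E//; last exact: meas_events.
have fk (A : set T) : measurable A -> P A = (fine (P A))%:E.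
  by move=> mA; rewrite fineK// fin_num_measure.
rewrite -[P (W @^-1` _)]/(P [set t | forall j, j \in s -> B j (W t j)]).
suff H : (P [set t | forall j, j \in s' -> B j (W t j)] * P A2)%E =
    P [set t | forall j, j \in s -> B j (W t j)] by exact: H.
rewrite (fk _ (meas_events s' mB)) (fk _ mA2) (fk _ (meas_events s mB)).
rewrite (indepW _ mB) ?filter_uniq// (indepW us mB) -EFinM; congr EFin.
case: (boolP (i \in s)) => is_.
  rewrite [RHS](bigD1_seq i)//= big_filter mulrC; congr (_ * _).
  congr (fine (P _)); apply/seteqP; split=> t /=; first exact.
  by move=> + _.
have -> : A2 = setT.
  by apply/seteqP; split=> // t _ /= is'; rewrite is' in is_.
rewrite probability_setT /= mulr1 big_filter big_seq_cond [RHS]big_seq_cond.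
apply: eq_bigl => j; case: (boolP (j \in s)) => //= js.
by apply: contraNneq is_ => <-.
Qed.

(** The family and its version with coordinate [i] taken from an independent copy have the same law,
    because both laws factor alike on the pi-system of cylinders. The inner integral stands for the
    conditional expectation given the other coordinates. *)
Lemma resample i (f : G -> \bar R) : measurable_fun setT f -> (forall g, 0 <= f g)%E ->
  (\int[P]_t f (W t) = \int[P]_t \int[P]_t' f (updf (W t) i (W t' i)))%E.
Proof.
move=> mf f0.
pose m1 := measure_function_pushforward__canonical__measure_function_Measure P mWf.
pose m2 := measure_function_pushforward__canonical__measure_function_Measure
  (P \x P)%E (measurable_splice i).
have m12 A : measurable A -> m1 A = m2 A.
  apply: (measure_unique cylinders (fun=> setT)).
  - exact: measurable_cylindersE.
  - exact: setI_cylinders.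
  - by move=> n; exists [::], (fun=> setT); split => //; apply/seteqP; split.
  - by apply/seteqP; split => // x _; exists 0%N.
  - move=> _ [s [B [mB ->]]]; rewrite /m1 /m2 /= /pushforward.
    rewrite (_ : [set g : G | forall i, i \in s -> B i (g i)] =
      [set g | forall i, i \in undup s -> B i (g i)]); last first.
      by apply/seteqP; split=> g /= h j; have := h j; rewrite mem_undup.
    by rewrite splice_cylinder// undup_uniq.
  - move=> _; rewrite /m1 /= /pushforward preimage_setT.
    by apply: (le_lt_trans (probability_le1 P measurableT)); rewrite ltry.
have h1 := @ge0_integral_pushforward _ _ _ _ _ W mWf P setT f measurableT mf.
have h2 := @ge0_integral_pushforward _ _ _ _ _ _ (measurable_splice i) (P \x P)%E setT f measurableT mf.
rewrite preimage_setT in h1; rewrite preimage_setT in h2.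
have e1 : (\int[m1]_y f y = \int[P]_t f (W t))%E by apply: h1 => y _; exact: f0.
have e2 : (\int[m2]_y f y = \int[(P \x P)%E]_p f (splice i p))%E by apply: h2 => y _; exact: f0.
rewrite -e1 (_ : \int[m1]_y f y = \int[m2]_y f y)%E; last first.
  by apply: eq_measure_integral => A mA _; exact: m12.
rewrite e2 (@fubini_tonelli1 _ _ _ _ _ P P (fun p => f (splice i p)))//.
exact: measurableT_comp mf (measurable_splice i).
Qed.

Lemma measurable_resample_inner i (f : G -> \bar R) : measurable_fun setT f ->
  (forall g, 0 <= f g)%E ->
  measurable_fun setT (fun g : G => \int[P]_t' f (updf g i (W t' i)))%E.
Proof.
move=> mf f0.
have m : measurable_fun setT (fun p : G * T => f (updf p.1 i (W p.2 i))).
  apply: (measurableT_comp mf); apply: measurable_fspace => k; rewrite /updf.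
  case: eqVneq => _; first exact: (measurableT_comp (mW i) measurable_snd).
  exact: (measurableT_comp (measurable_coord k) measurable_fst).
exact: (@measurable_fun_fubini_tonelli_F _ _ _ _ _ P _ m (fun p => f0 _)).
Qed.

End Resampling.

(** Padding with constants gives both streams one value space, so that a single product space
    carries them. *)
Definition coords {R : realType} {d : nat} {T : Type} (Z : nat -> T -> 'rV[R]_d)
    (U : nat -> T -> R) (t : T) : fspace (nat + nat)%type (vec R d * R)%type := fun i =>
  match i with inl n => (Z n t : vec R d, 0) | inr n => (0 : vec R d, U n t) end.

Lemma measurable_coord_fst {I : eqType} dA (A : measurableType dA) dB (B : measurableType dB)
    (i : I) : measurable_fun setT (fun g : fspace I (A * B)%type => (g i).1).
Proof. exact: measurableT_comp measurable_fst (measurable_coord i). Qed.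

Lemma measurable_coord_snd {I : eqType} dA (A : measurableType dA) dB (B : measurableType dB)
    (i : I) : measurable_fun setT (fun g : fspace I (A * B)%type => (g i).2).
Proof. exact: measurableT_comp measurable_snd (measurable_coord i). Qed.

(** * The algorithm as a process indexed by draws *)

Section Process.
Context {R : realType} {d : nat}.
Local Notation V := (vec R d).
Local Notation S := (@sphere R d).
Local Notation I := (nat + nat)%type.
Local Notation E := (V * R)%type.
Local Notation G := (fspace I E).
Variables (q : 'rV[R]_d -> R) (bs : nat -> R) (M : nat) (v0 : 'rV[R]_d).

(* A draw off the sphere (probability zero) is discarded, so that [run] always stays on the
   sphere; after [M] label queries the process is frozen. *)
Definition active (w : 'rV[R]_d) (l : nat) (x : 'rV[R]_d) : bool :=
  [&& (l < M)%N, dotv x x == 1 & bs l / 2 <= dotv w x <= bs l].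

Definition next_vec (w : 'rV[R]_d) (l : nat) (x : 'rV[R]_d) (uu : R) : 'rV[R]_d :=
  if active w l x then perceptron_update w x (oracle_label q uu x) else w.

Definition next_count (w : 'rV[R]_d) (l : nat) (x : 'rV[R]_d) : nat :=
  if active w l x then l.+1 else l.

(** Time counts draws rather than labels, so no waiting time appears: a draw outside the band leaves
    the state unchanged. The uniform variable read is indexed by the current label count. *)
Fixpoint run (g : I -> E) (n : nat) : 'rV[R]_d * nat :=
  match n with
  | 0 => (v0, 0%N)
  | n'.+1 => let s := run g n' in
      (next_vec s.1 s.2 (g (inl n')).1 (g (inr s.2)).2, next_count s.1 s.2 (g (inl n')).1)
  end.

Lemma run_count_le g n : ((run g n).2 <= n)%N.
Proof.
elim: n => //= n IH; rewrite /next_count; case: ifP => _ //.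
exact: leqW.
Qed.

Lemma run_count_leM g n : ((run g n).2 <= M)%N.
Proof.
by elim: n => //= n IH; rewrite /next_count; case: ifP => // /and3P[].
Qed.

Lemma run_updf_inl g n m e : (n <= m)%N -> run (updf g (inl m) e) n = run g n.
Proof.
elim: n => //= n IH nm; rewrite IH; last exact: ltnW.
by rewrite updf_other// (inj_eq (@inl_inj _ _)) ltn_eqF.
Qed.

(** Only uniform variables with index below the label count have been read, so the next one is
    fresh. *)
Lemma run_updf_inr g n l e : ((run g n).2 <= l)%N -> run (updf g (inr l) e) n = run g n.
Proof.
elim: n => //= n IH h.
have hl : ((run g n).2 <= l)%N by apply: leq_trans h; rewrite /next_count; case: ifP.
rewrite IH// [updf g _ _ (inl n)]updf_other//; case: (ltnP (run g n).2 l) => [ll|lg].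
  by rewrite updf_other// (inj_eq (@inr_inj _ _)) ltn_eqF.
have e1 : active (run g n).1 (run g n).2 (g (inl n)).1 = false.
  by move: h; rewrite /next_count; case: ifP => // _; rewrite ltnNge lg.
by rewrite /next_vec e1.
Qed.

Lemma reflect_update (w x : 'rV[R]_d) : perceptron_update w x (-1) =
  if 0 < dotv w x then reflect x w else w.
Proof.
rewrite /perceptron_update mulN1r oppr_lt0; case: ifP => _.
  by rewrite mulr1 /reflect (dotvC x w).
by rewrite mulr0 mul0r scale0r subr0.
Qed.

Hypotheses (v01 : sphere v0) (bs0 : forall l, 0 < bs l).

Lemma update_pos (w x : 'rV[R]_d) : 0 < dotv w x -> perceptron_update w x 1 = w.
Proof.
by move=> h; rewrite /perceptron_update mul1r ltNge ltW//= mulr0 mul0r scale0r subr0.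
Qed.

Lemma active_pos w l x : active w l x -> 0 < dotv w x.
Proof.
by move=> /and3P[_ _ /andP[h _]]; apply: lt_le_trans h; rewrite divr_gt0.
Qed.

Lemma next_vecE w l x uu : next_vec w l x uu =
  if active w l x then (if uu < q x then w else reflect x w) else w.
Proof.
rewrite /next_vec; case: ifP => // /active_pos h; rewrite /oracle_label.
by case: ifP => _; [exact: update_pos|rewrite reflect_update h].
Qed.

Lemma next_vec_sphere w l x uu : sphere w -> sphere (next_vec w l x uu).
Proof.
move=> w1; rewrite next_vecE; case: ifP => // /and3P[_ /eqP x1 _].
by case: ifP => // _; exact: reflect_sphere.
Qed.

Lemma run_sphere g n : sphere (run g n).1.
Proof. by elim: n => //= n IH; exact: next_vec_sphere. Qed.

Hypothesis mq : measurable_fun setT (q : V -> R).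

Lemma measurable_active dX (X : measurableType dX) (w x : X -> V) l :
  measurable_fun setT w -> measurable_fun setT x ->
  measurable_fun setT (fun t => active (w t) l (x t)).
Proof.
move=> mw mx; have md := measurable_dotv mw mx.
apply: measurable_and => //; apply: measurable_and.
  by apply: measurable_fun_eqr => //; exact: measurable_dotv.
by apply: measurable_and; apply: measurable_fun_ler.
Qed.

Lemma measurable_next_vec dX (X : measurableType dX) (w x : X -> V) (uu : X -> R) l :
  measurable_fun setT w -> measurable_fun setT x -> measurable_fun setT uu ->
  measurable_fun setT (fun t => next_vec (w t) l (x t) (uu t) : V).
Proof.
move=> mw mx mu.
rewrite (_ : (fun t => _) = (fun t => if active (w t) l (x t) then
    (if uu t < q (x t) then w t else reflect (x t) (w t)) else w t)); last first.
  by apply/funext => t; rewrite next_vecE.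
apply: measurable_fun_ifT => //; first exact: measurable_active.
apply: measurable_fun_ifT => //.
  by apply: measurable_fun_ltr => //; exact: measurableT_comp mq mx.
apply: measurable_vecD => //; apply: measurable_vecN; apply: measurable_vecZ => //.
by apply: measurable_funM => //; exact: measurable_dotv.
Qed.

(** Cuts the space into the countably many level sets of the random index [N]. *)
Lemma measurable_select dX (X : measurableType dX) dY (Y : measurableType dY)
    (N : X -> nat) (f : nat -> X -> Y) :
  (forall l, measurable_fun setT (fun t => N t == l)) ->
  (forall l, measurable_fun setT (f l)) -> measurable_fun setT (fun t => f (N t) t).
Proof.
move=> mN mf _ B mB; rewrite setTI.
rewrite (_ : _ @^-1` _ = \bigcup_l ([set t | N t == l] `&` f l @^-1` B)); last first.
  apply/seteqP; split=> [t /= h|t [l _ [/= /eqP<-]]//].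
  by exists (N t) => //; split => /=.
apply: bigcup_measurable => l _; apply: measurableI.
  rewrite (_ : [set t | N t == l] = setT `&` (fun t => N t == l) @^-1` [set true]); last first.
    by rewrite setTI; apply/seteqP; split.
  exact: mN.
by rewrite -[X in measurable X]setTI; exact: mf.
Qed.

Lemma measurable_run n :
  measurable_fun setT (fun g : G => (run g n).1 : V) /\
  forall l, measurable_fun setT (fun g : G => (run g n).2 == l).
Proof.
have m1 n' : measurable_fun setT (fun g : G => (g (inl n')).1 : V).
  exact: (@measurable_coord_fst I _ V _ R (inl n')).
have m2 n' : measurable_fun setT (fun g : G => (g (inr n')).2).
  exact: (@measurable_coord_snd I _ V _ R (inr n')).
elim: n => [|n [IH1 IH2]]; first by split => [|l]; exact: measurable_cst.
split=> [|l'].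
  apply: (@measurable_select _ G _ V (fun g => (run g n).2)
    (fun l g => next_vec (run g n).1 l (g (inl n)).1 (g (inr l)).2)) => // l.
  exact: measurable_next_vec.
apply: (@measurable_select _ G _ bool (fun g => (run g n).2)
  (fun l g => next_count (run g n).1 l (g (inl n)).1 == l')) => // l.
rewrite (_ : (fun g : G => _) = (fun g : G => if active (run g n).1 l (g (inl n)).1
    then l.+1 == l' else l == l')); last first.
  by apply/funext => g; rewrite /next_count; case: ifP.
by apply: measurable_fun_ifT => //; exact: measurable_active.
Qed.

End Process.

(** * The supermartingale inequality *)

Section Supermartingale.
Context {R : realType} {d : nat} {dT : measure_display} {T : measurableType dT}.
Variables (P : probability T R) (Z : nat -> T -> 'rV[R]_d) (U : nat -> T -> R).
Local Notation V := (vec R d).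
Local Notation S := (@sphere R d).
Local Notation I := (nat + nat)%type.
Local Notation E := (V * R)%type.
Local Notation G := (fspace I E).
Variables (mu : probability V R).
Hypothesis mu1 : mu (S : set V) = 1%E.
Hypothesis lawZ : forall n (B : set V), measurable B ->
  measurable (Z n @^-1` B) /\ P (Z n @^-1` B) = mu B.
Hypothesis lawU : forall n, uniform01_rv P (U n).
Hypothesis indep : mutually_independent P (stream_sigma Z U).

Let mZ n : measurable_fun setT (Z n : T -> V).
Proof. by move=> _ B mB; rewrite setTI; exact: (lawZ n mB).1. Qed.

Let mU n : measurable_fun setT (U n).
Proof. by move=> _ B mB; rewrite setTI; exact: (lawU n mB).1. Qed.

Local Notation W := (coords Z U).

Lemma measurable_coords i : measurable_fun setT (fun t => W t i : E).
Proof. by case: i => n; apply: measurable_fun_pair. Qed.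

Lemma bigsetI_seq (s : seq I) (A : I -> set T) :
  \big[setI/setT]_(i <- s) A i = [set t | forall i, i \in s -> A i t].
Proof.
elim: s => [|j s IH].
  by rewrite big_nil; apply/seteqP; split.
rewrite big_cons IH; apply/seteqP; split=> [t [/= h1 h2] i|t /= h].
  by rewrite inE => /orP[/eqP->//|]; exact: h2.
by split=> [|i i_s]; apply: h; rewrite inE ?eqxx ?i_s ?orbT.
Qed.

Lemma indep_coords (s : seq I) (B : I -> set E) : uniq s ->
  (forall i, measurable (B i)) ->
  fine (P [set t | forall i, i \in s -> B i (W t i)]) =
  \prod_(i <- s) fine (P [set t | B i (W t i)]).
Proof.
move=> us mB; rewrite -(bigsetI_seq s (fun i => [set t | B i (W t i)])).
apply: indep => // -[n|n] _ /=.
  exists [set x | B (inl n) (x, 0)] => //.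
  rewrite -[X in borel_d X]setTI.
  by apply: (@measurable_fun_pair _ _ _ V V R id (cst 0)) (mB (inl n)).
exists [set y | B (inr n) (0, y)] => //.
rewrite -[X in measurable X]setTI.
by apply: (@measurable_fun_pair _ _ _ R V R (cst (0 : V)) id) (mB (inr n)).
Qed.

Variables (q : 'rV[R]_d -> R) (bs : nat -> R) (M : nat) (v0 : 'rV[R]_d).
Hypotheses (v01 : sphere v0) (bs0 : forall l, 0 < bs l).
Hypothesis mq : measurable_fun setT (q : V -> R).
Hypothesis q01 : forall x, sphere x -> 0 <= q x <= 1.
Local Notation rn := (run q bs M v0).

Variables (F : nat -> V -> R) (K : R).
Hypothesis mF : forall l, measurable_fun setT (F l).
Hypothesis F0 : forall l w, 0 <= F l w.
Hypothesis FK : forall l w, F l w <= K.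

Lemma prob_lt_unif n c : 0 <= c <= 1 -> P [set t | U n t < c] = c%:E.
Proof.
move=> /andP[c0 c1].
have := (lawU n (measurable_itv `]-oo, c[)).2.
rewrite (_ : U n @^-1` _ = [set t | U n t < c]); last first.
  by apply/seteqP; split => t /=; rewrite in_itv.
move=> ->; rewrite (_ : _ `&` _ = `[0, c[%classic); last first.
  apply/seteqP; split=> x /=; rewrite !in_itv/=; first by move=> [h /andP[-> _]].
  by move=> /andP[h1 h2]; rewrite h1 h2 (ltW (lt_le_trans h2 c1)).
rewrite lebesgue_measure_itv/= lte_fin; case: ltP => h; first by rewrite sube0.
by congr (_%:E); apply/eqP; rewrite eq_le c0 h.
Qed.

Lemma integral_label n c a b : 0 <= c <= 1 -> 0 <= a -> 0 <= b ->
  (\int[P]_t (if U n t < c then a else b)%:E = (c * a + (1 - c) * b)%:E)%E.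
Proof.
move=> c01 a0 b0; have mb : measurable_fun setT (fun t => U n t < c).
  by apply: measurable_fun_ltr.
have PT : P setT = 1%E by exact: probability_setT.
have bi : bm setT (fun t => ind (U n t < c) : R) by exact: bm_bool.
have e : Ex P setT (fun t => ind (U n t < c)) = c.
  by have := Ex_bool measurableT PT mb; rewrite prob_lt_unif// => -[].
have bf : bm setT (fun t => (a - b) * (ind (U n t < c) : R) + b).
  by apply: bmD; [exact: bmZ|exact: bm_cst].
have h : (\int[P]_t (if U n t < c then a else b)%:E =
    \int[P]_t ((a - b) * (ind (U n t < c) : R) + b)%:E)%E.
  by apply: eq_integral => t _; case: ifP => _; rewrite ?mulr1 ?mulr0 ?subrK ?add0r.
have bz := bmZ (a - b) bi.
have ED : Ex P setT (fun t => (a - b) * (ind (U n t < c) : R) + b) =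
  Ex P setT (fun t => (a - b) * (ind (U n t < c) : R)) + Ex P setT (fun=> b).
    by exact: (ExD P measurableT bz (bm_cst setT b)).
rewrite h -[LHS]fineK; last by apply: integrable_fin_num => //; exact: (bm_integrable P measurableT bf).
congr EFin; rewrite -[LHS]/(Ex P setT (fun t => (a - b) * (ind (U n t < c) : R) + b)) ED.
by rewrite (ExZ P measurableT (a - b) bi) e Ex_cst//; ring.
Qed.

Lemma integral_draw n (phi : V -> R) : measurable_fun setT phi ->
  (forall x, 0 <= phi x) -> (forall x, phi x <= K) ->
  (\int[P]_t (phi (Z n t))%:E = (Ex mu S phi)%:E)%E.
Proof.
move=> mphi phi0 phiK.
have mphiE : measurable_fun setT (EFin \o phi) by exact/measurable_EFinP.
have := @ge0_integral_pushforward _ _ _ _ _ (Z n : T -> V) (mZ n) P setT (EFin \o phi) measurableT mphiE.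
rewrite preimage_setT => <-; last by move=> x _; rewrite lee_fin phi0.
have mS := @measurable_sphere R d.
have -> : (\int[pushforward P (Z n : T -> V)]_x (EFin \o phi) x = \int[mu]_x (phi x)%:E)%E.
  by apply: eq_measure_integral => A mA _; exact: (lawZ n mA).2.
have mSC : mu (~` S : set V) = 0%E by rewrite probability_setC// mu1 subee.
rewrite (ge0_negligible_integral (N := ~` S : set V))//; last 2 first.
- exact: measurableC.
- by move=> x _; rewrite lee_fin.
rewrite setDE setCK setTI -[LHS]fineK//.
apply: integrable_fin_num => //; apply: (bm_integrable mu mS); split => //.
by exists K => x _; rewrite ger0_norm.
Qed.

(** The conditional mean of the potential after one draw, given the state (w, l). *)
Definition mean_next (l : nat) (w : 'rV[R]_d) : R := Ex mu S (fun x =>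
  if active bs M w l x then q x * F l.+1 w + (1 - q x) * F l.+1 (reflect x w) else F l w).

Lemma mean_nextE n l (w : 'rV[R]_d) :
  (\int[P]_t' \int[P]_t'' (F (next_count bs M w l (Z n t'))
     (next_vec q bs M w l (Z n t') (U l t'')))%:E = (mean_next l w)%:E)%E.
Proof.
pose phi (x : V) := if active bs M w l x then
  q x * F l.+1 w + (1 - q x) * F l.+1 (reflect x w) else F l w.
have phiE t' : (\int[P]_t'' (F (next_count bs M w l (Z n t'))
     (next_vec q bs M w l (Z n t') (U l t'')))%:E = (phi (Z n t'))%:E)%E.
  rewrite /phi /next_count; case: ifP => ac; last first.
    under eq_integral do rewrite next_vecE// ac.
    by rewrite integral_cst//= -[X in (_ * X)%E]/(P setT) probability_setT mule1.
  have x1 : sphere (Z n t') by case/and3P: ac => _ /eqP.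
  under eq_integral do rewrite next_vecE// ac.
  rewrite -(integral_label l (q01 x1) (F0 _ _) (F0 _ _)).
  by apply: eq_integral => t'' _; case: ifP.
under eq_integral do rewrite phiE.
have q01' x : active bs M w l x -> 0 <= q x <= 1 by case/and3P => _ /eqP x1 _; exact: q01.
rewrite integral_draw//.
- apply: measurable_fun_ifT => //; first exact: measurable_active.
  have mr : measurable_fun setT (fun x : V => reflect x w : V).
    apply: measurable_vecD => //; apply: measurable_vecN; apply: measurable_vecZ => //.
    by apply: measurable_funM => //; exact: measurable_dotv.
  apply: measurable_funD; first exact: measurable_funM.
  apply: measurable_funM; first exact: measurable_funB.
  exact: measurableT_comp (mF _) mr.
- move=> x; rewrite /phi; case: ifP => // /q01' /andP[h0 h1].
  by rewrite addr_ge0// mulr_ge0// subr_ge0.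
- move=> x; rewrite /phi; case: ifP => // /q01' /andP[h0 h1].
  have := FK l.+1 w; have := FK l.+1 (reflect x w); nra.
Qed.

Definition potential n (t : T) : R := F (rn (W t) n).2 (rn (W t) n).1.

Lemma supermartingale_step (gam : R) n : 0 <= gam ->
  (forall l w, sphere w -> mean_next l w <= gam * F l w) ->
  (\int[P]_t (potential n.+1 t)%:E <= gam%:E * \int[P]_t (potential n t)%:E)%E.
Proof.
move=> gam0 hmean.
have mW : forall i, measurable_fun setT (fun t => W t i : E) by exact: measurable_coords.
have mWf : measurable_fun setT (W : T -> G) by exact: measurable_fspace.
have [mr1 mr2] := measurable_run M v0 bs0 mq n.
(* The uniform variable to be read has a random index; splitting by its value [l] makes the two
   coordinates to resample, [inr l] and [inl n], deterministic. *)
pose h l (g : G) : \bar R := ((ind ((rn g n).2 == l) : R) *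
  F (next_count bs M (rn g n).1 l (g (inl n)).1)
    (next_vec q bs M (rn g n).1 l (g (inl n)).1 (g (inr l)).2))%:E.
have h0 l g : (0 <= h l g)%E by rewrite lee_fin mulr_ge0// ler0n.
have mh l : measurable_fun setT (h l).
  apply/measurable_EFinP; apply: measurable_funM.
    rewrite (_ : (fun g : G => _) = (fun g : G => if (rn g n).2 == l then 1 else 0)); last first.
      by apply/funext => g; case: eqP.
    by apply: measurable_fun_ifT.
  have mx : measurable_fun setT (fun g : G => (g (inl n)).1 : V).
    exact: (@measurable_coord_fst I _ V _ R (inl n)).
  have mu' : measurable_fun setT (fun g : G => (g (inr l)).2).
    exact: (@measurable_coord_snd I _ V _ R (inr l)).
  have mv : measurable_fun setT (fun g : G => next_vec q bs M (rn g n).1 l (g (inl n)).1 (g (inr l)).2 : V).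
    exact: measurable_next_vec.
  rewrite (_ : (fun g : G => _) = (fun g : G => if active bs M (rn g n).1 l (g (inl n)).1
    then F l.+1 (next_vec q bs M (rn g n).1 l (g (inl n)).1 (g (inr l)).2)
    else F l (next_vec q bs M (rn g n).1 l (g (inl n)).1 (g (inr l)).2))); last first.
    by apply/funext => g; rewrite /next_count; case: ifP.
  apply: measurable_fun_ifT; first exact: measurable_active.
    exact: measurableT_comp (mF _) mv.
  exact: measurableT_comp (mF _) mv.
have potE t : (potential n.+1 t)%:E = (\sum_(l < n.+1) h l (W t))%E.
  pose l0 : 'I_n.+1 := Ordinal (run_count_le q bs M v0 (W t) n : ((rn (W t) n).2 < n.+1)%N).
  rewrite (bigD1 l0)//= big1 ?adde0 /h /= ?eqxx ?mul1r// => l ll0.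
  rewrite (_ : ((rn (W t) n).2 == l) = false) ?mul0r//.
  by apply: contraNF ll0 => /eqP e; apply/eqP/val_inj.
under eq_integral do rewrite potE.
rewrite ge0_integral_sum//; last by move=> l; exact: measurableT_comp (mh l) mWf.
have mterm l : measurable_fun setT (fun t => (gam * ((ind ((rn (W t) n).2 == l) : R) * F l (rn (W t) n).1))%:E).
  apply/measurable_EFinP; apply: measurable_funM => //; apply: measurable_funM.
    rewrite (_ : (fun t => _) = (fun t => if (rn (W t) n).2 == l then 1 else 0)); last first.
      by apply/funext => t; case: eqP.
    by apply: measurable_fun_ifT => //; exact: measurableT_comp (mr2 l) mWf.
  by apply: measurableT_comp (mF l) _; exact: measurableT_comp mr1 mWf.
have hl l : (\int[P]_t h l (W t) <= \int[P]_t (gam * ((ind ((rn (W t) n).2 == l) : R) * F l (rn (W t) n).1))%:E)%E.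
  rewrite (resample mW indep_coords (inr l) (mh l) (h0 l)).
  have mi := measurable_resample_inner P mW (inr l) (mh l) (h0 l).
  rewrite (resample mW indep_coords (inl n) mi); last by move=> g; exact: integral_ge0.
  apply: ge0_le_integral => //.
  - by move=> t _; apply: integral_ge0 => t' _; apply: integral_ge0.
  - have mi2 := measurable_resample_inner P mW (inl n) mi (fun g => integral_ge0 P (fun t' _ => h0 _ _)).
    exact: measurableT_comp mi2 mWf.
  move=> t _.
  have hE t' t'' : h l (updf (updf (W t) (inl n) (W t' (inl n))) (inr l) (W t'' (inr l))) =
      ((ind ((rn (W t) n).2 == l) : R)%:E *
       (F (next_count bs M (rn (W t) n).1 l (Z n t'))
         (next_vec q bs M (rn (W t) n).1 l (Z n t') (U l t'')))%:E)%E.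
    rewrite /h -EFinM; set g1 := updf (W t) _ _; set g2 := updf g1 _ _.
    have r1 : rn g1 n = rn (W t) n by rewrite /g1 run_updf_inl.
    have c1 : g2 (inl n) = W t' (inl n) by rewrite /g2 updf_other// /g1 updf_same.
    have c2 : g2 (inr l) = W t'' (inr l) by rewrite /g2 updf_same.
    rewrite c1 c2 /=; case: (eqVneq (rn (W t) n).2 l) => [el|nl].
      have -> : rn g2 n = rn (W t) n by rewrite /g2 run_updf_inr r1// el.
      by rewrite el eqxx.
    rewrite (_ : ((rn g2 n).2 == l) = false) ?mul0r//.
    (* If the modified stream has count [l], undoing the change at [inr l] preserves the run, so the
       original count is [l] as well. *)
    apply/negP => /eqP el; move: nl; rewrite -r1 -el => /eqP; apply.
    have -> : g1 = updf g2 (inr l) (g1 (inr l)) by rewrite /g2 updf_updf updf_id.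
    by rewrite run_updf_inr// el.
  under eq_integral => t' _ do under eq_integral => t'' _ do rewrite hE.
  case: (eqVneq (rn (W t) n).2 l) => el; last first.
    under eq_integral => t' _ do under eq_integral => t'' _ do rewrite mul0e.
    under eq_integral => t' _ do rewrite integral0.
    by rewrite integral0 mul0r mulr0.
  under eq_integral => t' _ do under eq_integral => t'' _ do rewrite mul1e.
  by rewrite mean_nextE lee_fin mul1r; apply: hmean; exact: run_sphere.
apply: (@le_trans _ _ (\sum_(l < n.+1) \int[P]_t (gam * ((ind ((rn (W t) n).2 == l) : R) * F l (rn (W t) n).1))%:E)%E).
  by apply: lee_sum => l _; exact: hl.
rewrite -ge0_integral_sum//; last by move=> l t _; rewrite lee_fin !mulr_ge0// ler0n.
rewrite -ge0_integralZl_EFin//; last 2 first.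
- by move=> t _; rewrite lee_fin F0.
- apply/measurable_EFinP; apply: (@measurable_select _ T _ R (fun t => (rn (W t) n).2)
    (fun l t => F l (rn (W t) n).1)) => l.
    exact: measurableT_comp (mr2 l) mWf.
  by apply: measurableT_comp (mF l) _; exact: measurableT_comp mr1 mWf.
rewrite le_eqVlt; apply/orP; left; apply/eqP; apply: eq_integral => t _.
pose l0 : 'I_n.+1 := Ordinal (run_count_le q bs M v0 (W t) n : ((rn (W t) n).2 < n.+1)%N).
rewrite (bigD1 l0)//= big1 ?adde0 ?eqxx ?mul1r ?EFinM// => l ll0.
rewrite (_ : ((rn (W t) n).2 == l) = false) ?mul0r ?mulr0//.
by apply: contraNF ll0 => /eqP e; apply/eqP/val_inj.
Qed.

Lemma supermartingale (gam : R) n : 0 <= gam ->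
  (forall l w, sphere w -> mean_next l w <= gam * F l w) ->
  (\int[P]_t (potential n t)%:E <= (gam ^+ n * F 0 v0)%:E)%E.
Proof.
move=> gam0 hm; elim: n => [|n IH].
  by rewrite /potential /= integral_cst// -[X in (_ * X)%E]/(P setT) probability_setT mule1 expr0 mul1r.
apply: (le_trans (supermartingale_step n gam0 hm)).
rewrite exprS -mulrA EFinM; apply: lee_wpmul2l => //.
Qed.

End Supermartingale.

(** * Agreement of the process with the recursive algorithm *)

Section DeterministicLink.
Context {R : realType} {d : nat}.
Variables (q : 'rV[R]_d -> R) (bs : nat -> R) (M : nat) (v0 : 'rV[R]_d).
Variables (g : nat + nat -> (vec R d * R)%type) (N : nat).
Let Zs n : 'rV[R]_d := (g (inl n)).1.
Let Us l : R := (g (inr l)).2.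
Hypothesis Zsphere : forall n, (n < N)%N -> sphere (Zs n).
Local Notation rn := (run q bs M v0 g).

Lemma run_inactive j n : (j <= n)%N ->
  (forall i, (j <= i < n)%N -> ~~ active bs M (rn j).1 (rn j).2 (Zs i)) -> rn n = rn j.
Proof.
elim: n => [|n IH]; first by rewrite leqn0 => /eqP->.
rewrite leq_eqVlt => /orP[/eqP->//|]; rewrite ltnS => jn h.
have e : rn n = rn j.
  by apply: IH => // i /andP[ji i_n]; apply: h; rewrite ji ltnW.
have := h n; rewrite jn ltnSn => /(_ isT) /negbTE a.
by rewrite /= e /next_vec /next_count a; case: (rn j).
Qed.

Lemma run_frozen j n : (j <= n)%N -> (M <= (rn j).2)%N -> rn n = rn j.
Proof.
move=> jn h; apply: run_inactive => // i _; rewrite /active negb_and.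
by rewrite -leqNgt h.
Qed.

(** Between two labels the process stands still, so the next label comes at the first later draw in
    the band; a count above [l] at time [N] guarantees that this draw exists. *)
Lemma first_in_run j w l : rn j = (w, l) -> (l < M)%N -> (j <= N)%N -> (l < (rn N).2)%N ->
  exists i, [/\ first_in Zs (band w (bs l)) j = Some i, (i < N)%N &
    rn i.+1 = (perceptron_update w (Zs i) (oracle_label q (Us l) (Zs i)), l.+1)].
Proof.
move=> ej lM jN lN.
have bandP i : (i < N)%N -> band w (bs l) (Zs i) <-> active bs M w l (Zs i).
  move=> iN; rewrite /active lM /=; have /eqP -> := Zsphere iN.
  by split.
pose p i := [&& (j <= i)%N, (i < N)%N & active bs M w l (Zs i)].
have ex : exists i, p i.
  apply: contrapT => hn; have e : rn N = rn j.
    apply: run_inactive => // i /andP[ji iN]; apply/negP => a; apply: hn; exists i.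
    by rewrite /p ji iN /=; move: a; rewrite ej.
  by move: lN; rewrite e ej /= ltnn.
case: (ex_minnP ex) => i /and3P[ji iN a] imin; exists i; split => //.
  have hi : exists i, (j <= i)%N /\ band w (bs l) (Zs i).
    by exists i; split => //; apply/(bandP i iN).
  rewrite /first_in; case: asboolP => // _; congr Some.
  set A := (X in get X).
  have Ai : A i.
    split=> //; split; first exact/(bandP i iN).
    move=> i' /andP[ji' i'i] hb; have i'N := ltn_trans i'i iN.
    have := imin i'; rewrite /p ji' i'N /= => /(_ ((bandP i' i'N).1 hb)).
    by rewrite leqNgt i'i.
  (* [first_in] picks its index by choice; minimality makes the index unique. *)
  have [jg [hg ng]] : A (get A) by apply: getPex; exists i.
  case: (ltngtP (get A) i) => // h.
    by case: Ai => _ [_ /(_ (get A))]; rewrite jg h => /(_ isT).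
  by have := ng i; rewrite ji h => /(_ isT); case; exact/(bandP i iN).
have ei : rn i = (w, l).
  rewrite -ej; apply: run_inactive => // i' /andP[ji' i'i].
  rewrite ej; apply/negP => a'.
  by have := imin i'; rewrite /p ji' a' (ltn_trans i'i iN) => /(_ isT); rewrite leqNgt i'i.
by rewrite /= ei /next_vec /next_count a.
Qed.

Lemma modified_perceptron_run b m j w l : rn j = (w, l) -> (l + m <= M)%N -> (j <= N)%N ->
  (l + m <= (rn N).2)%N -> (forall l', (l <= l' < l + m)%N -> bs l' = b) ->
  exists w' j', [/\ modified_perceptron q Zs Us b m (w, j, l) = Some (w', j', (l + m)%N),
    (j' <= N)%N & rn j' = (w', (l + m)%N)].
Proof.
elim: m j w l => [|m IH] j w l ej lM jN lN hb.
  by exists w, j; rewrite addn0.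
have lm : (l < l + m.+1)%N by rewrite addnS ltnS leq_addr.
have [i [fi iN ei]] := first_in_run ej (leq_trans lm lM) jN (leq_trans lm lN).
rewrite addnS -addSn in lM lN hb *.
have bl : bs l = b by apply: hb; rewrite leqnn addSn ltnS leq_addr.
have [|w' [j' [e1 e2 e3]]] := IH _ _ _ ei lM iN lN.
  by move=> l' /andP[h1 h2]; apply: hb; rewrite ltnW.
by exists w', j'; split => //; rewrite /= -bl fi /= bl.
Qed.

Lemma ap_rounds_run (ms : nat -> nat) (b : nat -> R) (n : nat) :
  (\sum_(k < n) ms k.+1 <= M)%N -> (\sum_(k < n) ms k.+1 <= (rn N).2)%N ->
  (forall k l, (k < n)%N -> (\sum_(i < k) ms i.+1 <= l < \sum_(i < k.+1) ms i.+1)%N ->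
     bs l = b k.+1) ->
  exists w j, [/\ ap_rounds q Zs Us ms b v0 n = Some (w, j, \sum_(k < n) ms k.+1)%N,
    (j <= N)%N & rn j = (w, \sum_(k < n) ms k.+1)%N].
Proof.
elim: n => [|n IH] hM hN hb.
  by exists v0, 0%N; rewrite big_ord0.
have le1 : (\sum_(k < n) ms k.+1 <= \sum_(k < n.+1) ms k.+1)%N.
  by rewrite big_ord_recr leq_addr.
have [|w [j [e1 e2 e3]]] := IH (leq_trans le1 hM) (leq_trans le1 hN).
  by move=> k l kn; apply: hb; exact: ltnW.
move: hM hN; rewrite [X in (X <= _)%N]big_ord_recr [X in (X <= (rn _).2)%N]big_ord_recr /= => hM hN.
have [|w' [j' [f1 f2 f3]]] := modified_perceptron_run e3 hM e2 hN (b := b n.+1).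
  by move=> l' hl'; apply: hb => //; rewrite big_ord_recr.
exists w', j'; rewrite big_ord_recr /=; split => //.
by rewrite e1.
Qed.

End DeterministicLink.

(** * One-step means of a bounded potential *)

Section StepMean.
Variables (R : realType) (d : nat) (mu : probability (vec R d) R).
Local Notation V := (vec R d).
Local Notation S := (@sphere R d).
Local Notation bmS := (bm (S : set V)).
Hypothesis mu1 : mu (S : set V) = 1%E.
Variable q : 'rV[R]_d -> R.
Hypothesis mq : measurable_fun setT (q : V -> R).
Hypothesis q01 : forall x, sphere x -> 0 <= q x <= 1.
Let mS : measurable (S : set V). Proof. exact: measurable_sphere. Qed.
Let ED (f g : V -> R) : bmS f -> bmS g ->
  Ex mu S (fun x => f x + g x) = Ex mu S f + Ex mu S g.
Proof. exact: ExD. Qed.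
Let EZ c (f : V -> R) : bmS f -> Ex mu S (fun x => c * f x) = c * Ex mu S f.
Proof. exact: ExZ. Qed.

Let bm_band (w : 'rV[R]_d) (b : R) : bmS (fun x => ind (b / 2 <= dotv w x <= b) : R).
Proof. by apply: bm_bool; exact: measurable_band. Qed.

Lemma bm_step (w : 'rV[R]_d) (b f0 : R) (f : V -> R) : bmS f ->
  bmS (fun x => ind (b / 2 <= dotv w x <= b) * (q x * f0 + (1 - q x) * f x)).
Proof.
move=> bf; have bq := bm_q mq q01.
apply: bmM; first exact: bm_band.
apply: bmD; first by apply: bmM => //; exact: bm_cst.
by apply: bmM => //; apply: bmD; [exact: bm_cst|exact: bmN].
Qed.

Lemma band_prob_ge0 (w : 'rV[R]_d) (b : R) : 0 <= band_prob mu w b.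
Proof. by apply: Ex_ge0 => x _; rewrite ler0n. Qed.

Lemma le_step_mean (w : 'rV[R]_d) (b f0 g0 : R) (f g : V -> R) : bmS f -> bmS g ->
  f0 <= g0 -> (forall x, sphere x -> f x <= g x) ->
  step_mean mu q w b f0 f <= step_mean mu q w b g0 g.
Proof.
move=> bf bg fg0 fg; apply: le_Ex => //; [exact: bm_step|exact: bm_step|].
move=> x x1; apply: ler_wpM2l; first exact: ler0n.
have /andP[h0 h1] := q01 x1.
by apply: lerD; apply: ler_wpM2l => //; [rewrite subr_ge0|exact: fg].
Qed.

Lemma step_mean_affine (w : 'rV[R]_d) (b al be f0 : R) (f : V -> R) : bmS f ->
  step_mean mu q w b (al * f0 + be) (fun x => al * f x + be) =
  al * step_mean mu q w b f0 f + be * band_prob mu w b.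
Proof.
move=> bf; have bs := bm_step w b f0 bf; have bb := bm_band w b.
rewrite /step_mean /band_prob -(EZ al bs) -(EZ be bb) -(ED (bmZ al bs) (bmZ be bb)).
by apply: eq_Ex => x _; ring.
Qed.

Lemma step_mean_cst (w : 'rV[R]_d) (b c : R) :
  step_mean mu q w b c (fun=> c) = c * band_prob mu w b.
Proof.
have bb := bm_band w b.
by rewrite /step_mean /band_prob -(EZ c bb); apply: eq_Ex => x _; ring.
Qed.

Variables (bs : nat -> R) (M : nat) (F : nat -> V -> R) (K : R).
Hypothesis mF : forall l, measurable_fun setT (F l).
Hypothesis F0 : forall l w, 0 <= F l w.
Hypothesis FK : forall l w, F l w <= K.

Lemma measurable_reflectr (w : 'rV[R]_d) :
  measurable_fun setT (fun x : V => reflect x w : V).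
Proof.
apply: measurable_vecD => //; apply: measurable_vecN; apply: measurable_vecZ => //.
by apply: measurable_funM => //; exact: measurable_dotv.
Qed.

Lemma bm_potential_reflect l (w : 'rV[R]_d) : bmS (fun x => F l (reflect x w)).
Proof.
split; last by exists K => x _; rewrite ger0_norm.
exact: measurableT_comp (mF l) (measurable_reflectr w).
Qed.

Lemma mean_next_frozen l w : (M <= l)%N -> mean_next mu q bs M F l w = F l w.
Proof.
move=> Ml; rewrite -[RHS](Ex_cst mS mu1); apply: eq_Ex => x _.
by rewrite /active ltnNge Ml.
Qed.

Lemma mean_next_step l w : (l < M)%N -> mean_next mu q bs M F l w =
  step_mean mu q w (bs l) (F l.+1 w) (fun x => F l.+1 (reflect x w)) +
  (1 - band_prob mu w (bs l)) * F l w.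
Proof.
move=> lM; have bstep := bm_step w (bs l) (F l.+1 w) (bm_potential_reflect l.+1 w).
have bb := bm_band w (bs l).
have -> : (1 - band_prob mu w (bs l)) * F l w =
    Ex mu S (fun x => F l w + - F l w * ind (bs l / 2 <= dotv w x <= bs l)).
  rewrite (ED (bm_cst _ (F l w)) (bmZ (- F l w) bb)) (EZ (- F l w) bb).
  by rewrite (Ex_cst mS mu1) /band_prob; ring.
rewrite /step_mean -(ED bstep (bmD (bm_cst _ (F l w)) (bmZ (- F l w) bb))).
apply: eq_Ex => x x1; rewrite /active lM (x1 : dotv x x = 1) eqxx /=.
by case: ifP => _; rewrite ?mul1r ?mul0r ?mulr1 ?mulr0; ring.
Qed.

(** A potential capped at 1 cannot increase in mean where it attains its cap; this settles the
    states where no contraction is available. *)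
Lemma mean_next_le1 l w : sphere w -> (forall l w, F l w <= 1) -> F l w = 1 ->
  mean_next mu q bs M F l w <= F l w.
Proof.
move=> w1 F1 e; case: (leqP M l) => lM; first by rewrite mean_next_frozen.
rewrite mean_next_step// e mulr1.
have : step_mean mu q w (bs l) (F l.+1 w) (fun x => F l.+1 (reflect x w)) <=
    step_mean mu q w (bs l) 1 (fun=> 1).
  by apply: le_step_mean => //; [exact: bm_potential_reflect|exact: bm_cst].
by rewrite step_mean_cst mul1r; lra.
Qed.

End StepMean.

(** * Tail bounds *)

Section Tail.
Context {R : realType} {d : nat} {dT : measure_display} {T : measurableType dT}.
Variables (P : probability T R) (Z : nat -> T -> 'rV[R]_d) (U : nat -> T -> R).
Local Notation V := (vec R d).
Local Notation S := (@sphere R d).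
Variables (mu : probability V R).
Hypothesis mu1 : mu (S : set V) = 1%E.
Hypothesis lawZ : forall n (B : set V), measurable B ->
  measurable (Z n @^-1` B) /\ P (Z n @^-1` B) = mu B.
Hypothesis lawU : forall n, uniform01_rv P (U n).
Hypothesis indep : mutually_independent P (stream_sigma Z U).
Local Notation W := (coords Z U).
Variables (q : 'rV[R]_d -> R) (bs : nat -> R) (M : nat) (v0 : 'rV[R]_d).
Hypotheses (v01 : sphere v0) (bs0 : forall l, 0 < bs l).
Hypothesis mq : measurable_fun setT (q : V -> R).
Hypothesis q01 : forall x, sphere x -> 0 <= q x <= 1.
Local Notation rn := (run q bs M v0).

Let mWf : measurable_fun setT (W : T -> fspace (nat + nat)%type (V * R)%type).
Proof. by apply: measurable_fspace; exact: (measurable_coords lawZ lawU). Qed.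

Lemma measurable_run_vec n : measurable_fun setT (fun t => (rn (W t) n).1 : V).
Proof. exact: measurableT_comp (measurable_run M v0 bs0 mq n).1 mWf. Qed.

Lemma measurable_run_count n l : measurable_fun setT (fun t => (rn (W t) n).2 == l).
Proof. exact: measurableT_comp ((measurable_run M v0 bs0 mq n).2 l) mWf. Qed.

Lemma measurable_potential (F : nat -> V -> R) n : (forall l, measurable_fun setT (F l)) ->
  measurable_fun setT (potential Z U q bs M v0 F n).
Proof.
move=> mF; apply: (@measurable_select _ T _ R (fun t => (rn (W t) n).2)
  (fun l t => F l (rn (W t) n).1)) => l; first exact: measurable_run_count.
exact: measurableT_comp (mF l) (measurable_run_vec n).
Qed.

(** Markov's inequality at level 1 for the mean bounded by [supermartingale]. *)
Lemma potential_tail (F : nat -> V -> R) (K : R) (gam : R) n (A : set T) :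
  (forall l, measurable_fun setT (F l)) -> (forall l w, 0 <= F l w) ->
  (forall l w, F l w <= K) -> 0 <= gam ->
  (forall l w, sphere w -> mean_next mu q bs M F l w <= gam * F l w) ->
  measurable A -> (forall t, A t -> 1 <= F (rn (W t) n).2 (rn (W t) n).1) ->
  (P A <= (gam ^+ n * F 0%N v0)%:E)%E.
Proof.
move=> mF F0 FK gam0 hm mA hA.
have h := supermartingale mu1 lawZ lawU indep v01 bs0 mq q01 mF F0 FK n gam0 hm.
apply: le_trans h.
have -> : P A = (\int[P]_t (\1_A t)%:E)%E by rewrite integral_indic// setIT.
apply: ge0_le_integral => //.
- by apply/measurable_EFinP; exact: measurable_indic.
- by apply/measurable_EFinP; exact: measurable_potential.
- move=> t _; rewrite lee_fin indicE; case: (boolP (t \in A)) => tA; last exact: F0.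
  by apply: hA; rewrite inE in tA.
Qed.

Lemma measurable_count_lt n : measurable [set t | ((rn (W t) n).2 < M)%N].
Proof.
rewrite (_ : [set t | _] = \bigcup_(l in [set l | (l < M)%N]) [set t | (rn (W t) n).2 == l]).
  apply: bigcup_measurable => l _.
  rewrite (_ : [set t | _] = setT `&` (fun t => (rn (W t) n).2 == l) @^-1` [set true]).
    exact: measurable_run_count.
  by rewrite setTI; apply/seteqP; split.
apply/seteqP; split=> [t /= h|t [l /= lM /eqP ->]//].
by exists (rn (W t) n).2 => /=.
Qed.

Lemma count_tail (p : R) n : 0 <= p <= 1 ->
  (forall l w, (l < M)%N -> sphere w -> p <= band_prob mu w (bs l)) ->
  (P [set t | ((rn (W t) n).2 < M)%N] <= ((1 - p / 2) ^+ n * 2 ^+ M)%:E)%E.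
Proof.
move=> /andP[p0 p1] hp.
(* Each label at least halves this, and a draw yields one with probability at least p. The value
   drops from 2 to 0 at the last label, so frozen states satisfy the strict decay as well. *)
pose F l (w : V) : R := if (l < M)%N then 2 ^+ (M - l) else 0.
have F0 l w : 0 <= F l w by rewrite /F; case: ifP => // _; exact: exprn_ge0.
have FK l w : F l w <= 2 ^+ M.
  rewrite /F; case: ifP => _; last exact: exprn_ge0.
  by rewrite ler_weXn2l// ?leq_subr//; lra.
have mF l : measurable_fun setT (F l) by rewrite /F; case: ifP => _; exact: measurable_cst.
have g0 : 0 <= 1 - p / 2 by lra.
have hm l w : sphere w -> mean_next mu q bs M F l w <= (1 - p / 2) * F l w.
  move=> w1; case: (leqP M l) => lM.
    by rewrite (mean_next_frozen mu1)// /F ltnNge lM /= mulr0.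
  rewrite (mean_next_step mu1 mq q01 bs mF F0 FK w lM).
  have e : F l w = 2 * F l.+1 w \/ F l.+1 w = 0.
    rewrite /F lM; case: ifP => h; [left|by right].
    by rewrite -exprS subnSK.
  have st : step_mean mu q w (bs l) (F l.+1 w) (fun x => F l.+1 (reflect x w)) =
    F l.+1 w * band_prob mu w (bs l) by exact: step_mean_cst.
  rewrite st; have := hp l w lM w1; have := F0 l w; have := F0 l.+1 w.
  have := band_prob_ge0 mu w (bs l).
  by case: e => ->; nra.
have := potential_tail mF F0 FK g0 hm (measurable_count_lt n).
move=> h; apply: (le_trans (h n _)); last first.
  by rewrite lee_fin; apply: ler_wpM2l; [exact: exprn_ge0|exact: FK].
move=> t /= lM; rewrite /F lM exprn_ege1//; lra.
Qed.

End Tail.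

(** * Labels grouped into rounds *)

Section Schedule.
Variables (ms : nat -> nat) (K : nat).

(* [pos l] is the round in which the (l+1)-st label is queried, together with the number of
   queries left in that round. *)
Fixpoint pos (l : nat) : nat * nat :=
  match l with
  | 0 => (1%N, ms 1%N)
  | l'.+1 => let p := pos l' in
      if (p.2 <= 1)%N && (p.1 < K)%N then (p.1.+1, ms p.1.+1) else (p.1, p.2.-1)
  end.

Hypotheses (K0 : (0 < K)%N) (ms0 : forall k, (0 < k)%N -> (0 < ms k)%N).
Local Notation Ms k := (\sum_(i < k) ms i.+1)%N.

Lemma posP l : (l <= Ms K)%N -> [/\ (0 < (pos l).1 <= K)%N, Ms (pos l).1 = (l + (pos l).2)%N,
  ((pos l).2 <= ms (pos l).1)%N & (l < Ms K)%N -> (0 < (pos l).2)%N].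
Proof.
elim: l => [|l IH] lM /=.
  by rewrite big_ord1 ms0//; split.
have [/andP[k0 kK] e1 e2 /(_ lM) t0] := IH (ltnW lM).
case: ifP => [/andP[t1 k1]|h] /=.
  have te : (pos l).2 = 1%N by apply/eqP; rewrite eqn_leq t1.
  split => //; first by rewrite big_ord_recr /= e1 te; lia.
  by move=> _; exact: ms0.
split=> //; [by rewrite k0|by rewrite e1; lia|exact: leq_trans (leq_pred _) e2|].
move=> lM1; case: (ltnP 1 (pos l).2) => t1; first lia.
move: h; rewrite t1 /= => /negbT; rewrite -leqNgt => Kk.
have ek : (pos l).1 = K by apply/eqP; rewrite eqn_leq kK.
by rewrite ek in e1; rewrite e1 in lM1; lia.
Qed.

Lemma leq_Ms k k' : (k <= k')%N -> (Ms k <= Ms k')%N.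
Proof.
elim: k' => [|k' IH]; first by rewrite leqn0 => /eqP->.
rewrite leq_eqVlt => /orP[/eqP->//|/IH h]; apply: (leq_trans h).
by rewrite big_ord_recr leq_addr.
Qed.

Lemma pos_round k l : (k < K)%N -> (Ms k <= l < Ms k.+1)%N -> (pos l).1 = k.+1.
Proof.
move=> kK /andP[h1 h2]; have lM : (l < Ms K)%N by apply: leq_trans h2 (leq_Ms kK).
have [/andP[k0 _] e1 e2 /(_ lM) t0] := posP (ltnW lM).
case: (ltngtP (pos l).1 k.+1) => // h.
  by have := @leq_Ms (pos l).1 k h; rewrite e1; lia.
case: (pos l).1 k0 h e1 e2 => // k' _ h e1 e2.
have e3 : Ms k'.+1 = (Ms k' + ms k'.+1)%N by rewrite big_ord_recr.
by have := @leq_Ms k.+1 k' h; lia.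
Qed.

(** Round [K] has no successor, so its counter runs down to 0; the final potential is read in this
    state. *)
Lemma pos_last : pos (Ms K) = (K, 0%N).
Proof.
have [/andP[k0 kK] e1 e2 _] := posP (leqnn _).
have := leq_Ms kK; rewrite e1 => h.
have t0 : (pos (Ms K)).2 = 0%N by lia.
rewrite t0 addn0 in e1.
have ek : (pos (Ms K)).1 = K.
  apply/eqP; rewrite eqn_leq kK leqNgt; apply/negP => lt.
  have := leq_Ms lt; rewrite big_ord_recr /= e1 -[leqRHS]addn0 leq_add2l leqn0.
  by rewrite -[_ == _]negbK -lt0n ms0.
by rewrite [LHS]surjective_pairing ek t0.
Qed.

End Schedule.

(** * The truncated potential of a round and its budget *)

Section RoundPotential.
Variables (R : realType) (ms : nat -> nat) (lam A S : nat -> R) (rho : R).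
Hypotheses (rho01 : 0 <= rho <= 1).
Hypothesis lam0 : forall k, (0 < k)%N -> 0 < lam k.
Hypothesis A3 : forall k, 0 <= A k <= Num.sqrt 3.
Hypothesis S0 : forall k, 0 <= S k.
Hypothesis budget : forall k,
  (1 - rho) ^+ ms k.+1 * expR (lam k.+1 * (A k - A k.+1)) +
  expR (- (lam k.+1 * (Num.sqrt 3 - A k))) +
  2 * (ms k.+1)%:R * expR (- (lam k.+1 * A k.+1 / 2)) + S k.+1 <= S k.

(** Weights of two bad outcomes: ending the round beyond [A k], discounted by the [t] contractions
    to come, and escaping beyond sqrt 3. *)
Definition slope (k t : nat) : R :=
  (1 - rho) ^+ t * expR (- (lam k * A k)) + expR (- (lam k * Num.sqrt 3)).
(** An upper estimate of the failure probability with [t] labels left in round [k]: the weighted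
    exponential, the additive terms of those labels, and the budget [S k] of later rounds. *)
Definition level (k t : nat) (r : R) : R :=
  slope k t * expR (lam k * r) + (2 * t%:R * expR (- (lam k * A k / 2)) + S k).
Definition pot (k t : nat) (r : R) : R :=
  if Num.sqrt 3 < r then 1 else Num.min 1 (level k t r).

Let r0 : 0 <= 1 - rho. Proof. by move: rho01 => /andP[_ ?]; rewrite subr_ge0. Qed.

Lemma slope_ge0 k t : 0 <= slope k t.
Proof. by rewrite addr_ge0 ?expR_ge0// mulr_ge0 ?expR_ge0// exprn_ge0. Qed.

Lemma extra_ge0 k t : 0 <= 2 * t%:R * expR (- (lam k * A k / 2)) + S k.
Proof. by rewrite addr_ge0// mulr_ge0 ?expR_ge0// mulr_ge0. Qed.

Lemma level_ge0 k t r : 0 <= level k t r.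
Proof. by rewrite addr_ge0 ?extra_ge0// mulr_ge0 ?slope_ge0 ?expR_ge0. Qed.

Lemma pot_le1 k t r : pot k t r <= 1.
Proof. by rewrite /pot; case: ifP => // _; rewrite ge_min lexx. Qed.

Lemma pot_ge0 k t r : 0 <= pot k t r.
Proof. by rewrite /pot; case: ifP => // _; rewrite le_min ler01 level_ge0. Qed.

(** Beyond sqrt 3 the second summand of [slope] alone brings [level] to 1, so a step that crosses
    sqrt 3 is still estimated by the exponential. *)
Lemma pot_level k t r : (0 < k)%N -> pot k t r <= level k t r.
Proof.
move=> k0; rewrite /pot; case: ifP => h; last by rewrite ge_min lexx orbT.
have e1 : 1 <= expR (- (lam k * Num.sqrt 3)) * expR (lam k * r).
  rewrite -expRD -[leLHS]expR0 ler_expR -mulrN -mulrDr mulr_ge0 ?(ltW (lam0 k0))//.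
  by rewrite addrC subr_ge0 ltW.
apply: (le_trans e1); rewrite /level -[leLHS]addr0; apply: lerD; last exact: extra_ge0.
apply: ler_wpM2r; first exact: expR_ge0.
by rewrite lerDr mulr_ge0 ?expR_ge0// exprn_ge0.
Qed.

Lemma level0_ge1 k r : (0 < k)%N -> A k <= r -> 1 <= level k 0 r.
Proof.
move=> k0 h; have e1 : 1 <= expR (- (lam k * A k)) * expR (lam k * r).
  by rewrite -expRD -expR0 ler_expR -mulrN -mulrDr mulr_ge0 ?(ltW (lam0 k0))//; lra.
apply: (le_trans e1); rewrite /level -[leLHS]addr0; apply: lerD; last exact: extra_ge0.
apply: ler_wpM2r; first exact: expR_ge0.
by rewrite /slope expr0 mul1r lerDl expR_ge0.
Qed.

Lemma level_start k r : r <= A k -> level k.+1 (ms k.+1) r <= S k.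
Proof.
move=> h; apply: le_trans (budget k); rewrite /level addrA; apply: lerD => //.
apply: lerD => //; rewrite mulrDl -mulrA -!expRD.
have l0 : 0 < lam k.+1 by exact: lam0.
have hr : lam k.+1 * r <= lam k.+1 * A k by rewrite ler_pM2l.
apply: lerD.
  by apply: ler_wpM2l; [exact: exprn_ge0|rewrite ler_expR mulrBr; lra].
by rewrite ler_expR mulrBr; lra.
Qed.

Lemma pot_start k r : r <= A k -> pot k.+1 (ms k.+1) r <= S k.
Proof. by move=> h; apply: le_trans (level_start h); exact: pot_level. Qed.

(** Either the round ended beyond [A k], and [level k 0] is at least 1 already, or the next round
    starts within its radius and costs at most [S k]. *)
Lemma pot_next k r : (0 < k)%N -> pot k.+1 (ms k.+1) r <= level k 0 r.
Proof.
move=> k0; have [h|h] := leP (A k) r.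
  by apply: le_trans (level0_ge1 k0 h); exact: pot_le1.
apply: (le_trans (pot_start (ltW h))).
rewrite /level mulr0 mul0r add0r lerDr mulr_ge0 ?slope_ge0 ?expR_ge0//.
Qed.

(** [A k / 4] is the threshold [a] of [one_step_contraction]. Its additive term exp (lam A / 2) is
    weighted by a slope of at most 2 exp (- lam A), so each label costs 2 exp (- lam A / 2), as
    [level] provides. *)
Lemma level_contract k t r : (0 < k)%N ->
  slope k t * ((1 - rho) * expR (lam k * r) + expR (2 * lam k * (A k / 4))) +
  (2 * t%:R * expR (- (lam k * A k / 2)) + S k) <= level k t.+1 r.
Proof.
move=> k0; have l0 := ltW (lam0 k0).
have -> : 2 * lam k * (A k / 4) = lam k * A k / 2 by field.
have h1 : slope k t * (1 - rho) <= slope k t.+1.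
  rewrite /slope mulrDl exprSr mulrAC lerD2l -[leRHS]mulr1 ler_wpM2l ?expR_ge0//.
  by rewrite gerBl; case/andP: rho01.
have h2 : slope k t * expR (lam k * A k / 2) <= 2 * expR (- (lam k * A k / 2)).
  have : slope k t <= 2 * expR (- (lam k * A k)).
    rewrite /slope mulr_natl mulr2n; apply: lerD.
      rewrite ler_piMl ?expR_ge0// exprn_ile1//; case/andP: rho01; lra.
    by rewrite ler_expR lerN2; apply: ler_wpM2l => //; case/andP: (A3 k).
  move=> h; apply: (@le_trans _ _ (2 * expR (- (lam k * A k)) * expR (lam k * A k / 2))).
    by apply: ler_wpM2r => //; exact: expR_ge0.
  rewrite -mulrA -expRD le_eqVlt; apply/orP; left; apply/eqP; by congr (_ * expR _); field.
rewrite /level mulrDr mulrA.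
have h3 : slope k t * (1 - rho) * expR (lam k * r) <= slope k t.+1 * expR (lam k * r).
  by apply: ler_wpM2r => //; exact: expR_ge0.
have -> : t.+1%:R = t%:R + 1 :> R by rewrite -natr1.
lra.
Qed.

End RoundPotential.

(** * Distance to the target after the last round *)

Section Correctness.
Context {R : realType} {d : nat} {dT : measure_display} {T : measurableType dT}.
Variables (P : probability T R) (Z : nat -> T -> 'rV[R]_d) (U : nat -> T -> R).
Local Notation V := (vec R d).
Local Notation S := (@sphere R d).
Variables (mu : probability V R).
Hypothesis mu_rot : rotation_invariant mu.
Hypothesis d2 : (2 <= d)%N.
Hypothesis lawZ : forall n (B : set V), measurable B ->
  measurable (Z n @^-1` B) /\ P (Z n @^-1` B) = mu B.
Hypothesis lawU : forall n, uniform01_rv P (U n).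
Hypothesis indep : mutually_independent P (stream_sigma Z U).
Local Notation W := (coords Z U).
Variables (q : 'rV[R]_d -> R) (u v0 : 'rV[R]_d) (eta : R).
Hypotheses (v01 : sphere v0) (u1 : sphere u) (eta0 : 0 <= eta < 2^-1).
Hypothesis mq : measurable_fun setT (q : V -> R).
Hypothesis q01 : forall x, sphere x -> 0 <= q x <= 1.
Hypothesis noise : bounded_noise eta u q.
Let ga := 1 - 2 * eta.
Let D : R := Num.sqrt d%:R.

Variables (ms : nat -> nat) (K : nat) (b lam A Sk : nat -> R) (ka nu : R).
Hypotheses (K0 : (0 < K)%N) (ms0 : forall k, (0 < k)%N -> (0 < ms k)%N).
Hypothesis ka0 : 0 < ka.
Hypothesis kaC : ka * (24 * expR 1 * (2 * expR 16)) * (8 * 1024) <= 1.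
Hypothesis ka1 : ka <= 2^-1.
Hypothesis nu0 : 0 <= nu.
Hypothesis nuC : nu * (12 * 1024) <= 1.
Hypothesis b0 : forall k, 0 < b k.
Hypothesis lam0 : forall k, (0 < k)%N -> 0 < lam k.
Hypothesis A3 : forall k, 0 <= A k <= Num.sqrt 3.
Hypothesis Sk0 : forall k, 0 <= Sk k.
Hypothesis lamE : forall k, (0 < k)%N -> lam k * b k = ka * ga * D.
Hypothesis bA : forall k, (0 < k)%N -> b k <= A k / 8.
Hypothesis b2 : forall k, (0 < k)%N -> b k ^+ 2 <= 2^-1.
Hypothesis bD : forall k, (0 < k)%N -> b k * D <= nu * ga * (A k / 4).
Let rho := ka * ga ^+ 2 / (4 * 1024).
Hypothesis budget : forall k,
  (1 - rho) ^+ ms k.+1 * expR (lam k.+1 * (A k - A k.+1)) +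
  expR (- (lam k.+1 * (Num.sqrt 3 - A k))) +
  2 * (ms k.+1)%:R * expR (- (lam k.+1 * A k.+1 / 2)) + Sk k.+1 <= Sk k.
Hypothesis start : dist v0 u <= A 0.

Local Notation Ms k := (\sum_(i < k) ms i.+1)%N.
Local Notation M := (Ms K).
Local Notation bs := (fun l => b (pos ms K l).1).
Local Notation rn := (run q bs M v0).

Let ga01 : 0 < ga <= 1. Proof. by move: eta0 => /andP[? ?]; rewrite /ga; lra. Qed.

Let rho01 : 0 <= rho <= 1.
Proof.
case/andP: ga01 => g0 g1; have g2 : ga ^+ 2 <= 1 by apply: exprn_ile1 => //; exact: ltW.
have g3 := sqr_ge0 ga; rewrite /rho; have := mulr_ge0 (ltW ka0) g3.
have : ka * ga ^+ 2 <= 2^-1 * 1 by apply: ler_pM => //; exact: ltW.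
lra.
Qed.

Let F (l : nat) (w : V) : R :=
  pot lam A Sk rho (pos ms K l).1 (pos ms K l).2 (dist w u).

Let F0 l w : 0 <= F l w. Proof. exact: pot_ge0. Qed.
Let F1 l w : F l w <= 1. Proof. exact: pot_le1. Qed.

Lemma measurable_dist : measurable_fun setT (fun w : V => dist w u).
Proof.
have m : measurable_fun setT (fun w : V => w - u : V) by exact: measurable_vecD.
have mdot : measurable_fun setT (fun w : V => dotv (w - u) (w - u)) by exact: measurable_dotv.
have ms_ : measurable_fun setT (@Num.sqrt R).
  by apply: continuous_measurable_fun; exact: sqrt_continuous.
exact: measurableT_comp ms_ mdot.
Qed.

Let mF l : measurable_fun setT (F l).
Proof.
have md := measurable_dist; rewrite /F /pot.
apply: measurable_fun_ifT => //; first exact: measurable_fun_ltr.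
apply: measurable_minr => //; rewrite /level; apply: measurable_funD => //.
apply: measurable_funM => //; apply: measurableT_comp; first exact: measurable_expR.
exact: measurable_funM.
Qed.

Let F_next l w : (l < M)%N ->
  F l.+1 w <= level lam A Sk rho (pos ms K l).1 (pos ms K l).2.-1 (dist w u).
Proof.
move=> lM; have [/andP[k0 kK] _ _ /(_ lM) t0] := posP K0 ms0 (ltnW lM).
rewrite /F /=; case: ifP => [/andP[t1 _]|_] /=; last exact: pot_level.
have -> : (pos ms K l).2 = 1%N by apply/eqP; rewrite eqn_leq t1.
exact: pot_next.
Qed.

Lemma correctness_drift l (w : 'rV[R]_d) : sphere w -> mean_next mu q bs M F l w <= F l w.
Proof.
move=> w1; have mu1 := mu_rot.1; case: (leqP M l) => lM.
  by rewrite (mean_next_frozen mu1).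
have [e|ne] := eqVneq (F l w) 1.
  exact: (mean_next_le1 mu1 mq q01 bs M mF F0 F1 w1 F1 e).
have [/andP[k0 kK] _ _ /(_ lM) t0] := posP K0 ms0 (ltnW lM).
have hn := F_next _ lM; move: ne; rewrite {1}/F /pot.
set k := (pos ms K l).1 in k0 kK hn *; set t := (pos ms K l).2 in t0 hn *.
case: ifP => [|/negbT]; first by rewrite eqxx.
rewrite -leNgt => r3; rewrite /Num.min; case: ifP => [|/negbT h1 _]; first by rewrite eqxx.
have Fe : F l w = level lam A Sk rho k t (dist w u).
  by rewrite /F /pot -/k -/t ltNge r3 /= /Num.min (negbTE h1).
rewrite (mean_next_step mu1 mq q01 bs mF F0 F1 w lM).
have bk : bs l = b k by [].
rewrite bk; set p := band_prob mu w (b k).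
have p0 : 0 <= p by exact: band_prob_ge0.
pose al := slope lam A rho k t.-1.
pose be := 2 * (t.-1)%:R * expR (- (lam k * A k / 2)) + Sk k.
have be_ : bm (S : set V) (fun x => expR (lam k * dist (reflect x w) u)).
  by apply: bm_expR; apply: bmZ; exact: bm_dist_reflect.
(* After the step the potential is replaced by [level], which is affine in the exponential, so the
   contraction applies; before the step the two agree, since the cap is not attained. *)
have s1 : step_mean mu q w (b k) (F l.+1 w) (fun x => F l.+1 (reflect x w)) <=
    step_mean mu q w (b k) (al * expR (lam k * dist w u) + be)
      (fun x => al * expR (lam k * dist (reflect x w) u) + be).
  apply: (le_step_mean mu mq q01); first exact: bm_potential_reflect.
  - by apply: bmD; [exact: bmZ|exact: bm_cst].
  - exact: hn.
  - by move=> x _; exact: hn.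
have al0 : 0 <= al by exact: slope_ge0.
have c1 := one_step_contraction mu_rot d2 u1 eta0 mq q01 noise w1 (b0 k) ka0 kaC ka1 nu0 nuC
  (lamE k0) (a := A k / 4).
have c2 := c1 _ (b2 k0) (bD k0) r3.
have {c1 c2} c : step_mean mu q w (b k) (expR (lam k * dist w u))
    (fun x => expR (lam k * dist (reflect x w) u)) <=
    ((1 - rho) * expR (lam k * dist w u) + expR (2 * lam k * (A k / 4))) * p.
  by apply: c2; have := bA k0; lra.
have sa := step_mean_affine mu mq q01 w (b k) al be (expR (lam k * dist w u)) be_.
rewrite {}sa -/p in s1.
have lc := level_contract Sk rho01 lam0 A3 t.-1 (dist w u) k0.
rewrite prednK // -Fe -/al -/be in lc.
have h2 := ler_wpM2l al0 c.
have h3 := ler_wpM2r p0 lc.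
move: s1 h2 h3; set X := step_mean _ _ _ _ _ _; set Y := step_mean _ _ _ _ _ _.
lra.
Qed.

Lemma correctness_tail N :
  (P [set t | (M <= (rn (W t) N).2)%N /\ (A K < dist (rn (W t) N).1 u)%R] <= (Sk 0)%:E)%E.
Proof.
have bs0 l : 0 < bs l by exact: b0.
have hm l (w : 'rV[R]_d) : sphere w -> mean_next mu q bs M F l w <= 1 * F l w.
  by move=> w1; rewrite mul1r; exact: correctness_drift.
have mA : measurable [set t | (M <= (rn (W t) N).2)%N /\ (A K < dist (rn (W t) N).1 u)%R].
  rewrite (_ : [set t | _] = ~` [set t | ((rn (W t) N).2 < M)%N] `&`
    [set t | A K < dist (rn (W t) N).1 u]); last first.
    apply/seteqP; split=> t /= [h1 h2]; split => //; first by rewrite ltnNge h1.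
    by rewrite leqNgt; apply/negP.
  apply: measurableI.
    by apply: measurableC; exact: (measurable_count_lt lawZ lawU _ v0 bs0 mq).
  have mr := measurable_run_vec lawZ lawU M v0 bs0 mq N.
  have md : measurable_fun setT (fun t => A K < dist (rn (W t) N).1 u).
    by apply: measurable_fun_ltr => //; exact: measurableT_comp measurable_dist mr.
  rewrite (_ : [set t | _] = setT `&` (fun t => A K < dist (rn (W t) N).1 u) @^-1` [set true]).
    exact: md.
  by rewrite setTI; apply/seteqP; split.
have := potential_tail mu_rot.1 lawZ lawU indep v01 bs0 mq q01 mF F0 F1 ler01 hm mA.
move=> h; apply: (le_trans (h N _)).
  move=> t /= [h1 h2].
  have e : (rn (W t) N).2 = M.
    apply/eqP; rewrite eqn_leq h1 andbT; exact: run_count_leM.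
  rewrite /F e pos_last //= /pot; case: ifP => // _.
  rewrite le_min lexx /=; apply: level0_ge1 => //; exact: ltW.
by rewrite expr1n mul1r lee_fin /F /=; exact: pot_start.
Qed.

End Correctness.

Lemma image_law_exists d1 (T1 : measurableType d1) d2 (T2 : measurableType d2) (R : realType)
    (P : probability T1 R) (f : T1 -> T2) : measurable_fun setT f ->
  exists mu : probability T2 R, forall B, mu B = P (f @^-1` B).
Proof.
move=> mf; pose X : {mfun T1 >-> T2} := HB.pack f (isMeasurableFun.Build _ _ _ _ f mf).
by exists (distribution P X).
Qed.

(** * The good event *)

Section Assembly.
Context {R : realType} {d : nat} {dT : measure_display} {T : measurableType dT}.
Variables (P : probability T R) (Z : nat -> T -> 'rV[R]_d) (U : nat -> T -> R).
Local Notation V := (vec R d).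
Local Notation S := (@sphere R d).
Hypothesis d2 : (2 <= d)%N.
Hypothesis unifZ : forall n, uniform_sphere_rv P (Z n).

(** [sphere_unif] is a mere set function; its countable additivity and its mass one are inherited
    from the law of [Z 0]. *)
Lemma sphere_law_exists : exists mu : probability V R, rotation_invariant mu /\
  forall B : set V, measurable B -> mu B = (sphere_unif B)%:E.
Proof.
have mZ : measurable_fun setT (Z 0 : T -> V).
  by move=> _ B mB; rewrite setTI; exact: (unifZ 0 mB).1.
have [mu hmu] := image_law_exists P mZ.
have muE (B : set V) : measurable B -> mu B = (sphere_unif B)%:E.
  by move=> mB; rewrite hmu; exact: (unifZ 0 mB).2.
exists mu; split=> //; split=> [|v A v1 mA].
  rewrite muE; last exact: measurable_sphere.
  rewrite sphere_unif_sphere -muE; last exact: measurableT.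
  exact: probability_setT.
rewrite muE; last by rewrite -[X in measurable X]setTI; exact: measurable_reflect.
by rewrite muE// sphere_unif_reflect.
Qed.

Lemma disagreement_le (v u : 'rV[R]_d) : sphere v -> sphere u ->
  disagreement v u <= 12 * dist v u.
Proof.
move=> v1 u1; have [mu [mu_rot muE]] := sphere_law_exists.
apply: le_trans (disagreement_prob_le mu_rot v1 u1).
have mdis : measurable_fun setT (fun x : V => sgnp (dotv v x) != sgnp (dotv u x)).
  apply: measurable_neg; apply: measurable_fun_eqr.
    by apply: measurable_sgnp; exact: measurable_dotv.
  by apply: measurable_sgnp; exact: measurable_dotv.
have e := Ex_bool (@measurable_sphere R d) mu_rot.1 mdis.
have es : [set x | sgnp (dotv v x) <> sgnp (dotv u x)] =
    [set x : V | sgnp (dotv v x) != sgnp (dotv u x)].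
  by apply/seteqP; split=> x /= h; apply/eqP.
rewrite /disagreement es.
have := e; rewrite muE; first by move=> [->].
rewrite (_ : [set x : V | _] = setT `&` (fun x : V => sgnp (dotv v x) != sgnp (dotv u x)) @^-1` [set true]).
  exact: mdis.
by rewrite setTI; apply/seteqP; split.
Qed.

Hypothesis lawU : forall n, uniform01_rv P (U n).
Hypothesis indep : mutually_independent P (stream_sigma Z U).
Local Notation W := (coords Z U).
Variables (q : 'rV[R]_d -> R) (u v0 : 'rV[R]_d) (eta : R).
Hypotheses (v01 : sphere v0) (u1 : sphere u) (eta0 : 0 <= eta < 2^-1).
Hypothesis mq : measurable_fun setT (q : V -> R).
Hypothesis q01 : forall x, sphere x -> 0 <= q x <= 1.
Hypothesis noise : bounded_noise eta u q.
Let ga := 1 - 2 * eta.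
Let D : R := Num.sqrt d%:R.

Variables (ms : nat -> nat) (K : nat) (b lam A Sk : nat -> R) (ka nu : R).
Hypotheses (K0 : (0 < K)%N) (ms0 : forall k, (0 < k)%N -> (0 < ms k)%N).
Hypothesis ka0 : 0 < ka.
Hypothesis kaC : ka * (24 * expR 1 * (2 * expR 16)) * (8 * 1024) <= 1.
Hypothesis ka1 : ka <= 2^-1.
Hypothesis nu0 : 0 <= nu.
Hypothesis nuC : nu * (12 * 1024) <= 1.
Hypothesis b0 : forall k, (0 < k)%N -> 0 < b k.
Hypothesis lam0 : forall k, (0 < k)%N -> 0 < lam k.
Hypothesis A3 : forall k, 0 <= A k <= Num.sqrt 3.
Hypothesis Sk0 : forall k, 0 <= Sk k.
Hypothesis lamE : forall k, (0 < k)%N -> lam k * b k = ka * ga * D.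
Hypothesis bA : forall k, (0 < k)%N -> b k <= A k / 8.
Hypothesis b2 : forall k, (0 < k)%N -> b k ^+ 2 <= 2^-1.
Hypothesis bD : forall k, (0 < k)%N -> b k * D <= nu * ga * (A k / 4).
Hypothesis bD4 : forall k, (0 < k)%N -> b k * D <= 4^-1.
Let rho := ka * ga ^+ 2 / (4 * 1024).
Hypothesis budget : forall k,
  (1 - rho) ^+ ms k.+1 * expR (lam k.+1 * (A k - A k.+1)) +
  expR (- (lam k.+1 * (Num.sqrt 3 - A k))) +
  2 * (ms k.+1)%:R * expR (- (lam k.+1 * A k.+1 / 2)) + Sk k.+1 <= Sk k.
Hypothesis start : dist v0 u <= A 0.
Variables (be Ab p delta : R) (N : nat).
Hypotheses (beE : be = 4 * (4 * 1536)) (AbE : Ab = 16 * be).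
Hypothesis p01 : 0 <= p <= 1.
Hypothesis pb : forall k, (0 < k <= K)%N -> p <= (8 * be)^-1 / (34 * Ab ^+ 2) * (b k * D).
Local Notation M := (\sum_(k < K) ms k.+1)%N.
Hypothesis N_count : (1 - p / 2) ^+ N * 2 ^+ M <= delta / 2.
Hypothesis Sk_delta : Sk 0 <= delta / 2.

Lemma good_event : exists G : set T, measurable G /\ (1 - delta%:E <= P G)%E /\
  forall t, G t -> exists (v : 'rV[R]_d) (j : nat),
    [/\ ap_rounds q (fun n => Z n t) (fun n => U n t) ms b v0 K = Some (v, j, M),
      (j <= N)%N, sphere v & dist v u <= A K].
Proof.
have [mu [mu_rot muE]] := sphere_law_exists.
have lawZ n (B : set V) : measurable B -> measurable (Z n @^-1` B) /\ P (Z n @^-1` B) = mu B.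
  by move=> mB; have [h1 h2] := unifZ n mB; rewrite muE.
(* Rounds are numbered from 1; the value 1 at round 0 makes every width positive, as the process
   requires. *)
pose b' k := if k is 0%N then 1 else b k.
pose bs l := b' (pos ms K l).1.
have b'0 k : 0 < b' k by case: k => // k; exact: b0.
have bs0 l : 0 < bs l by exact: b'0.
have b'E k : (0 < k)%N -> b' k = b k by case: k.
have corr := @correctness_tail R d dT T P Z U mu mu_rot d2 lawZ lawU indep q u v0 eta v01 u1
  eta0 mq q01 noise ms K b' lam A Sk ka nu K0 ms0 ka0 kaC ka1 nu0 nuC b'0 lam0 A3 Sk0.
have {}corr : (P [set t | (M <= (run q bs M v0 (W t) N).2)%N /\
    (A K < dist (run q bs M v0 (W t) N).1 u)%R] <= (Sk 0)%:E)%E.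
  apply: corr => //.
  - by move=> k k0; rewrite b'E// lamE.
  - by move=> k k0; rewrite b'E// bA.
  - by move=> k k0; rewrite b'E// b2.
  - by move=> k k0; rewrite b'E// bD.
have cnt : (P [set t | ((run q bs M v0 (W t) N).2 < M)%N] <= (delta / 2)%:E)%E.
  have h : (P [set t | ((run q bs M v0 (W t) N).2 < M)%N] <= ((1 - p / 2) ^+ N * 2 ^+ M)%:E)%E.
    apply: (count_tail mu_rot.1 lawZ lawU indep v01 bs0 mq q01 N p01).
    move=> l w lM w1; have [/andP[k0 kK] _ _ _] := posP K0 ms0 (ltnW lM).
    rewrite /bs b'E//; set k := (pos ms K l).1 in k0 kK *.
    apply: le_trans (band_prob_ge_aux mu_rot d2 beE AbE w1 (b0 k0) (bD4 k0)).
    by apply: pb; rewrite k0.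
  by apply: (le_trans h); rewrite lee_fin.
pose B1 := [set t | ((run q bs M v0 (W t) N).2 < M)%N].
pose B2 := [set t | (M <= (run q bs M v0 (W t) N).2)%N /\
    (A K < dist (run q bs M v0 (W t) N).1 u)%R].
(* The process discards draws off the sphere and the algorithm does not; outside this null event the
   two agree up to draw [N]. *)
pose B3 := \big[setU/set0]_(n < N) (Z n @^-1` (~` (S : set V))).
have mS : measurable (S : set V) by exact: measurable_sphere.
have mB1 : measurable B1 by exact: (measurable_count_lt lawZ lawU _ v0 bs0 mq).
have mB2 : measurable B2.
  rewrite (_ : B2 = ~` B1 `&` [set t | A K < dist (run q bs M v0 (W t) N).1 u]); last first.
    apply/seteqP; split=> t /= [h1 h2]; split => //; first by apply/negP; rewrite -leqNgt.
    by rewrite leqNgt; apply/negP.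
  apply: measurableI; first exact: measurableC.
  have mr := measurable_run_vec lawZ lawU M v0 bs0 mq N.
  have md : measurable_fun setT (fun t => A K < dist (run q bs M v0 (W t) N).1 u).
    by apply: measurable_fun_ltr => //; exact: measurableT_comp (measurable_dist u) mr.
  rewrite (_ : [set t | _] = setT `&`
    (fun t => A K < dist (run q bs M v0 (W t) N).1 u) @^-1` [set true]).
    exact: md.
  by rewrite setTI; apply/seteqP; split.
have mZS n : measurable (Z n @^-1` (~` (S : set V))).
  by apply: (lawZ n _ _).1; exact: measurableC.
have mB3 : measurable B3 by exact: bigsetU_measurable.
have P0 n : P (Z n @^-1` (~` (S : set V))) = 0%E.
  rewrite (lawZ n _ (measurableC mS)).2 probability_setC//.
  by rewrite (mu_rot.1 : mu (S : set V) = 1%E) subee.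
have P3 : P B3 = 0%E.
  apply/eqP; rewrite eq_le measure_ge0 andbT.
  apply: (le_trans (Boole_inequality P (fun i _ => mZS i))).
  by rewrite big1// => n _; exact: P0.
have U2 (C1 C2 : set T) : measurable C1 -> measurable C2 ->
    (P (C1 `|` C2) <= P C1 + P C2)%E by exact: measureU2.
have mB12 : measurable (B1 `|` B2) by exact: measurableU.
have mB : measurable (B1 `|` B2 `|` B3) by exact: measurableU.
exists (~` (B1 `|` B2 `|` B3)); split; first exact: measurableC.
split.
  rewrite probability_setC//; apply: leeB => //.
  apply: (le_trans (U2 _ _ mB12 mB3)).
  rewrite P3 adde0; apply: (le_trans (U2 _ _ mB1 mB2)).
  rewrite [delta]splitr EFinD; apply: leeD; first exact: cnt.
  by apply: (le_trans corr); rewrite lee_fin.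
move=> t Gt.
have Zsph n : (n < N)%N -> sphere (W t (inl n)).1.
  move=> nN; apply: contrapT => hn; apply: Gt; right.
  have e : B3 = \bigcup_(n in `I_N) (Z n @^-1` (~` (S : set V))).
    exact: (esym (bigcup_mkord N (fun n => Z n @^-1` (~` (S : set V))))).
  by rewrite e; exists n.
have hM : (M <= (run q bs M v0 (W t) N).2)%N.
  by rewrite leqNgt; apply/negP => h; apply: Gt; left; left.
have hA : dist (run q bs M v0 (W t) N).1 u <= A K.
  by rewrite leNgt; apply/negP => h; apply: Gt; left; right.
have bsE k l : (k < K)%N -> (\sum_(i < k) ms i.+1 <= l < \sum_(i < k.+1) ms i.+1)%N ->
    bs l = b k.+1.
  by move=> kK hl; rewrite /bs (pos_round K0 ms0 kK hl).
have [v [j [e1 jN e2]]] := ap_rounds_run Zsph (leqnn _) hM bsE.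
have fr : run q bs M v0 (W t) N = (v, M).
  by rewrite (run_frozen jN) e2.
exists v, j; split => //.
  by have := run_sphere q M v01 bs0 (W t) N; rewrite fr.
by rewrite fr in hA.
Qed.

End Assembly.

(** * Failure budget of one round *)

Section Numerics.
Variable R : realType.
Implicit Types (x y : R).

Lemma ceil_natP x : 0 <= x -> x <= (ceil_nat x)%:R < x + 1.
Proof.
move=> x0; have /andP[h1 h2] := ceil_itv x.
have c0 : (0 <= Num.ceil x)%R by rewrite -(ler0z R); exact: le_trans x0 h2.
have h3 : (Num.ceil x - 1)%:~R = (Num.ceil x)%:~R - 1 :> R by rewrite intrD.
rewrite /ceil_nat natr_absz ger0_norm// h2 /=; lra.
Qed.

Lemma ln_le_sub1 x : 0 < x -> ln x <= x - 1.
Proof. by move=> x0; have := expR_ge1Dx (ln x); rewrite lnK ?posrE//; lra. Qed.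

Lemma ln_ge_inv x : 0 < x -> 1 - x^-1 <= ln x.
Proof.
move=> x0; have := ln_le_sub1 (_ : 0 < x^-1); rewrite invr_gt0 => /(_ x0).
by rewrite lnV ?posrE//; lra.
Qed.

(** The budget delta / (2 k) decreases by delta / (2 k (k + 1)) per round. As [expR (- L)] is delta
    / (k m), its cube beats the prefactor with a spare power of m. *)
Lemma exp_budget (k m : nat) (delta L : R) : (0 < k)%N -> 24 <= m%:R :> R -> 0 < delta < 1 ->
  L = ln (k%:R * m%:R / delta) ->
  (2 + 2 * m%:R) * expR (- (3 * L)) + delta / (2 * (k.+1)%:R) <= delta / (2 * k%:R).
Proof.
move=> k0 m24 /andP[d0 d1] LE.
have kR : 1 <= k%:R :> R by rewrite ler1n.
have k1 : 0 < k%:R :> R by lra.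
have m0 : 0 < m%:R :> R by lra.
have y0 : 0 < k%:R * m%:R / delta by rewrite divr_gt0// mulr_gt0.
have -> : expR (- (3 * L)) = (delta / (k%:R * m%:R)) ^+ 3.
  rewrite expRN expRM_natl LE lnK ?posrE// -exprVn invf_div//.
have -> : k.+1%:R = k%:R + 1 :> R by rewrite -natr1.
move: kR k1 m24 m0 {y0 LE k0}; move: (k%:R) (m%:R) => x z x1 x0 z24 z0.
have -> : delta / (2 * x) = delta / (2 * (x + 1)) + delta / (2 * x * (x + 1)).
  by field; rewrite !gt_eqF//; lra.
rewrite addrC lerD2l.
have -> : (delta / (x * z)) ^+ 3 = delta / x ^+ 2 * (delta ^+ 2 / (x * z ^+ 2)) / z.
  by field; rewrite !gt_eqF.
have h1 : delta ^+ 2 / (x * z ^+ 2) <= 16^-1.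
  rewrite ler_pdivrMr; last by rewrite mulr_gt0// exprn_gt0.
  have a1 : delta ^+ 2 <= 1 by apply: exprn_ile1 => //; exact: ltW.
  have a2 : 1 * (24 * 24) <= x * z ^+ 2 by apply: ler_pM => //; rewrite expr2; apply: ler_pM; lra.
  lra.
have q0 : 0 < delta / x ^+ 2 by rewrite divr_gt0// exprn_gt0.
have h2 : (2 + 2 * z) / z <= 4 by rewrite ler_pdivrMr//; lra.
have h3 : delta / x ^+ 2 / 4 <= delta / (2 * x * (x + 1)).
  have -> : delta / (2 * x * (x + 1)) = delta / x ^+ 2 * (x / (2 * (x + 1))).
    by field; rewrite !gt_eqF//; lra.
  apply: ler_wpM2l; first exact: ltW.
  by rewrite ler_pdivlMr ?mulr_gt0//; lra.
apply: le_trans h3.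
set Q := delta / x ^+ 2 in q0 *; set B := delta ^+ 2 / _ in h1 *.
have B0 : 0 <= B by rewrite divr_ge0 ?sqr_ge0// mulr_ge0 ?sqr_ge0// ltW.
have -> : (2 + 2 * z) * (Q * B / z) = Q * (B * ((2 + 2 * z) / z)) by field; rewrite gt_eqF.
apply: ler_wpM2l; first exact: ltW.
apply: (@le_trans _ _ (16^-1 * 4)); last lra.
apply: ler_pM => //; apply: divr_ge0; lra.
Qed.

Lemma power_le_exp (r : R) (m : nat) : r <= 1 -> (1 - r) ^+ m <= expR (- (r * m%:R)).
Proof.
move=> r1; rewrite -mulNr mulrC expRM_natl.
by apply: lerXn2r; rewrite ?nnegrE ?expR_ge0 ?subr_ge0//; have := expR_ge1Dx (- r).
Qed.

(** sqrt 2 is the chord of a right angle, and 12 is the factor between distance and disagreement. *)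
Definition round_radius (k : nat) : R := if k is 0 then Num.sqrt 2 else 2 ^- k / 12.

Lemma sqrt_bounds : [/\ Num.sqrt 2 <= 3 / 2 :> R, 17 / 10 <= Num.sqrt 3 :> R & 0 <= Num.sqrt 2 :> R].
Proof.
split; last exact: sqrtr_ge0.
  rewrite -ler_sqr ?nnegrE ?sqrtr_ge0//.
  rewrite sqr_sqrtr//; lra.
rewrite -ler_sqr ?nnegrE ?sqrtr_ge0//.
rewrite sqr_sqrtr//; lra.
Qed.

Lemma pow2V_le k : (2 ^- k.+1 : R) <= 2^-1.
Proof.
by rewrite lef_pV2 ?posrE ?exprn_gt0// exprS ler_pMr// exprn_ege1// ler1n.
Qed.

Lemma round_radius_bounds k : 0 <= round_radius k <= 3 / 2.
Proof.
have [s2 _ s0] := sqrt_bounds; case: k => [|k] /=; first by rewrite s0.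
have := pow2V_le k; have : 0 < (2 ^- k.+1 : R) by rewrite invr_gt0 exprn_gt0.
by move=> ? ?; apply/andP; split; lra.
Qed.

Lemma round_radius_pow k : round_radius k * 2 ^+ k.+1 <= 3.
Proof.
have [s2 _ s0] := sqrt_bounds; case: k => [|k] /=; first by rewrite expr1; lra.
rewrite [2 ^+ k.+2]exprS; have h : 0 < (2 ^+ k.+1 : R) by rewrite exprn_gt0.
have -> : 2 ^- k.+1 / 12 * (2 * 2 ^+ k.+1) = 6^-1 :> R by field; rewrite gt_eqF.
lra.
Qed.

(** The 24 in [lam] makes half of [lam] times the final radius equal to dd L, while [lam] times the
    initial radius is at most 72 dd L. A contraction of exp (- 73 dd L) therefore leaves exp (- dd
    L), at most exp (- 3 L) as dd >= 3. *)
Lemma round_budget (k m : nat) (dd delta L rho lam : R) : 24 <= m%:R :> R -> 0 < delta < 1 ->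
  3 <= dd -> L = ln (k.+1%:R * m%:R / delta) -> 0 < L -> rho <= 1 ->
  73 * dd * L <= rho * m%:R ->
  lam = 24 * 2 ^+ k.+1 * dd * L ->
  (1 - rho) ^+ m * expR (lam * (round_radius k - round_radius k.+1)) +
  expR (- (lam * (Num.sqrt 3 - round_radius k))) +
  2 * m%:R * expR (- (lam * round_radius k.+1 / 2)) + delta / (2 * k.+2%:R) <= delta / (2 * k.+1%:R).
Proof.
move=> m24 d01 dd3 LE L0 r1 hr lamE.
apply: le_trans (exp_budget (ltn0Sn k) m24 d01 LE); apply: lerD => //.
have [_ s3 _] := sqrt_bounds; have /andP[A0 A1] := round_radius_bounds k.
have hp := round_radius_pow k.
have P0 : 0 < (2 ^+ k.+1 : R) by rewrite exprn_gt0.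
have P2 : 2 <= (2 ^+ k.+1 : R) by rewrite exprS ler_peMr// exprn_ege1// ler1n.
have dL : 0 < dd * L by rewrite mulr_gt0//; lra.
have dL3 : 3 * L <= dd * L by rewrite ler_pM2r.
have e3 : lam * round_radius k.+1 / 2 = dd * L.
  by rewrite lamE /round_radius; field; rewrite gt_eqF.
have e1 : lam * (round_radius k - round_radius k.+1) <= 72 * (dd * L).
  have -> : lam * (round_radius k - round_radius k.+1) = 24 * (dd * L) * (round_radius k * 2 ^+ k.+1) -
      2 * (lam * round_radius k.+1 / 2) by rewrite lamE; field.
  rewrite e3; have : 24 * (dd * L) * (round_radius k * 2 ^+ k.+1) <= 24 * (dd * L) * 3.
    by apply: ler_wpM2l => //; lra.
  lra.
have e2 : dd * L <= lam * (Num.sqrt 3 - round_radius k).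
  have -> : lam * (Num.sqrt 3 - round_radius k) = 24 * (dd * L) * (2 ^+ k.+1 * (Num.sqrt 3 - round_radius k)).
    by rewrite lamE; ring.
  have : 24 * (dd * L) * (2 * (2 / 10)) <= 24 * (dd * L) * (2 ^+ k.+1 * (Num.sqrt 3 - round_radius k)).
    apply: ler_wpM2l; first lra.
    by apply: ler_pM => //; lra.
  lra.
have t1 : (1 - rho) ^+ m * expR (lam * (round_radius k - round_radius k.+1)) <= expR (- (3 * L)).
  apply: (@le_trans _ _ (expR (- (rho * m%:R)) * expR (lam * (round_radius k - round_radius k.+1)))).
    by apply: ler_wpM2r; [exact: expR_ge0|exact: power_le_exp].
  by rewrite -expRD ler_expR; lra.
have t2 : expR (- (lam * (Num.sqrt 3 - round_radius k))) <= expR (- (3 * L)).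
  by rewrite ler_expR; lra.
have t3 : 2 * m%:R * expR (- (lam * round_radius k.+1 / 2)) <= 2 * m%:R * expR (- (3 * L)).
  apply: ler_wpM2l; first lra.
  by rewrite e3 ler_expR; lra.
lra.
Qed.

End Numerics.

(** * Size of the two schedules *)

Section ScheduleBounds.
Variables (R : realType) (c1 c2 : R) (d : nat) (eta delta : R).
Hypotheses (d3 : (3 <= d)%N) (eta0 : 0 <= eta < 2^-1) (delta01 : 0 < delta < 1).
Hypotheses (c1_ge : 24 <= c1) (c2_gt0 : 0 < c2) (c2_le : c2 * (24 * 32) <= 1).
Let g := 1 - 2 * eta.
Let x := d%:R / g ^+ 2.
Let D : R := Num.sqrt d%:R.
Definition log_factor (k : nat) : R := ln (d%:R / (1 - 2 * eta) ^+ 2) + ln (k%:R / delta).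
Local Notation Lam := log_factor.
Local Notation ms := (m_sched c1 d eta delta).
Local Notation bk := (b_sched c1 c2 d eta delta).
Definition log_width (k : nat) : R := ln (k%:R * (ms k)%:R / delta).
Local Notation L := log_width.

Let g01 : 0 < g /\ g <= 1. Proof. by move: eta0 => /andP[? ?]; rewrite /g; split; lra. Qed.
Let delta0 : 0 < delta. Proof. by case/andP: delta01. Qed.

Let dR3 : 3 <= d%:R :> R. Proof. by rewrite ler_nat. Qed.

Lemma ratio_ge3 : 3 <= x.
Proof.
have [g0 g1] := g01; have dR := dR3; rewrite /x ler_pdivlMr ?exprn_gt0//.
have : g ^+ 2 <= 1 by apply: exprn_ile1 => //; exact: ltW.
lra.
Qed.

Lemma ln_ratio_ge : 2 / 3 <= ln x.
Proof.
have x3 := ratio_ge3; have x0 : 0 < x by lra.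
apply: le_trans (ln_ge_inv x0).
have : x^-1 <= 3^-1 by rewrite lef_pV2 ?posrE//; lra.
lra.
Qed.

Let kd k : (0 < k)%N -> 1 <= k%:R / delta.
Proof.
move=> k0; rewrite ler_pdivlMr// mul1r; case/andP: delta01 => _ d1.
by apply: (le_trans (ltW d1)); rewrite ler1n.
Qed.

Lemma log_factor_ge k : (0 < k)%N -> 2 / 3 <= Lam k.
Proof.
move=> k0; have := ln_ratio_ge; have := ln_ge0 (kd k0); rewrite /log_factor -/g -/x; lra.
Qed.

Lemma le_log_factor k k' : (0 < k)%N -> (k <= k')%N -> Lam k <= Lam k'.
Proof.
move=> k0 kk'; rewrite /log_factor lerD2l ler_ln ?posrE ?divr_gt0 ?ltr0n//; last first.
  exact: leq_trans kk'.
by rewrite ler_pM2r ?invr_gt0// ler_nat.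
Qed.

Let xLam k : (0 < k)%N -> 2 <= x * Lam k.
Proof.
move=> k0; have := log_factor_ge k0; have := ratio_ge3 => h1 h2.
have : 3 * (2 / 3) <= x * Lam k by apply: ler_pM => //; lra.
lra.
Qed.

Lemma m_sched_bounds k : (0 < k)%N ->
  [/\ 24 <= (ms k)%:R :> R, c1 * x * Lam k <= (ms k)%:R & (ms k)%:R <= 2 * c1 * x * Lam k].
Proof.
move=> k0; have h := xLam k0.
have c1g := c1_ge; have h1 : 24 * 2 <= c1 * (x * Lam k) by apply: ler_pM => //; lra.
have c0 : 0 <= c1 * x * Lam k by rewrite -mulrA; lra.
have /andP[m1 m2] := ceil_natP c0.
have e : ms k = ceil_nat (c1 * x * Lam k) by [].
rewrite mulrA in h1; have -> : 2 * c1 * x * Lam k = 2 * (c1 * x * Lam k) by rewrite !mulrA.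
rewrite e; split=> //; lra.
Qed.

(** ln m_k is at most ln (2 c1) + ln x + ln Lam, and ln Lam <= Lam; hence a multiple of [Lam] whose
    factor grows only logarithmically with [c1]. *)
Lemma log_width_bounds k : (0 < k)%N ->
  2^-1 <= L k /\ L k <= (2 + 2 * ln (2 * c1)) * Lam k.
Proof.
move=> k0; have [m24 m1 m2] := m_sched_bounds k0.
have k1 := kd k0; have l23 := log_factor_ge k0; have x3 := ratio_ge3.
have m0 : 0 < (ms k)%:R :> R by lra.
have LE : L k = ln (k%:R / delta) + ln (ms k)%:R.
  by rewrite /log_width mulrAC lnM ?posrE//; lra.
have c1g := c1_ge; have c10 : 1 <= 2 * c1 by lra.
have lc0 := ln_ge0 c10.
have k2 := ln_ge0 k1.
split.
  have h := ln_ge_inv m0; have : (ms k)%:R^-1 <= 24^-1 :> R by rewrite lef_pV2 ?posrE//; lra.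
  lra.
have hm : ln (ms k)%:R <= ln (2 * c1) + ln x + ln (Lam k).
  rewrite -!lnM ?posrE//; try lra; last by rewrite mulr_gt0; lra.
  by rewrite ler_ln ?posrE//; exact: lt_le_trans m0 m2.
have hl : ln (Lam k) <= Lam k by have := ln_le_sub1 (_ : 0 < Lam k); move=> /(_ ltac:(lra)); lra.
have e2 : Lam k = ln x + ln (k%:R / delta) by [].
have h3 : ln (2 * c1) * 1 <= ln (2 * c1) * (2 * Lam k) by apply: ler_wpM2l => //; lra.
lra.
Qed.

Let D0 : 0 < D. Proof. by rewrite sqrtr_gt0 ltr0n; exact: leq_trans d3. Qed.
Let DD : D ^+ 2 = d%:R. Proof. by rewrite sqr_sqrtr. Qed.

Lemma b_schedE k : bk k = c2 * 2 ^- k * g / (D * L k).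
Proof. by []. Qed.

Lemma b_sched_gt0 k : (0 < k)%N -> 0 < bk k.
Proof.
move=> k0; have [l0 _] := log_width_bounds k0; have [g0 _] := g01.
have L0 : 0 < L k by lra.
rewrite b_schedE; apply: divr_gt0; apply: mulr_gt0 => //.
by apply: mulr_gt0 => //; rewrite invr_gt0 exprn_gt0.
Qed.

Lemma b_sched_sqrt k : (0 < k)%N -> bk k * D = c2 * 2 ^- k * g / L k.
Proof.
move=> k0; have [l0 _] := log_width_bounds k0.
have L0 : 0 < L k by lra.
by rewrite b_schedE; field; rewrite !gt_eqF// exprn_gt0.
Qed.

Lemma b_sched_sqrt_le k : (0 < k)%N -> bk k * D <= 2 * c2 * 2 ^- k * g.
Proof.
move=> k0; have [l0 _] := log_width_bounds k0; have [g0 _] := g01.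
rewrite b_sched_sqrt// ler_pdivrMr; last lra.
have h : 0 <= c2 * 2 ^- k * g by rewrite !mulr_ge0 ?invr_ge0 ?exprn_ge0// ltW.
have : c2 * 2 ^- k * g * 2^-1 <= c2 * 2 ^- k * g * L k by apply: ler_wpM2l.
lra.
Qed.

Lemma b_sched_le k : (0 < k)%N -> bk k <= 2 ^- k / 12 / 8.
Proof.
move=> k0; have [g0 g1] := g01.
have p0 : 0 < (2 ^- k : R) by rewrite invr_gt0 exprn_gt0.
have D1 : 1 <= D by rewrite -[leLHS]sqrtr1 ler_sqrt// ler1n; exact: leq_trans d3.
have h1 : bk k * 1 <= bk k * D by apply: ler_wpM2l => //; exact: ltW (b_sched_gt0 k0).
have h2 := b_sched_sqrt_le k0.
have h3 : c2 * 2 ^- k * g <= c2 * 2 ^- k.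
  by rewrite ler_piMr// mulr_ge0// ltW.
have h4 : c2 * (24 * 32) * 2 ^- k <= 1 * 2 ^- k.
  by apply: ler_wpM2r; [exact: ltW|exact: c2_le].
lra.
Qed.

(** The logarithm in the width cancels the one in lambda, leaving ka ga sqrt d with ka = 24 c2. *)
Lemma lam_b_sched k : (0 < k)%N ->
  24 * 2 ^+ k * d%:R * L k * bk k = 24 * c2 * g * D.
Proof.
move=> k0; have [l0 _] := log_width_bounds k0.
have L0 : 0 < L k by lra.
by rewrite b_schedE -DD; field; rewrite !gt_eqF// exprn_gt0.
Qed.

End ScheduleBounds.

(** * Number of rounds and of draws *)

Section RoundCount.
Variable R : realType.

Lemma ln2_bounds : 2^-1 <= ln (2 : R) <= 1.
Proof.
have h1 := ln_ge_inv (ltr0n R 2); have h2 := ln_le_sub1 (ltr0n R 2).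
apply/andP; split; lra.
Qed.

Lemma k0_bounds (eps : R) : 0 < eps < 1 ->
  [/\ (0 < k0 eps)%N, 2 ^- k0 eps <= eps, 2 ^+ k0 eps <= 2 / eps &
    (k0 eps)%:R <= 2 * ln (1 / eps) + 1].
Proof.
move=> /andP[e0 e1]; have /andP[l2a l2b] := ln2_bounds.
have l20 : 0 < ln 2 :> R by lra.
have i0 : 0 < 1 / eps by rewrite divr_gt0.
have E0 : 0 < ln (1 / eps) by rewrite ln_gt0// ltr_pdivlMr// mul1r.
have q0 : 0 < ln (1 / eps) / ln 2 by rewrite divr_gt0.
have /andP[h1 h2] := ceil_natP (ltW q0).
rewrite -/(k0 eps) in h1 h2.
have pE : 2 ^+ k0 eps = expR ((k0 eps)%:R * ln 2) :> R.
  by rewrite expRM_natl lnK// posrE.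
have ie : expR (ln (1 / eps)) = 1 / eps by rewrite lnK// posrE.
have g1 : 1 / eps <= 2 ^+ k0 eps.
  by rewrite pE -ie ler_expR -ler_pdivrMr.
split.
- by rewrite -(ltr0n R); exact: lt_le_trans q0 h1.
- by rewrite -[leRHS]invrK lef_pV2 ?posrE ?exprn_gt0 ?invr_gt0// -div1r.
- have -> : 2 / eps = expR (ln (1 / eps) + ln 2) by rewrite expRD ie lnK ?posrE//; field; rewrite gt_eqF.
  rewrite pE ler_expR.
  have : (k0 eps)%:R * ln 2 <= (ln (1 / eps) / ln 2 + 1) * ln 2 by apply: ler_wpM2r; exact: ltW.
  by rewrite mulrDl divfK ?gt_eqF// [1 * ln 2]mul1r.
- move: h2 E0; move: (k0 eps)%:R (ln (1 / eps)) => k E h2 E0; clear h1 i0 q0 pE ie g1; have : E / ln 2 <= 2 * E.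
    rewrite ler_pdivrMr//; have : E * 1 <= E * (2 * ln 2) by apply: ler_wpM2l; lra.
    lra.
  lra.
Qed.

(* With l_N the label count after N draws, E[2^(M - l_N)] <= (1 - p/2)^N 2^M bounds P(l_N < M). *)
Lemma draws_bound (p delta : R) (M : nat) : 0 < p <= 1 -> 0 < delta < 1 -> (0 < M)%N ->
  ln (1 / delta) <= M%:R ->
  exists N : nat, [/\ (1 - p / 2) ^+ N * 2 ^+ M <= delta / 2, N%:R <= 7 * M%:R / p &
    M%:R <= 7 * M%:R / p].
Proof.
move=> /andP[p0 p1] /andP[d0 d1] M0 hM; have /andP[l2a l2b] := ln2_bounds.
have M1 : 1 <= M%:R :> R by rewrite ler1n.
have ld : ln (2 / delta) = ln 2 + ln (1 / delta).
  by rewrite -lnM ?posrE ?divr_gt0// mulrA mulr1.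
have hd : 0 <= ln (1 / delta) by rewrite ln_ge0// ler_pdivlMr// mul1r ltW.
have pV : 1 <= p^-1 by rewrite invf_ge1.
have P0 : 0 <= p^-1 by lra.
(* N = 2 X / p rounded up gives (1 - p/2)^N <= exp (- X), hence the bound delta / 2. As X <= 3 M,
   the factor is 7 = 2 * 3 + 1, the 1 paying for the rounding. *)
pose X := M%:R + ln (2 / delta).
have X0 : 0 <= X by rewrite /X ld; lra.
have X3 : X <= 3 * M%:R by rewrite /X ld; lra.
have Y0 : 0 <= 2 * X / p by rewrite divr_ge0 ?mulr_ge0// ltW.
have /andP[n1 n2] := ceil_natP Y0.
exists (ceil_nat (2 * X / p)); move: (ceil_nat _) n1 n2 => N n1 n2; split.
- have h1 : (1 - p / 2) ^+ N <= expR (- (p / 2 * N%:R)) by apply: power_le_exp; lra.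
  have h2 : 2 ^+ M <= expR (M%:R) :> R.
    have -> : M%:R = M%:R * 1 :> R by rewrite mulr1.
    rewrite expRM_natl; apply: lerXn2r; rewrite ?nnegrE ?expR_ge0//.
    by have := expR_ge1Dx (1 : R); lra.
  have h3 : X <= p / 2 * N%:R.
    have : p / 2 * (2 * X / p) <= p / 2 * N%:R by apply: ler_wpM2l => //; lra.
    by rewrite (_ : p / 2 * (2 * X / p) = X)//; field; rewrite gt_eqF.
  have q0 : 0 <= 1 - p / 2 by lra.
  apply: (@le_trans _ _ (expR (- (p / 2 * N%:R)) * expR M%:R)).
    by apply: ler_pM; rewrite ?exprn_ge0.
  have -> : delta / 2 = expR (- ln (2 / delta)).
    by rewrite expRN lnK ?posrE ?divr_gt0// invf_div.
  by rewrite -expRD ler_expR; rewrite /X in h3; lra.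
- have : 1 * 1 <= M%:R * p^-1 by apply: ler_pM.
  have : X * p^-1 <= 3 * M%:R * p^-1 by apply: ler_wpM2r.
  lra.
- have : M%:R * 1 <= M%:R * p^-1 by apply: ler_wpM2l; lra.
  have : 0 <= M%:R * p^-1 by rewrite mulr_ge0//; lra.
  lra.
Qed.

End RoundCount.

(** * Numbers of labels and of draws against the stated bounds *)

Section CostBounds.
Variables (R : realType) (c1 c2 cb : R) (d : nat) (eta delta : R).
Hypotheses (d3 : (3 <= d)%N) (eta0 : 0 <= eta < 2^-1) (delta01 : 0 < delta < 1).
Hypotheses (c1_ge : 24 <= c1) (c2_gt0 : 0 < c2) (c2_le : c2 * (24 * 32) <= 1).
Hypothesis cb01 : 0 < cb <= 1.
Local Notation g := (1 - 2 * eta).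
Local Notation x := (d%:R / (1 - 2 * eta) ^+ 2).
Local Notation D := (Num.sqrt d%:R : R).
Local Notation ms := (m_sched c1 d eta delta).
Local Notation bk := (b_sched c1 c2 d eta delta).
Local Notation Lam := (log_factor d eta delta).
Local Notation M K := (\sum_(k < K) ms k.+1)%N.
Local Notation cL := (2 + 2 * ln (2 * c1)).

Let g01 : 0 < g /\ g <= 1. Proof. by move: eta0 => /andP[? ?]; split; lra. Qed.
Let cL2 : 2 <= cL.
Proof. have h : 0 <= ln (2 * c1) by rewrite ln_ge0//; have := c1_ge; lra. by lra. Qed.

Lemma total_labels_le K : (0 < K)%N -> (M K)%:R <= K%:R * (2 * c1 * x * Lam K).
Proof.
move=> K0; rewrite natr_sum.
have -> : K%:R * (2 * c1 * x * Lam K) = \sum_(k < K) (2 * c1 * x * Lam K).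
  by rewrite sumr_const card_ord mulr_natl.
apply: ler_sum => k _.
have [_ _ h] := m_sched_bounds d3 eta0 delta01 c1_ge (ltn0Sn k).
apply: (le_trans h); apply: ler_wpM2l; last by apply: le_log_factor => //; exact: ltn_ord.
have := c1_ge; have := ratio_ge3 d3 eta0; move: (x) => z ? ?.
by rewrite !mulr_ge0//; lra.
Qed.

(** Lets [draws_bound] absorb ln (1 / delta) into the number of labels. *)
Lemma total_labels_ge K : (0 < K)%N -> (0 < M K)%N /\ ln (1 / delta) <= (M K)%:R.
Proof.
case: K => // K _; rewrite big_ord_recr /=.
have [h1 h2 _] := m_sched_bounds d3 eta0 delta01 c1_ge (ltn0Sn K).
split.
  rewrite addn_gt0; apply/orP; right; rewrite -(ltr0n R); move: (ms K.+1)%:R h1 => z ?; lra.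
rewrite natrD; apply: (@le_trans _ _ (ms K.+1)%:R); last by rewrite lerDr ler0n.
apply: le_trans h2.
have l0 := log_factor_ge d3 eta0 delta01 (ltn0Sn K).
have x3 := ratio_ge3 d3 eta0; have lx := ln_ratio_ge d3 eta0.
have h : ln (1 / delta) <= Lam K.+1.
  rewrite /log_factor; have : ln (1 / delta) <= ln (K.+1%:R / delta).
    have /andP[dl0 _] := delta01.
    by rewrite ler_ln ?posrE ?divr_gt0// ler_pM2r ?invr_gt0// ler1n.
  move: (ln (1 / delta)) (ln (K.+1%:R / delta)) (ln x) lx => a b c lx ab; lra.
apply: (le_trans h); rewrite ler_peMl//; first by lra.
have c1g := c1_ge; move: (x) x3 => z x3.
have : 1 * 1 <= c1 * z by apply: ler_pM => //; lra.
lra.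
Qed.

(* A lower bound, valid in every round up to K, of the probability that a point falls in the band. *)
Definition draw_rate (K : nat) : R := cb * c2 * 2 ^- K * g / (cL * Lam K).

Lemma draw_rate_gt0 K : (0 < K)%N -> 0 < draw_rate K.
Proof.
move=> K0; have l0 := log_factor_ge d3 eta0 delta01 K0; have := cL2; have [g0 _] := g01.
have /andP[cb0 _] := cb01.
rewrite /draw_rate; move: (cL) (Lam K) l0 => z a l0 z2; rewrite divr_gt0 ?mulr_gt0 ?invr_gt0 ?exprn_gt0//; lra.
Qed.

Lemma draw_rateV K : (0 < K)%N ->
  (draw_rate K)^-1 = cL / (cb * c2 * g) * (Lam K * 2 ^+ K).
Proof.
move=> K0; have l0 := log_factor_ge d3 eta0 delta01 K0; have z2 := cL2; have [g0 _] := g01.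
have /andP[cb0 _] := cb01; have P0 : 0 < (2 ^+ K : R) by rewrite exprn_gt0.
rewrite /draw_rate; move: (2 ^+ K) (Lam _) (cL) P0 l0 z2 => t a z P0 l0 z2.
by field; rewrite !gt_eqF//; lra.
Qed.

Lemma draw_rate_le K k : (0 < k <= K)%N -> draw_rate K <= cb * (bk k * D).
Proof.
move=> /andP[k0 kK]; rewrite (b_sched_sqrt c2 d3 eta0 delta01 c1_ge)//.
have K0 := leq_trans k0 kK.
have [l0 l1] := log_width_bounds d3 eta0 delta01 c1_ge k0.
have lk := log_factor_ge d3 eta0 delta01 k0.
have lkK := le_log_factor d eta delta01 k0 kK.
have z2 := cL2; have [g0 _] := g01; have /andP[cb0 _] := cb01.
rewrite /draw_rate -!mulrA; apply: ler_wpM2l; first exact: ltW.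
apply: ler_wpM2l; first exact: ltW.
rewrite !mulrA; apply: ler_pM.
- by rewrite mulr_ge0 ?invr_ge0 ?exprn_ge0// ltW.
- rewrite invr_ge0 mulr_ge0//; lra.
- apply: ler_wpM2r; first exact: ltW.
  by rewrite lef_pV2 ?posrE ?exprn_gt0// ler_weXn2l// ler1n.
- rewrite lef_pV2 ?posrE ?mulr_gt0//; try lra.
  apply: (le_trans l1); apply: ler_wpM2l => //; lra.
Qed.

Lemma draw_rate_le1 K : (0 < K)%N -> draw_rate K <= 1.
Proof.
move=> K0; apply: (@le_trans _ _ (cb * (bk 1 * D))); first by apply: draw_rate_le; rewrite K0.
have h := b_sched_sqrt_le d3 eta0 delta01 c1_ge c2_gt0 (ltn0Sn 0).
have h0 := b_sched_gt0 d3 eta0 delta01 c1_ge c2_gt0 (ltn0Sn 0).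
have D0 : 0 <= D := sqrtr_ge0 _.
have [g0 g1] := g01; have /andP[cb0 cb1] := cb01.
have a : c2 * g <= c2 by rewrite ler_piMr// ltW.
have c2l := c2_le.
have e : 2 * c2 * 2 ^- 1 * g = c2 * g by rewrite expr1; field.
rewrite e in h.
have : cb * (bk 1 * D) <= 1 * (bk 1 * D) by apply: ler_wpM2r => //; rewrite mulr_ge0// ltW.
move: (bk 1 * D) (c2 * g) h a => ? ? ? ?; lra.
Qed.

(** For eps <= 1/e, ln (1/eps) >= 1 and ln (ln (1/eps)) >= 0, so no summand of [LL] is negative. The
    4 lets three copies of ln x >= 2/3 absorb ln 3, which comes from the number of rounds. *)
Lemma log_factor_k0 (eps : R) : 0 < eps <= expR (-1) ->
  [/\ 2 / 3 <= LL d eta eps delta, Lam (k0 eps) <= 4 * LL d eta eps delta,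
    1 <= ln (1 / eps) & (k0 eps)%:R <= 3 * ln (1 / eps)].
Proof.
move=> /andP[e0 e1].
have eps01 : 0 < eps < 1 by rewrite e0 (le_lt_trans e1)// expR_lt1 oppr_lt0.
have [K0 _ _ hK] := k0_bounds eps01.
have E1 : 1 <= ln (1 / eps).
  rewrite -[leLHS](expRK 1) ler_ln ?posrE ?divr_gt0 ?expR_gt0// div1r -[leLHS]invrK -expRN.
  by rewrite lef_pV2 ?posrE ?expR_gt0.
have lx := ln_ratio_ge d3 eta0.
have /andP[dl0 dl1] := delta01.
have ld : 0 <= ln (1 / delta) by rewrite ln_ge0// ler_pdivlMr// mul1r ltW.
have lE : 0 <= ln (ln (1 / eps)) by rewrite ln_ge0.
have l23 : 2 / 3 <= LL d eta eps delta.
  rewrite /LL; move: (ln x) (ln (1 / delta)) (ln (ln _)) lx ld lE => ? ? ? ? ? ?; lra.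
have K3 : (k0 eps)%:R <= 3 * ln (1 / eps).
  by move: (k0 eps)%:R (ln _) hK E1 => ? ? ? ?; lra.
split=> //.
have hL : ln ((k0 eps)%:R / delta) = ln (k0 eps)%:R + ln (1 / delta).
  by rewrite -lnM ?posrE ?divr_gt0 ?ltr0n// mulrA mulr1.
have h3 : ln 3 <= 2 :> R by have := ln_le_sub1 (ltr0n R 3); lra.
have hk : ln (k0 eps)%:R <= ln 3 + ln (ln (1 / eps)).
  have E0 : 0 < ln (1 / eps) by exact: lt_le_trans E1.
  by rewrite -lnM ?posrE// ler_ln ?posrE ?mulr_gt0// ltr0n.
rewrite /log_factor hL; move: l23; rewrite /LL.
move: (ln x) (ln (1 / delta)) (ln (ln _)) (ln (k0 eps)%:R) (ln 3) lx ld lE hk h3 => ? ? ? ? ? ? ? ? ? ? ?; lra.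
Qed.

Lemma query_cost (eps : R) : 0 < eps <= expR (-1) ->
  (M (k0 eps))%:R <= 24 * c1 * query_bound d eta eps delta.
Proof.
move=> he; have [l23 lam4 E1 K3] := log_factor_k0 he.
have K0 : (0 < k0 eps)%N.
  have /andP[e0 e1] := he.
  by have [] := @k0_bounds R eps; rewrite ?e0 ?(le_lt_trans e1)// expR_lt1 oppr_lt0.
apply: (le_trans (total_labels_le K0)); rewrite /query_bound.
have x3 := ratio_ge3 d3 eta0; have c1g := c1_ge.
have lam0 := log_factor_ge d3 eta0 delta01 K0.
move: (x) (LL _ _ _ _) (ln (1 / eps)) (Lam _) (k0 eps)%:R x3 l23 lam4 E1 K3 lam0 (ler0n R (k0 eps)).
move=> z l E a k x3 l23 lam4 E1 K3 lam0 k1.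
have cz : 0 <= 2 * c1 * z by rewrite !mulr_ge0//; lra.
have -> : 24 * c1 * (z * E * l) = (3 * E) * (2 * c1 * z * (4 * l)) by ring.
apply: ler_pM => //; last by apply: ler_wpM2l.
by rewrite mulr_ge0//; lra.
Qed.

Lemma draw_cost (eps : R) : 0 < eps <= expR (-1) ->
  7 * (M (k0 eps))%:R / draw_rate (k0 eps) <=
  1344 * c1 * cL / (cb * c2) * unlabeled_bound d eta eps delta.
Proof.
move=> he; have [l23 lam4 E1 K3] := log_factor_k0 he; have hq := query_cost he.
have /andP[e0 e1] := he.
have [|K0 _ hK _] := @k0_bounds R eps; first by rewrite e0 (le_lt_trans e1)// expR_lt1 oppr_lt0.
have lam0 := log_factor_ge d3 eta0 delta01 K0.
move: (k0 eps) K0 lam0 lam4 K3 hq hK => K K0 lam0 lam4 K3 hq hK.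
have z2 := cL2; have [g0 _] := g01; have /andP[cb0 _] := cb01; have c1g := c1_ge.
rewrite (draw_rateV K0).
(* 1344 = 7 * 24 * 4 * 2: draws against labels, labels against [query_bound], [Lam] against [LL],
   and 2^K against 1 / eps. *)
have -> : 1344 * c1 * cL / (cb * c2) * unlabeled_bound d eta eps delta =
    7 * (24 * c1 * query_bound d eta eps delta) *
    (cL / (cb * c2 * g) * (4 * LL d eta eps delta * (2 / eps))).
  rewrite /unlabeled_bound /query_bound; move: (LL _ _ _ _) (ln (1 / eps)) (cL) => l E z.
  by field; rewrite !gt_eqF.
have P0 : 0 <= (2 ^+ K : R) by rewrite exprn_ge0.
have M0 : 0 <= (M K)%:R :> R by rewrite ler0n.
have C0 : 0 <= cL / (cb * c2 * g).
  by have c20 := c2_gt0; move: (cL) z2 => z z2; rewrite divr_ge0 ?mulr_ge0//; lra.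
move: (cL / _) (2 ^+ K) (M _)%:R (query_bound _ _ _ _) (LL _ _ _ _) (Lam _)
  C0 P0 M0 hq hK l23 lam4 lam0 => z t m Q l a C0 P0 M0 hq hK l23 lam4 lam0.
apply: ler_pM.
- lra.
- by rewrite !mulr_ge0//; lra.
- lra.
- by apply: ler_wpM2l => //; apply: ler_pM => //; lra.
Qed.

End CostBounds.

(* The factor of the band-probability bound [pb] of [good_event] at its values of be and Ab. *)
Definition band_const (R : realType) : R := (8 * (4 * (4 * 1536)))^-1 / (34 * (16 * (4 * (4 * 1536))) ^+ 2).

Lemma band_const01 (R : realType) : 0 < band_const R <= 1.
Proof.
have z1 : 1 <= 4 * (4 * 1536) :> R by lra.
rewrite /band_const; move: (4 * (4 * 1536)) z1 => z z1.
have w0 : 0 < 34 * (16 * z) ^+ 2 by rewrite mulr_gt0 ?exprn_gt0//; lra.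
apply/andP; split; first by rewrite divr_gt0// invr_gt0; lra.
have X2 : 1 <= (16 * z) ^+ 2 by rewrite exprn_ege1//; lra.
rewrite ler_pdivrMr// mul1r; move: ((16 * z) ^+ 2) X2 => y y1.
apply: (@le_trans _ _ 1); last by lra.
by rewrite invf_le1; lra.
Qed.

(** [c2] is fixed first, by the exponential moments; [c1] must then dominate its own logarithm. With
    c1 = s^2 one has ln (2 c1) <= 2 s - 1, and s = 292 * 4 * 1024 / (24 c2) reduces the last
    inequality to 73 * 4 s <= 292 s. *)
Lemma schedule_constants (R : realType) : exists c1 c2 : R,
  [/\ 24 <= c1, 0 < c2, 96 * c2 * (12 * 1024) <= 1,
      24 * c2 * (24 * expR 1 * (2 * expR 16)) * (8 * 1024) <= 1 &
      73 * (2 + 2 * ln (2 * c1)) <= 24 * c2 / (4 * 1024) * c1].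
Proof.
have e1 : 1 <= expR 1 :> R by have := expR_ge1Dx (1 : R); lra.
have e16 : 1 <= expR 16 :> R by have := expR_ge1Dx (16 : R); lra.
have e17 : 1 <= expR 1 * expR 16 :> R.
  have : 1 * 1 <= expR 1 * expR 16 :> R by apply: ler_pM.
  lra.
move: (expR 1 : R) (expR 16 : R) e1 e16 e17 => x y x1 y1 xy1.
have [n nE] : exists n : R, n = 24 * 24 * 2 * (8 * 1024) by exists (24 * 24 * 2 * (8 * 1024)).
have n0 : 0 < n by lra.
pose c2 : R := n^-1 / (x * y).
have xy0 : 0 < x * y by lra.
have c20 : 0 < c2 by rewrite /c2 divr_gt0// invr_gt0.
have c2s : c2 <= n^-1.
  by rewrite /c2 ler_pdivrMr// ler_peMr// invr_ge0 ltW.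
have c2b : c2 * (24 * 24 * 2 * (8 * 1024)) <= 1.
  by rewrite -nE -ler_pdivlMr// div1r.
have c2e : 24 * c2 * (24 * x * (2 * y)) * (8 * 1024) <= 1.
  have e : c2 * n * (x * y) = 1 by rewrite /c2; field; rewrite !gt_eqF//; lra.
  by rewrite nE in e; clear -e; lra.
clearbody c2; clear -c20 c2b c2e.
have [s sE] : exists s : R, s * (24 * c2) = 292 * (4 * 1024).
  by exists (292 * (4 * 1024) / (24 * c2)); rewrite divfK// mulf_neq0 ?gt_eqF.
have s24 : 24 <= s.
  by rewrite -(@ler_pM2r _ (24 * c2)) ?sE; lra.
have s0 : 0 < s by lra.
exists (s ^+ 2), c2; split.
- have h : 24 * 1 <= s * s by clear -s24; apply: ler_pM; lra.
  by rewrite expr2; clear -h; lra.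
- by [].
- by lra.
- exact: c2e.
- rewrite expr2 mulrA lnM ?posrE ?mulr_gt0// lnM ?posrE//.
  have -> : 24 * c2 / (4 * 1024) * (s * s) = s * (24 * c2) * s / (4 * 1024) by field.
  rewrite sE; have l2 := ln_le_sub1 (ltr0n R 2); have ls := ln_le_sub1 s0.
  clear -l2 ls s0; lra.
Qed.

Lemma dist_le_sqrt2 (R : realType) (d : nat) (v u : 'rV[R]_d) : sphere v -> sphere u ->
  acos (dotv v u) <= pi / 2 -> dist v u <= Num.sqrt 2.
Proof.
move=> v1 u1 h.
have h1 : -1 <= dotv v u <= 1 by rewrite -ler_norml dotv_le1.
have h0 : 0 <= acos (dotv v u) by exact: acos_ge0.
have c0 : 0 <= dotv v u.
  rewrite -(@acosK _ (dotv v u)) ?in_itv//= cos_ge0_pihalf// h andbT (le_trans _ h0)//.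
  by rewrite oppr_le0 divr_ge0 ?pi_ge0.
by rewrite /dist ler_sqrt//; have := dist_sphere v1 u1; rewrite dist_sqr; lra.
Qed.

(** * The actual schedules meet the requirements of the good event *)

Section GoodEvent.
Context {R : realType} {d : nat} {dT : measure_display} {T : measurableType dT}.
Variables (P : probability T R) (Z : nat -> T -> 'rV[R]_d) (U : nat -> T -> R).
Hypothesis d3 : (3 <= d)%N.
Hypothesis unifZ : forall n, uniform_sphere_rv P (Z n).
Hypothesis lawU : forall n, uniform01_rv P (U n).
Hypothesis indep : mutually_independent P (stream_sigma Z U).
Variables (q : 'rV[R]_d -> R) (u v0 : 'rV[R]_d) (eta delta c1 c2 : R).
Hypotheses (v01 : sphere v0) (u1 : sphere u) (eta0 : 0 <= eta < 2^-1) (delta01 : 0 < delta < 1).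
Hypotheses (angle : acos (dotv v0 u) <= pi / 2) (law : cond_law q) (noise : bounded_noise eta u q).
Hypotheses (c1_ge : 24 <= c1) (c2_gt0 : 0 < c2) (c2_le : 96 * c2 * (12 * 1024) <= 1).
Hypothesis c2_exp : 24 * c2 * (24 * expR 1 * (2 * expR 16)) * (8 * 1024) <= 1.
Hypothesis c12 : 73 * (2 + 2 * ln (2 * c1)) <= 24 * c2 / (4 * 1024) * c1.
Local Notation ms := (m_sched c1 d eta delta).
Local Notation bk := (b_sched c1 c2 d eta delta).
Local Notation L := (log_width c1 d eta delta).
Local Notation g := (1 - 2 * eta).

Let g01 : 0 < g /\ g <= 1. Proof. by move: eta0 => /andP[? ?]; split; lra. Qed.
Let L0 k : (0 < k)%N -> 2^-1 <= L k.
Proof. by move=> k0; have [] := log_width_bounds d3 eta0 delta01 c1_ge k0. Qed.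
Let dR3 : 3 <= d%:R :> R. Proof. by rewrite ler_nat. Qed.
Let p2 k : 0 < (2 ^- k : R) <= 1.
Proof. by rewrite invr_gt0 exprn_gt0//= invf_le1 ?exprn_gt0// exprn_ege1// ler1n. Qed.

Let budget k : (1 - 24 * c2 * g ^+ 2 / (4 * 1024)) ^+ ms k.+1 *
    expR (24 * 2 ^+ k.+1 * d%:R * L k.+1 * (round_radius R k - round_radius R k.+1)) +
  expR (- (24 * 2 ^+ k.+1 * d%:R * L k.+1 * (Num.sqrt 3 - round_radius R k))) +
  2 * (ms k.+1)%:R * expR (- (24 * 2 ^+ k.+1 * d%:R * L k.+1 * round_radius R k.+1 / 2)) +
  delta / (2 * k.+2%:R) <= delta / (2 * k.+1%:R).
Proof.
have [m24 m1 m2] := m_sched_bounds d3 eta0 delta01 c1_ge (ltn0Sn k).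
have l0 := L0 (ltn0Sn k); have [g0 g1] := g01; have c20 := c2_gt0; have c2l := c2_le.
have [_ l1] := log_width_bounds d3 eta0 delta01 c1_ge (ltn0Sn k).
have a0 := log_factor_ge d3 eta0 delta01 (ltn0Sn k).
have gg : g ^+ 2 <= 1 by apply: exprn_ile1 => //; exact: ltW.
have gg0 : 0 < g ^+ 2 by rewrite exprn_gt0.
apply: (@round_budget R k (ms k.+1) d%:R delta (L k.+1)).
- by [].
- by [].
- exact: dR3.
- by [].
- by move: (L k.+1) l0 => l l0; lra.
- have : 24 * c2 * g ^+ 2 <= 24 * c2 * 1 by apply: ler_wpM2l => //; lra.
  move: (24 * c2 * g ^+ 2) => z zl; lra.
- set a := log_factor d eta delta k.+1 in m1 l1 a0.
  have h1 : 73 * d%:R * L k.+1 <= d%:R * a * (73 * (2 + 2 * ln (2 * c1))).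
    have -> : d%:R * a * (73 * (2 + 2 * ln (2 * c1))) =
      73 * d%:R * ((2 + 2 * ln (2 * c1)) * a) by ring.
    by apply: ler_wpM2l; [rewrite mulr_ge0 ?ler0n|exact: l1].
  apply: (le_trans h1).
  have h2 : d%:R * a * (73 * (2 + 2 * ln (2 * c1))) <= d%:R * a * (24 * c2 / (4 * 1024) * c1).
    apply: ler_wpM2l; last exact: c12.
    by rewrite mulr_ge0 ?ler0n//; lra.
  apply: (le_trans h2).
  have -> : d%:R * a * (24 * c2 / (4 * 1024) * c1) =
      24 * c2 * g ^+ 2 / (4 * 1024) * (c1 * (d%:R / g ^+ 2) * a).
    by field; rewrite gt_eqF.
  apply: ler_wpM2l; last exact: m1.
  move: (g ^+ 2) gg0 => z z0.
  have -> : 24 * c2 * z / (4 * 1024) = c2 * z * (24 / (4 * 1024)) by ring.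
  have : 0 <= c2 * z by rewrite mulr_ge0// ltW.
  move: (c2 * z) => y y0; lra.
- by [].
Qed.

Lemma good_run (K N : nat) : (0 < K)%N ->
  (1 - draw_rate c1 c2 (band_const R) d eta delta K / 2) ^+ N * 2 ^+ (\sum_(k < K) ms k.+1)%N
    <= delta / 2 ->
  exists G : set T, measurable G /\ (1 - delta%:E <= P G)%E /\
  forall t, G t -> exists (v : 'rV[R]_d) (j : nat),
    [/\ ap_rounds q (fun n => Z n t) (fun n => U n t) ms bk v0 K =
          Some (v, j, (\sum_(k < K) ms k.+1)%N),
      (j <= N)%N & disagreement v u <= 2 ^- K].
Proof.
move=> K0; have c20 := c2_gt0; have c2l := c2_le; have c1g := c1_ge; have [g0 g1] := g01.
have c2m : c2 * (24 * 32) <= 1 by lra.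
have bc := band_const01 R; have dd := dR3; have /andP[dl0 dl1] := delta01.
have bD k : (0 < k)%N -> bk k * Num.sqrt d%:R <= 2 * c2 * 2 ^- k * g.
  exact: b_sched_sqrt_le.
have bA k : (0 < k)%N -> bk k <= round_radius R k / 8.
  by case: k => // k _; exact: (b_sched_le d3 eta0 delta01 c1_ge c2_gt0 c2m).
have b0 k : (0 < k)%N -> 0 < bk k by exact: b_sched_gt0.
have [_ s3 s2] := sqrt_bounds R.
have mq : measurable_fun setT (q : vec R d -> R).
  by move=> _ B mB; rewrite setTI; exact: law.1.
have ms0 k : (0 < k)%N -> (0 < ms k)%N.
  move=> k0; have [m24 _ _] := m_sched_bounds d3 eta0 delta01 c1_ge k0.
  by rewrite -(ltr0n R); move: (ms k)%:R m24 => z z24; lra.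
have lam0 k : (0 < k)%N -> 0 < 24 * 2 ^+ k * d%:R * L k.
  move=> k0; have := L0 k0; move: (L k) => l l0.
  by rewrite !mulr_gt0 ?exprn_gt0//; lra.
have A3 k : 0 <= round_radius R k <= Num.sqrt 3.
  by have /andP[-> h] := round_radius_bounds R k; rewrite (le_trans h)//; lra.
have Sk0 k : 0 <= delta / (2 * k.+1%:R).
  by rewrite divr_ge0 ?mulr_ge0 ?ler0n// ltW.
have lamE k : (0 < k)%N -> 24 * 2 ^+ k * d%:R * L k * bk k = 24 * c2 * g * Num.sqrt d%:R.
  by move=> k0; exact: lam_b_sched.
have b2 k : (0 < k)%N -> bk k ^+ 2 <= 2^-1.
  move=> k0; have := bA k k0; have := b0 k k0; have /andP[r0 r1] := round_radius_bounds R k.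
  move: (bk k) (round_radius R k) r0 r1 => b r r0 r1 bp br.
  have h : b * b <= 2^-1 * 1 by apply: ler_pM; lra.
  by rewrite expr2; lra.
(* 96 = 2 * 12 * 4: the 2 bounds the inverse logarithm in the width, 12 and 4 come from the
   threshold A / 4 with A = 2^-k / 12. *)
have bnu k : (0 < k)%N -> bk k * Num.sqrt d%:R <= 96 * c2 * g * (round_radius R k / 4).
  case: k => // k k0; apply: (le_trans (bD k.+1 k0)); rewrite /round_radius.
  have -> : 96 * c2 * g * (2 ^- k.+1 / 12 / 4) = 2 * c2 * 2 ^- k.+1 * g by field; rewrite gt_eqF ?exprn_gt0.
  exact: lexx.
have bD4 k : (0 < k)%N -> bk k * Num.sqrt d%:R <= 4^-1.
  move=> k0; apply: (le_trans (bD k k0)); have /andP[q0 q1] := p2 k.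
  have : 2 ^- k * g <= 1 * 1 by apply: ler_pM => //; exact: ltW.
  have : 0 <= 2 ^- k * g by rewrite mulr_ge0// ltW.
  rewrite -!mulrA; move: (2 ^- k * g) => z z0 z1.
  have : c2 * z <= c2 * 1 by apply: ler_wpM2l => //; lra.
  by move=> ?; lra.
have p01 : 0 <= draw_rate c1 c2 (band_const R) d eta delta K <= 1.
  by rewrite (draw_rate_le1 d3 eta0 delta01 c1_ge c2_gt0 c2m bc K0)
    ltW// (draw_rate_gt0 d3 eta0 delta01 c1_ge c2_gt0 bc K0).
have pb k : (0 < k <= K)%N -> draw_rate c1 c2 (band_const R) d eta delta K <=
    band_const R * (bk k * Num.sqrt d%:R).
  exact: (draw_rate_le d3 eta0 delta01 c1_ge c2_gt0 bc).
have S00 : delta / (2 * 1%:R) <= delta / 2 by rewrite mulr1.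
have ka0 : 0 < 24 * c2 by lra.
have ka1 : 24 * c2 <= 2^-1 by lra.
have nu0 : 0 <= 96 * c2 by lra.
move=> hN.
have [G [mG [PG hG]]] := good_event (ltnW d3) unifZ lawU indep v01 u1 eta0 mq law.2 noise
  K0 ms0 ka0 c2_exp ka1 nu0 c2_le b0 lam0 A3 Sk0 lamE bA b2 bnu bD4 budget
  (dist_le_sqrt2 v01 u1 angle) erefl erefl p01 pb hN S00.
exists G; split=> //; split=> // t Gt; have [v [j [e jN v1 hd]]] := hG t Gt.
exists v, j; split=> //; apply: (le_trans (disagreement_le unifZ v1 u1)).
case: K K0 hd {hN hG e p01 pb} => // K _ /= hd.
by move: hd; rewrite ler_pdivlMr// mulrC.
Qed.

End GoodEvent.

Theorem theorem2 (R : realType) :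
  exists c1 c2 C eps0 : R,
    0 < c1 /\ 0 < c2 /\ 0 < C /\ 0 < eps0 < 1 /\
    forall (d : nat) (eta eps delta : R) (u v0 : 'rV[R]_d)
      (q : 'rV[R]_d -> R)
      (dT : measure_display) (T : measurableType dT) (P : probability T R)
      (Z : nat -> T -> 'rV[R]_d) (U : nat -> T -> R),
      (3 <= d)%N -> 0 <= eta < 1 / 2 -> 0 < eps < 1 -> 0 < delta < 1 ->
      sphere u -> sphere v0 -> 0 <= acos (dotv v0 u) <= pi / 2 ->
      cond_law q -> bounded_noise eta u q ->
      (forall n, uniform_sphere_rv P (Z n)) ->
      (forall n, uniform01_rv P (U n)) ->
      mutually_independent P (stream_sigma Z U) ->
      exists G : set T, measurable G /\ (1 - delta%:E <= P G)%E /\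
        forall w, G w ->
          exists (v : 'rV[R]_d) (j l : nat),
            ap_rounds q (fun n => Z n w) (fun n => U n w)
              (m_sched c1 d eta delta) (b_sched c1 c2 d eta delta) v0 (k0 eps)
              = Some (v, j, l) /\
            disagreement v u <= eps /\
            (eps <= eps0 ->
               l%:R <= C * query_bound d eta eps delta /\
               j%:R <= C * unlabeled_bound d eta eps delta /\
               run_time R d j l <= C * time_bound d eta eps delta).
Proof.
have [c1 [c2 [c1g c20 c2l c2e c12]]] := schedule_constants R.
have bc := band_const01 R; have /andP[bc0 _] := bc.
have c10 : 0 < c1 by lra.
have cl0 : 0 <= ln (2 * c1) by rewrite ln_ge0//; lra.
have [Cd [CdE Cd0]] : exists C : R,
    C = 1344 * c1 * (2 + 2 * ln (2 * c1)) / (band_const R * c2) /\ 0 <= C.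
  eexists; split; first by [].
  have w0 : 0 < band_const R * c2 by rewrite mulr_gt0.
  by apply: divr_ge0; [apply: mulr_ge0; lra|exact: ltW].
(* [24 * c1] serves the labels. The running time adds draws and labels, each at most [Cd] times
   [unlabeled_bound], whence [2 * Cd]. The threshold 1/e keeps ln (ln (1/eps)) nonnegative. *)
exists c1, c2, (24 * c1 + 2 * Cd), (expR (-1)).
split; first exact: c10.
split; first exact: c20.
split; first lra.
split; first by rewrite expR_gt0 expR_lt1 oppr_lt0 ltr01.
move=> d eta eps delta u v0 q dT T P Z U d3 eta0' eps01 delta01 u1 v01 /andP[_ angle].
move=> law noise unifZ unifU indep.
have eta0 : 0 <= eta < 2^-1 by move: eta0'; rewrite div1r.
have [K0 Keps _ _] := k0_bounds eps01.
have [M0 Mdelta] := total_labels_ge d3 eta0 delta01 c1g K0.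
have p01 : 0 < draw_rate c1 c2 (band_const R) d eta delta (k0 eps) <= 1.
  rewrite (draw_rate_gt0 d3 eta0 delta01 c1g c20 bc K0).
  by rewrite (draw_rate_le1 d3 eta0 delta01 c1g c20 _ bc K0)//; clear -c2l c20; lra.
have [N [hN N7 M7]] := draws_bound p01 delta01 M0 Mdelta.
have [G [mG [PG hG]]] := good_run d3 unifZ unifU indep v01 u1 eta0 delta01 angle law noise
  c1g c20 c2l c2e c12 K0 hN.
exists G; split=> //; split=> // w Gw; have [v [j [e jN dis]]] := hG w Gw.
exists v, j, (\sum_(k < k0 eps) m_sched c1 d eta delta k.+1)%N; split=> //.
split; first exact: le_trans Keps.
move=> epsle; have /andP[e0 e1] := eps01.
have he : 0 < eps <= expR (-1) by rewrite e0.
have hq := query_cost d3 eta0 delta01 c1g he.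
have hu := draw_cost d3 eta0 delta01 c1g c20 bc he.
rewrite -CdE in hu.
have [l23 _ E1 _] := log_factor_k0 d3 eta0 delta01 he.
have g0 : 0 < 1 - 2 * eta by move: eta0 => /andP[_ h]; clear -h; lra.
have dR0 : 0 <= d%:R :> R := ler0n _ _.
have hj := le_trans (_ : j%:R <= N%:R :> R) (le_trans N7 hu); rewrite ler_nat in hj; move: (hj jN) => {}hj.
have hM := le_trans M7 hu.
have q0 : 0 <= query_bound d eta eps delta.
  by rewrite /query_bound !mulr_ge0 ?invr_ge0 ?sqr_ge0//; clear -l23 E1; lra.
have u0 : 0 <= unlabeled_bound d eta eps delta.
  rewrite /unlabeled_bound; apply: mulr_ge0; last by clear -E1; lra.
  apply: mulr_ge0; last by rewrite divr_ge0 ?ler01 ?ltW.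
  by apply: mulr_ge0; [rewrite divr_ge0// exprn_ge0// ltW|exact: sqr_ge0].
have te : time_bound d eta eps delta = d%:R * unlabeled_bound d eta eps delta.
  by rewrite /time_bound /unlabeled_bound; field; rewrite !gt_eqF.
have Dq : 0 <= 2 * Cd * query_bound d eta eps delta by do 2 apply: mulr_ge0 => //.
have Du : 0 <= Cd * unlabeled_bound d eta eps delta by apply: mulr_ge0.
have cu : 0 <= c1 * unlabeled_bound d eta eps delta by apply: mulr_ge0 => //; exact: ltW.
split; first by apply: (le_trans hq); clear -Dq; lra.
split; first by apply: (le_trans hj); clear -Du cu; lra.
rewrite /run_time natrM natrD te mulrCA; apply: ler_wpM2l => //.
by apply: (le_trans (lerD hj hM)); clear -Du cu; lra.
Qed.
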